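(* For $n_1,n_2,n_3,n_4\ge 0$ write $$Q:=n_1^2+n_2^2+n_3^2+n_4^2-n_1n_2+n_2n_4,\qquad B:=\frac{1}{(q;q)_{n_1}}{n_1\brack n_2}_q{n_1\brack n_4}_q{n_2 \brack n_3}_q,$$ and let all sums below be over all integers $n_1,n_2,n_3,n_4\ge 0$. Then, as formal power series in $q$: \begin{align*} G_{(5,0,0)}(1,q) &= \sum q^{Q+n_1+n_2+n_3+n_4}\,B = \frac{1}{(q^2,q^3,q^3,q^4,q^4,q^5,q^5,q^6;q^8)_\infty};\\ G_{(4,1,0)}(1,q) &= \sum q^{Q+n_2+n_3+n_4}\,B \\ = G_{(4,0,1)}(1,q) &= \sum q^{Q+n_1+n_3}\left(1+q^{n_1+n_2+n_4+1}\right)B = \frac{1}{(q,q^2,q^3,q^4,q^4,q^5,q^6,q^7;q^8)_\infty};\\ G_{(3,0,2)}(1,q) &= \sum q^{Q+n_1}\left(1+q^{n_1+n_3+1}+q^{2n_1+n_2+n_3+n_4+2}\right)B\\ = G_{(3,2,0)}(1,q) &= \sum q^{Q+n_1}\left(q^{n_3}+q^{n_1+1}+q^{2n_1+n_3+2}+q^{3n_1+n_2+n_3+n_4+3}\right)B = \frac{1}{(q,q^2,q^2,q^3,q^5,q^6,q^6,q^7;q^8)_\infty};\\ G_{(3,1,1)}(1,q) &= \sum q^{Q+n_3}\,B = \frac{1}{(q,q,q^3,q^3,q^5,q^5,q^7,q^7;q^8)_\infty};\\ G_{(2,2,1)}(1,q) &= \sum q^{Q}\,B = \frac{1}{(q,q,q^2,q^4,q^4,q^6,q^7,q^7;q^8)_\infty}.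 \end{align*}
   Context: $q$-notation: for $n\in\mathbb{N}\cup\{\infty\}$, $(a;q)_n:=\prod_{k=0}^{n-1}(1-aq^k)$ and $(a_1,\dots,a_j;q)_n:=(a_1;q)_n\cdots(a_j;q)_n$. The $q$-binomial coefficient is ${m+n\brack m}_q:=\frac{(q;q)_{m+n}}{(q;q)_m(q;q)_n}$ for integers $m,n\ge0$, and $0$ otherwise; thus ${a\brack b}_q=0$ unless $0\le b\le a$. Cylindric partitions: let $c=(c_1,\dots,c_k)$ be a sequence of nonnegative integers with positive sum. A partition is a finite (possibly empty) non-increasing sequence of positive integers $\lambda_1\ge\lambda_2\ge\dots\ge\lambda_s$, with the convention $\lambda_j=0$ for $j>s$. A cylindric partition with profile $c$ is a vector of partitions $\Lambda=(\lambda^{(1)},\dots,\lambda^{(k)})$ such that for all $j\ge1$: $\lambda^{(i)}_j\ge\lambda^{(i+1)}_{j+c_{i+1}}$ for $1\le i\le k-1$, and $\lambda^{(k)}_j\ge\lambda^{(1)}_{j+c_1}$. Its size $|\Lambda|$ is the sum of all parts of all the $\lambda^{(i)}$, and $\max(\Lambda)$ is the largest part occurring among all the $\lambda^{(i)}$ ($0$ if all are empty). Let $\mathcal{P}_c$ be the set of cylindric partitions with profile $c$, and define $$F_c(z,q):=\sum_{\Lambda\in\mathcal{P}_c}z^{\max(\Lambda)}q^{|\Lambda|},\qquad G_c(z,q):=(zq;q)_\infty F_c(z,q).$$ These are formal power series in $q$ whose coefficients are polynomials in $z$, so they can be evaluated at $z=1$. *)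

(* Defs.v *)
From HB Require Import structures.
From mathcomp Require Import all_boot all_order all_algebra.
From mathcomp Require Import all_classical.

Set Implicit Arguments.
Unset Strict Implicit.
Unset Printing Implicit Defensive.
Import GRing.Theory.
Local Open Scope classical_set_scope.
Local Open Scope ring_scope.

Record fps (R : Type) := Fps { fcoef : nat -> R }.

Reserved Notation "f ``_ n" (at level 3, n at level 2, left associativity,
  format "f ``_ n").
Notation "f ``_ n" := (fcoef f n) : ring_scope.

HB.instance Definition _ (R : Type) := gen_eqMixin (fps R).
HB.instance Definition _ (R : Type) := gen_choiceMixin (fps R).

Lemma fpsP (R : Type) (f g : fps R) : (forall n, f``_n = g``_n) <-> f = g.
Proof.
split=> [|->//]; case: f => f; case: g => g /= fg; congr Fps.
exact/funext.
Qed.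

Section Ring.
Variable R : comNzRingType.
Implicit Types f g h : fps R.

Definition fps_zero : fps R := Fps (fun=> 0).
Definition fps_opp f := Fps (fun n => - f``_n).
Definition fps_add f g := Fps (fun n => f``_n + g``_n).
Definition fps_const (a : R) : fps R := Fps (fun n => if n == 0 then a else 0).
Definition fps_mul f g := Fps (fun n => \sum_(i < n.+1) f``_i * g``_(n - i)).

Lemma fps_addA : associative fps_add.
Proof. by move=> f g h; apply/fpsP => n /=; rewrite addrA. Qed.
Lemma fps_addC : commutative fps_add.
Proof. by move=> f g; apply/fpsP => n /=; rewrite addrC. Qed.
Lemma fps_add0 : left_id fps_zero fps_add.
Proof. by move=> f; apply/fpsP => n /=; rewrite add0r. Qed.
Lemma fps_addN : left_inverse fps_zero fps_opp fps_add.
Proof. by move=> f; apply/fpsP => n /=; rewrite addNr. Qed.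

HB.instance Definition _ :=
  GRing.isZmodule.Build (fps R) fps_addA fps_addC fps_add0 fps_addN.

Definition fps_trunc (n : nat) f : {poly R} := \poly_(i < n.+1) f``_i.

Lemma fps_truncE n f i : (i <= n)%N -> (fps_trunc n f)`_i = f``_i.
Proof. by move=> le_in; rewrite coef_poly ltnS le_in. Qed.

Lemma fps_mulE n f g i : (i <= n)%N ->
  (fps_mul f g)``_i = (fps_trunc n f * fps_trunc n g)`_i.
Proof.
move=> le_in; rewrite coefM /=; apply: eq_bigr => j _.
rewrite !fps_truncE //; first by rewrite (leq_trans (leq_subr _ _)).
by rewrite (leq_trans _ le_in) // -ltnS.
Qed.

Lemma fps_mulC : commutative fps_mul.
Proof.
by move=> f g; apply/fpsP => n; rewrite !(@fps_mulE n) // mulrC.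
Qed.

Lemma fps_mulA : associative fps_mul.
Proof.
have aux n f g h : (fps_mul f (fps_mul g h))``_n =
    (fps_trunc n f * (fps_trunc n g * fps_trunc n h))`_n.
  rewrite (@fps_mulE n) // coefM [RHS]coefM; apply: eq_bigr => i _.
  by rewrite [X in _ * X]fps_truncE ?leq_subr // (@fps_mulE n) ?leq_subr.
move=> f g h; apply/fpsP => n.
by rewrite aux fps_mulC aux mulrA mulrC.
Qed.

Lemma fps_mul1 : left_id (fps_const 1) fps_mul.
Proof.
move=> f; apply/fpsP => n /=; rewrite big_ord_recl /= subn0 mul1r.
by rewrite big1 ?addr0 // => i _; rewrite mul0r.
Qed.

Lemma fps_mulDl : left_distributive fps_mul fps_add.
Proof.
move=> f g h; apply/fpsP => n /=; rewrite -big_split /=.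
by apply: eq_bigr => i _; rewrite mulrDl.
Qed.

Lemma fps_oner_neq0 : fps_const 1 != 0 :> fps R.
Proof.
by apply/eqP => /fpsP/(_ 0%N) /= /eqP; rewrite oner_eq0.
Qed.

HB.instance Definition _ := GRing.Zmodule_isComNzRing.Build (fps R)
  fps_mulA fps_mulC fps_mul1 fps_mulDl fps_oner_neq0.

Lemma fps0E n : (0 : fps R)``_n = 0. Proof. by []. Qed.
Lemma fps1E n : (1 : fps R)``_n = (n == 0)%:R. Proof. by case: n. Qed.
Lemma fpsDE f g n : (f + g)``_n = f``_n + g``_n. Proof. by []. Qed.
Lemma fpsNE f n : (- f)``_n = - f``_n. Proof. by []. Qed.
Lemma fpsME f g n : (f * g)``_n = \sum_(i < n.+1) f``_i * g``_(n - i).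
Proof. by []. Qed.

Lemma fps_sumE (I : Type) (r : seq I) (P : pred I) (F : I -> fps R) n :
  (\sum_(i <- r | P i) F i)``_n = \sum_(i <- r | P i) (F i)``_n.
Proof. by elim/big_rec2: _ => // i y x _ <-. Qed.

Lemma fps_constM a f n : (fps_const a * f)``_n = a * f``_n.
Proof.
rewrite fpsME big_ord_recl /= subn0 big1 ?addr0 // => i _.
by rewrite mul0r.
Qed.

(** A product vanishes below the sum of the orders of its factors. *)
Lemma fps_mul_low f g a b n : (forall i, (i < a)%N -> f``_i = 0) ->
  (forall i, (i < b)%N -> g``_i = 0) -> (n < a + b)%N -> (f * g)``_n = 0.
Proof.
move=> f0 g0 lt_n; rewrite fpsME big1 // => i _.
have [lt_ia|le_ai] := ltnP i a; first by rewrite f0 ?mul0r.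
rewrite g0 ?mulr0 // ltn_subLR; last by rewrite -ltnS.
by rewrite (leq_trans lt_n) // leq_add2r.
Qed.

Lemma fps_exp_low f k n : f``_0 = 0 -> (n < k)%N -> (f ^+ k)``_n = 0.
Proof.
move=> f0; elim: k n => // k IHk n lt_nk; rewrite exprS.
by apply: (@fps_mul_low _ _ 1 k) => // -[].
Qed.

(** The formal variable of the series. *)
Definition fps_q : fps R := Fps (fun n => (n == 1)%:R).

(** [fps_sum A F] is the sum of the family [F i], [i \in A], taken
    coefficientwise.  It is meaningful for summable families, i.e. when for
    each [n] only finitely many [F i] have a nonzero coefficient of order [n]
    (otherwise [\sum_(i \in A)] takes the default value [0]). *)
Definition fps_sum (I : choiceType) (A : set I) (F : I -> fps R) : fps R :=
  Fps (fun n => \sum_(i \in A) (F i)``_n).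

(** [qpoch a p n] is $(a;p)_n$, and [qpoch_inf a p] is $(a;p)_\infty$.
    When [p] has zero constant term, the coefficient of order [n] of [(a;p)_m]
    does not depend on [m > n], see [qpoch_stable]. *)
Definition qpoch (a p : fps R) (n : nat) : fps R :=
  \prod_(0 <= k < n) (1 - a * p ^+ k).

Definition qpoch_inf (a p : fps R) : fps R :=
  Fps (fun n => (qpoch a p n.+1)``_n).

Lemma qpoch_stable (a p : fps R) n m : p``_0 = 0 -> (n < m)%N ->
  (qpoch a p m)``_n = (qpoch_inf a p)``_n.
Proof.
move=> p0; elim: m => // m IHm; rewrite ltnS leq_eqVlt => /predU1P[->//|lt_nm].
have -> : qpoch a p m.+1 = qpoch a p m * (1 - a * p ^+ m).
  by rewrite /qpoch big_nat_recr.
rewrite -(IHm lt_nm) mulrBr mulr1 fpsDE fpsNE.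
rewrite [X in _ - X](@fps_mul_low _ _ 0 m) ?subr0 // => i lt_im.
by rewrite (@fps_mul_low _ _ 0 m) // => j lt_jm; apply: fps_exp_low.
Qed.

(** $(a_1,\dots,a_j;p)_\infty$ *)
Definition qpochs_inf (s : seq (fps R)) (p : fps R) : fps R :=
  \prod_(a <- s) qpoch_inf a p.

End Ring.

Arguments fps_q {R}.

Section UnitRing.
Variable R : comUnitRingType.
Implicit Types f g : fps R.

Definition fps_unit : {pred fps R} := [pred f | f``_0 \is a GRing.unit].

(** For [f] with invertible constant term [a], this is [a^-1] times the
    geometric series in [1 - f / a]. *)
Definition fps_inv f : fps R :=
  if f \in fps_unit then
    Fps (fun n => (f``_0)^-1 *
      (\sum_(0 <= k < n.+1) (1 - fps_const (f``_0)^-1 * f) ^+ k)``_n)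
  else f.

Lemma fps_mulVf : {in fps_unit, left_inverse 1 fps_inv *%R}.
Proof.
move=> f Uf; rewrite /fps_inv Uf; have {}Uf : f``_0 \is a GRing.unit by [].
set a := f``_0 in Uf *; set u := 1 - _.
have u0 : u``_0 = 0 by rewrite fpsDE fpsNE fps_constM mulVr // fps1E subrr.
have geo m n : (m < n)%N ->
    (\sum_(0 <= k < n) u ^+ k)``_m = (\sum_(0 <= k < m.+1) u ^+ k)``_m.
  elim: n => // n IHn; rewrite ltnS leq_eqVlt => /predU1P[->//|lt_mn].
  by rewrite big_nat_recr // fpsDE (IHn lt_mn) fps_exp_low // addr0.
apply/fpsP => n.
have -> : f = fps_const a * (1 - u).
  rewrite /u opprB addrC subrK mulrA; apply/fpsP => i.
  by rewrite -mulrA !fps_constM mulrA divrr // mul1r.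
transitivity (((\sum_(0 <= k < n.+1) u ^+ k) * (1 - u))``_n).
  rewrite mulrCA fps_constM !fpsME mulr_sumr; apply: eq_bigr => i _ /=.
  by rewrite mulrA mulrA divrr // mul1r -(geo i n.+1).
have -> : (\sum_(0 <= k < n.+1) u ^+ k) * (1 - u) = 1 - u ^+ n.+1.
  by rewrite big_mkord mulrC -[1 - u]opprB mulNr -subrX1 opprB.
rewrite fpsDE fpsNE.
by rewrite fps_exp_low // subr0.
Qed.

Lemma fps_unitPl f g : g * f = 1 -> fps_unit f.
Proof.
move=> /fpsP/(_ 0); rewrite fpsME big_ord1 fps1E => gf1.
by apply/unitrPr; exists g``_0; rewrite mulrC.
Qed.

Lemma fps_inv_out : {in [predC fps_unit], fps_inv =1 id}.
Proof. by move=> f /negPf Uf; rewrite /fps_inv Uf. Qed.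

HB.instance Definition _ := GRing.ComNzRing_hasMulInverse.Build (fps R)
  fps_mulVf fps_unitPl fps_inv_out.

(** The q-binomial coefficient $[a, b]_q$, zero unless $b \le a$. *)
Definition qbinom (a b : nat) : fps R :=
  if (b <= a)%N then
    qpoch fps_q fps_q a / (qpoch fps_q fps_q b * qpoch fps_q fps_q (a - b))
  else 0.

End UnitRing.

Arguments qbinom {R}.

Notation "''q'" := (@fps_q _) (at level 0) : ring_scope.

Definition is_partition (s : seq nat) : bool := sorted geq s && (0%N \notin s).

Section Cylindric.
Variables (k : nat) (c : k.-tuple nat).
Implicit Type L : k.-tuple (seq nat).

(** Indices start at [0], both for the [k] partitions (and the entries of the
    profile) and for the parts of each of them; [ordS] is the cyclic
    successor, so that the last partition is compared with the first one. *)
Definition is_cylindric L : Prop :=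
  (forall i, is_partition (tnth L i)) /\
  (forall (i : 'I_k) (j : nat),
    nth 0 (tnth L (ordS i)) (j + tnth c (ordS i)) <= nth 0 (tnth L i) j)%N.

Definition cyl_size L : nat := \sum_(i < k) sumn (tnth L i).

Definition cyl_max L : nat := \max_(i < k) \max_(m <- tnth L i) m.

(** $F_c(z,q)$ and $G_c(z,q)$, as series in $q$ whose coefficients are
    polynomials in $z$. *)
Definition cyl_F : fps {poly int} :=
  fps_sum [set L | is_cylindric L]
    (fun L => fps_const 'X ^+ cyl_max L * 'q ^+ cyl_size L).

Definition cyl_G : fps {poly int} :=
  qpoch_inf (fps_const 'X * 'q) 'q * cyl_F.

(** $G_c(1,q)$ *)
Definition cyl_G1 : fps int := Fps (fun n => (cyl_G``_n).[1]).

End Cylindric.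

(** The subtraction of natural numbers is never truncated here, since
    [n1 * n2 <= n1 ^ 2 + n2 ^ 2]. *)
Definition Qexp (n1 n2 n3 n4 : nat) : nat :=
  (n1 ^ 2 + n2 ^ 2 + n3 ^ 2 + n4 ^ 2 - n1 * n2 + n2 * n4)%N.

Definition Bterm (n1 n2 n3 n4 : nat) : fps int :=
  (qpoch 'q 'q n1)^-1 * qbinom n1 n2 * qbinom n1 n4 * qbinom n2 n3.

Definition qsum4 (F : nat -> nat -> nat -> nat -> fps int) : fps int :=
  fps_sum [set: nat * nat * nat * nat]
    (fun n => let: (n1, n2, n3, n4) := n in F n1 n2 n3 n4).

(* Main.v *)
Require Import Defs.
From mathcomp Require Import all_boot all_order all_algebra.
From mathcomp Require Import all_classical.
From mathcomp Require Import zify ring lra.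

(** Each of the seven series $G_c(1,q)$ is computed twice, from two different
    descriptions of the cylindric partitions.

    The sums. If all parts are at most $N$, inclusion and exclusion over the rows
    that start with a part $N$ gives the recursion of Corteel and Welsh, which
    relates the profile $c$ to those obtained from it by adding boxes at corners
    and which has only one solution ([cyl_bounded_rec], [corner_rec_uniq]). The
    solution in level 5 is the coefficient of $z^N$ in $S_c(z)/(z;q)_\infty$,
    where $S_c(z)$ is the quadruple sum of the theorem with $n_1$ marked by $z$
    ([cyl_boundedE]). For this one has to prove seven $q$-difference equations
    for the $S_c$. Some hold by the definition of the $S_c$; the others follow
    from three first order relations between the coefficients of the sums, and
    these are linear combinations of contiguity relations, each of which comes
    from shifting a single summation variable ([contig_combination1],
    [contig_combination2]). Letting $N$ tend to infinity puts $z=1$.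

    The products. A cylindric partition of rank $k$ and level $\ell$, read along
    its diagonals, is a closed chain of $T=k+\ell$ partitions in which
    consecutive members differ by a horizontal strip, added or removed according
    to a cyclic word that encodes the profile ([slices_bij]). A local bijection,
    the reflection [toggle], exchanges an addition with the removal that follows
    it and splits off a factor $1/(1-q^e)$ ([reduces_toggle]). Moving all the
    removals round the cycle again and again, one collects, for every addition
    and every removal, the factor $1/(q^d;q^T)_\infty$, where $d$ is the cyclic
    distance between the two; in the limit only the constant chains are left
    ([chain_series_limit]), and they contribute $1/(q^T;q^T)_\infty$ by Euler's
    theorem. This is Borodin's product formula. For $k=3$ and $\ell=5$ there are
    fifteen factors with exponents below $T=8$; among them is one for each of
    $1,\dots,7$, so that multiplication by $(q;q)_\infty$ leaves the eight factors
    of the theorem ([cyl_G1_product]). The equalities between different profiles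
    hold because the products agree. *)

Set Implicit Arguments.
Unset Strict Implicit.
Unset Printing Implicit Defensive.
Import Order.TTheory GRing.Theory Num.Theory.
Local Open Scope classical_set_scope.
Local Open Scope ring_scope.

(** * Truncation, units and powers of the variable *)

(** Infinite products and sums are handled through their truncations: two
    series are compared modulo $q^{n+1}$ for each $n$ separately. *)
Definition eq_upto (n : nat) (f g : fps int) :=
  forall i, (i <= n)%N -> f``_i = g``_i.

Lemma eq_upto_refl n f : eq_upto n f f. Proof. by []. Qed.

Lemma eq_upto_sym n f g : eq_upto n f g -> eq_upto n g f.
Proof. by move=> fg i /fg. Qed.

Lemma eq_upto_trans n f g h : eq_upto n f g -> eq_upto n g h -> eq_upto n f h.
Proof. by move=> fg gh i le_in; rewrite fg ?gh. Qed.

Lemma eq_uptoM n f f' g g' :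
  eq_upto n f f' -> eq_upto n g g' -> eq_upto n (f * g) (f' * g').
Proof.
move=> ff' gg' i le_in; rewrite !fpsME; apply: eq_bigr => j _.
rewrite ff' ?gg' //; first by rewrite (leq_trans (leq_subr _ _)).
by rewrite (leq_trans _ le_in) // -ltnS.
Qed.

Lemma eq_upto_sum n (I : Type) (r : seq I) (P : pred I) (F G : I -> fps int) :
  (forall i, P i -> eq_upto n (F i) (G i)) ->
  eq_upto n (\sum_(i <- r | P i) F i) (\sum_(i <- r | P i) G i).
Proof. by move=> FG k le_kn; rewrite !fps_sumE; apply: eq_bigr => i /FG->. Qed.

Lemma eq_upto_prod n (I : Type) (r : seq I) (P : pred I) (F G : I -> fps int) :
  (forall i, P i -> eq_upto n (F i) (G i)) ->
  eq_upto n (\prod_(i <- r | P i) F i) (\prod_(i <- r | P i) G i).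
Proof.
by move=> FG; apply: (big_ind2 (eq_upto n)) => // *; apply: eq_uptoM.
Qed.

Lemma eq_upto_fps f g : (forall n, eq_upto n f g) -> f = g.
Proof. by move=> fg; apply/fpsP => n; apply: (fg n). Qed.

Lemma fps_mul0E (f g : fps int) : (f * g)``_0 = f``_0 * g``_0.
Proof. by rewrite fpsME big_ord1. Qed.

Lemma fps_unit1 (f : fps int) : f``_0 = 1 -> f \is a GRing.unit.
Proof. by move=> f0; change (f``_0 \is a GRing.unit); rewrite f0. Qed.

Lemma fps_qXE (R : comNzRingType) k n : ('q ^+ k : fps R)``_n = (n == k)%:R.
Proof.
elim: k n => [|k IHk] n; first by rewrite expr0 fps1E.
rewrite exprS fpsME; case: n => [|n].
  by rewrite big_ord1 mul0r.
rewrite (bigD1 (1 : 'I_n.+2)) //= big1 ?addr0 => [|i ni1].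
  by rewrite mul1r IHk subn1.
case: eqP => [i1|_]; last by rewrite mul0r.
by case/eqP: ni1; apply: val_inj.
Qed.

Lemma fps_qXM k (f : fps int) n :
  ('q ^+ k * f)``_n = if (k <= n)%N then f``_(n - k) else 0.
Proof.
rewrite fpsME; case: leqP => [le_kn|lt_nk].
  rewrite (bigD1 (Ordinal (le_kn : k < n.+1)%N)) //= fps_qXE eqxx mul1r.
  rewrite big1 ?addr0 // => i ne_ik; rewrite fps_qXE.
  case: eqP => [ik|_]; last by rewrite mul0r.
  by case/eqP: ne_ik; apply: val_inj.
rewrite big1 // => i _; rewrite fps_qXE; case: eqP => [ik|_]; last by rewrite mul0r.
by move: (ltn_ord i) lt_nk; rewrite ik ltnS leqNgt => /negPf->.
Qed.

Lemma fps_qX_inj k (f g : fps int) : 'q ^+ k * f = 'q ^+ k * g -> f = g.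
Proof.
move=> /fpsP fg; apply/fpsP => n; have := fg (n + k)%N.
by rewrite !fps_qXM leq_addl addnK.
Qed.

Lemma fps_qX0 k : (0 < k)%N -> ('q ^+ k : fps int)``_0 = 0.
Proof. by move=> k0; rewrite fps_qXE; case: k k0. Qed.

Lemma unit_1BqX k : (0 < k)%N -> 1 - 'q ^+ k \is a @GRing.unit (fps int).
Proof. by move=> k0; apply: fps_unit1; rewrite fpsDE fpsNE fps_qX0 // subr0. Qed.

Lemma qpochS (R : comNzRingType) (a p : fps R) n :
  qpoch a p n.+1 = qpoch a p n * (1 - a * p ^+ n).
Proof. by rewrite /qpoch big_nat_recr. Qed.

Lemma qpoch_unit (a p : fps int) n : a``_0 = 0 -> qpoch a p n \is a GRing.unit.
Proof.
move=> a0; apply: rpred_prod => k _; apply: fps_unit1.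
by rewrite fpsDE fpsNE fps_mul0E a0 mul0r subr0.
Qed.

Lemma qpoch_inf_upto (a p : fps int) n m : p``_0 = 0 -> (n < m)%N ->
  eq_upto n (qpoch_inf a p) (qpoch a p m).
Proof.
move=> p0 lt_nm i le_in.
by rewrite (qpoch_stable a p0 (leq_ltn_trans le_in lt_nm)).
Qed.

Lemma qpoch_inf_unit (a p : fps int) : a``_0 = 0 -> p``_0 = 0 ->
  qpoch_inf a p \is a GRing.unit.
Proof.
move=> a0 p0; apply: fps_unit1; rewrite (qpoch_inf_upto a p0 (ltn0Sn 0)) //.
by rewrite qpochS /qpoch big_geq // mul1r fpsDE fpsNE fps_mul0E a0 mul0r subr0.
Qed.

(** * The q-binomial coefficients *)

Notation qfact n := (qpoch 'q 'q n : fps int).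
Notation qbin := (qbinom : nat -> nat -> fps int).

Lemma qfactS n : qfact n.+1 = qfact n * (1 - 'q ^+ n.+1).
Proof. by rewrite qpochS -exprS. Qed.

Lemma qfact0 : qfact 0 = 1.
Proof. by rewrite /qpoch big_geq. Qed.

Lemma qfact_unit n : qfact n \is a GRing.unit.
Proof. by apply: qpoch_unit. Qed.

Lemma qbinomE n k : (k <= n)%N -> qbin n k * (qfact k * qfact (n - k)) = qfact n.
Proof.
by move=> le_kn; rewrite /qbinom le_kn divrK // rpredM ?qfact_unit.
Qed.

Lemma qbinom_small n k : (n < k)%N -> qbin n k = 0.
Proof. by move=> lt_nk; rewrite /qbinom leqNgt lt_nk. Qed.

Lemma qbinn0 n : qbin n 0 = 1.
Proof. by rewrite /qbinom subn0 qfact0 mul1r divrr ?qfact_unit. Qed.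

Lemma qbin_absorb n k :
  qbin n.+1 k.+1 * (1 - 'q ^+ k.+1) = (1 - 'q ^+ n.+1) * qbin n k.
Proof.
case: (leqP k n) => [le_kn|lt_nk]; last by rewrite !qbinom_small ?mul0r ?mulr0.
have U : qfact k * qfact (n - k) \is a GRing.unit by rewrite rpredM ?qfact_unit.
apply: (mulIr U).
have := @qbinomE n.+1 k.+1 le_kn; rewrite subSS !qfactS -(qbinomE le_kn) => E.
transitivity (qbin n k * (qfact k * qfact (n - k)) * (1 - 'q ^+ n.+1)); last by ring.
by rewrite -E; ring.
Qed.

(** The ratio of two consecutive q-binomial coefficients, with denominators
    cleared; all the contiguity relations below come from it. *)
Lemma qbin_next n k : qbin n k.+1 * ('q ^+ k * (1 - 'q ^+ k.+1)) =
  ('q ^+ k - 'q ^+ n) * qbin n k.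
Proof.
case: (ltngtP k n) => [lt_kn|lt_nk|->].
- have U : qfact k * qfact (n - k.+1) * (1 - 'q ^+ (n - k)) \is a GRing.unit.
    by rewrite !rpredM ?qfact_unit ?unit_1BqX ?subn_gt0.
  apply: (mulIr U).
  have := qbinomE (ltnW lt_kn); have := qbinomE lt_kn.
  have -> : (n - k = (n - k.+1).+1)%N by lia.
  rewrite !qfactS => E1 E2.
  transitivity ('q ^+ k * (1 - 'q ^+ (n - k.+1).+1) * qfact n).
    by rewrite -E1; ring.
  have -> : 'q ^+ n = 'q ^+ k * 'q ^+ (n - k.+1).+1 :> fps int.
    by rewrite -exprD; congr (_ ^+ _); lia.
  by rewrite -{1}E2; ring.
- by rewrite !qbinom_small ?mul0r ?mulr0 // ltnW.
- by rewrite subrr mul0r qbinom_small ?mul0r.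
Qed.

Lemma qbin_pascal n k : (k <= n)%N ->
  qbin n.+1 k.+1 = qbin n k.+1 + 'q ^+ (n - k) * qbin n k.
Proof.
move=> le_kn; apply: (mulIr (unit_1BqX (ltn0Sn k))); rewrite qbin_absorb.
apply: (@fps_qX_inj k).
transitivity (qbin n k.+1 * ('q ^+ k * (1 - 'q ^+ k.+1)) +
  'q ^+ k * ('q ^+ (n - k) * qbin n k * (1 - 'q ^+ k.+1))); last by ring.
have En : 'q ^+ n = 'q ^+ k * 'q ^+ (n - k) :> fps int.
  by rewrite -exprD subnKC.
by rewrite qbin_next !exprS En; ring.
Qed.

(** * Contiguity relations for the triple sums *)

(** This is $\sum_k q^{k(k-1)+ck} [n,k]_q$; the truncated predecessor only
    occurs at [k = 0], where its coefficient vanishes. *)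
Definition rsum (n c : nat) : fps int :=
  \sum_(k < n.+1) 'q ^+ (k * k.-1 + c * k) * qbin n k.

Lemma rsum_ext n N c : (n <= N)%N ->
  rsum n c = \sum_(k < N.+1) 'q ^+ (k * k.-1 + c * k) * qbin n k.
Proof.
move=> le_nN; rewrite /rsum.
rewrite -(big_mkord xpredT (fun k => 'q ^+ (k * k.-1 + c * k) * qbin n k)).
rewrite -[RHS](big_mkord xpredT (fun k => 'q ^+ (k * k.-1 + c * k) * qbin n k)).
rewrite [RHS](big_cat_nat _ (n := n.+1)) //= [X in _ + X]big_nat_cond.
rewrite [X in _ + X]big1 ?addr0 // => k /andP[/andP[lt_nk _] _].
by rewrite qbinom_small ?mulr0.
Qed.

Lemma rsumS n c : rsum n c = 1 +
  \sum_(k < n.+1) 'q ^+ (k * k.-1 + 2 * k + c + c * k) * qbin n k.+1.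
Proof.
rewrite (@rsum_ext n n.+1) // big_ord_recl /= qbinn0 !muln0 expr0 mul1r.
congr (_ + _); apply: eq_bigr => k _; rewrite /bump /= add1n.
congr ('q ^+ _ * _); case: {+}(k : nat) => [|j]; nia.
Qed.

(** The factor $1-q^k$ by which the terms on the left differ lowers the index
    of the q-binomial coefficient ([qbin_next]); then $k$ is shifted by one. *)
Lemma rsum_contig n c :
  rsum n c - rsum n c.+1 = 'q ^+ c * (rsum n c.+2 - 'q ^+ n * rsum n c.+1).
Proof.
rewrite !rsumS mulrBr opprD addrACA subrr add0r -sumrB.
rewrite -(rsumS n c.+2) -(rsumS n c.+1) /rsum !mulr_sumr -sumrB.
apply: eq_bigr => k _.
have := qbin_next n k; set B := qbin n k.+1; set B' := qbin n k => E.
transitivity ('q ^+ (k * k.-1 + c + c * k) * 'q ^+ k * (B * ('q ^+ k * (1 - 'q ^+ k.+1)))).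
  have -> : (k * k.-1 + 2 * k + c.+1 + c.+1 * k =
             k * k.-1 + c + c * k + k + k + k.+1)%N by lia.
  have -> : (k * k.-1 + 2 * k + c + c * k = k * k.-1 + c + c * k + k + k)%N by lia.
  by rewrite !exprD; ring.
rewrite E.
have -> : (k * k.-1 + c.+2 * k = k * k.-1 + c * k + k + k)%N by lia.
have -> : (k * k.-1 + c.+1 * k = k * k.-1 + c * k + k)%N by lia.
by rewrite !exprD; ring.
Qed.

Lemma rsum_pascal n c : rsum n.+1 c = rsum n c + 'q ^+ (n + c) * rsum n c.+1.
Proof.
rewrite [LHS]rsumS (rsumS n c) -addrA; congr (_ + _).
rewrite big_ord_recr /= qbinom_small // mulr0 addr0 mulr_sumr -big_split /=.
apply: eq_bigr => k _; have le_kn : (k <= n)%N by rewrite -ltnS.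
rewrite qbin_pascal //.
have -> : (n + c = (n - k) + k + c)%N by lia.
have -> : (k * k.-1 + 2 * k + c + c * k = k * k.-1 + c * k + k + k + c)%N by lia.
have -> : (k * k.-1 + c.+1 * k = k * k.-1 + c * k + k)%N by lia.
by rewrite !exprD; ring.
Qed.

(** Here $q^k-q^{n+1}$ is absorbed by the coefficient $[n+1,k]_q$. *)
Lemma rsum_absorb n c :
  rsum n.+1 c.+1 - 'q ^+ n.+1 * rsum n.+1 c = (1 - 'q ^+ n.+1) * rsum n c.+1.
Proof.
have key k : (k <= n.+1)%N ->
    ('q ^+ k - 'q ^+ n.+1) * qbin n.+1 k = 'q ^+ k * (1 - 'q ^+ n.+1) * qbin n k.
  case: k => [|k] le_kn; first by rewrite !qbinn0 expr0; ring.
  have U := unit_1BqX (ltn0Sn k); apply: (mulIr U).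
  rewrite -!mulrA qbin_absorb; apply: (@fps_qX_inj k).
  transitivity ((1 - 'q ^+ n.+1) * 'q ^+ 1 * 'q ^+ k * (('q ^+ k - 'q ^+ n) * qbin n k)).
    by rewrite (exprS _ n) (exprS _ k); ring.
  by rewrite -qbin_next !exprS; ring.
rewrite (@rsum_ext n n.+1) // /rsum !mulr_sumr -sumrB; apply: eq_bigr => k _.
have le_kn : (k <= n.+1)%N by rewrite -ltnS.
have -> : (k * k.-1 + c.+1 * k = k * k.-1 + c * k + k)%N by lia.
rewrite !(exprD _ _ k).
transitivity ('q ^+ (k * k.-1 + c * k) * (('q ^+ k - 'q ^+ n.+1) * qbin n.+1 k)).
  by ring.
by rewrite key //; ring.
Qed.

(** The part of the summand of [tsum] in which neither $n_3$ nor $n_4$ occurs. *)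
Definition tcoef (m k : nat) : fps int := 'q ^+ (m * (m - k) + k * k.-1) * qbin m k.

(** The sum over $n_2,n_3,n_4$ of
    $q^{Q+(b-1)n_2+(c-1)n_3+(d-1)n_4} [m,n_2][m,n_4][n_2,n_3]$ with $n_1=m$.
    The shift of the three exponents by one unit makes all the relations below
    statements about power series: $Q-n_2-n_3-n_4$ is still nonnegative. *)
Definition tsum (m b c d : nat) : fps int :=
  \sum_(k < m.+1) tcoef m k * 'q ^+ (b * k) * rsum k c * rsum m (k + d).

(** [rsum_contig] for the sum over $n_3$, whose upper index is $n_2$. *)
Lemma tsum_contig3 m b c d :
  tsum m b c d - tsum m b c.+1 d = 'q ^+ c * (tsum m b c.+2 d - tsum m b.+1 c.+1 d).
Proof.
rewrite /tsum -!sumrB mulr_sumr; apply: eq_bigr => k _.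
have -> : rsum k c = rsum k c.+1 + 'q ^+ c * (rsum k c.+2 - 'q ^+ k * rsum k c.+1).
  by rewrite -rsum_contig; ring.
by rewrite mulSn (exprD _ k); ring.
Qed.

(** [rsum_contig] for the sum over $n_4$. *)
Lemma tsum_contig4 m b c d : tsum m b c d - tsum m b c d.+1 =
  'q ^+ d * (tsum m b.+1 c d.+2 - 'q ^+ m * tsum m b.+1 c d.+1).
Proof.
rewrite /tsum (mulr_sumr _ _ _ ('q ^+ m)) -!sumrB mulr_sumr.
apply: eq_bigr => k _.
have -> : rsum m (k + d) = rsum m (k + d.+1) +
    'q ^+ (k + d) * (rsum m (k + d.+2) - 'q ^+ m * rsum m (k + d.+1)).
  by rewrite !addnS -rsum_contig; ring.
by rewrite mulSn !exprD; ring.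
Qed.

Lemma tcoef_next m k : (k < m)%N ->
  'q ^+ m * (tcoef m k.+1 * (1 - 'q ^+ k.+1)) = tcoef m k * 'q ^+ k * ('q ^+ k - 'q ^+ m).
Proof.
move=> lt_km; rewrite /tcoef.
have -> : (m * (m - k.+1) + k.+1 * k.+1.-1 = m * (m - k.+1) + k * k.-1 + k + k)%N.
  by rewrite -!addnA; congr addn; case: {+}k => [|j] //=; nia.
have -> : (m * (m - k) + k * k.-1 = m * (m - k.+1) + m + k * k.-1)%N.
  by rewrite -mulnSr; congr (m * _ + _)%N; lia.
set e := (m * (m - k.+1))%N.
transitivity ('q ^+ m * 'q ^+ (e + k * k.-1) * 'q ^+ k *
   (qbin m k.+1 * ('q ^+ k * (1 - 'q ^+ k.+1)))); first by rewrite !exprD; ring.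
by rewrite qbin_next !exprD; ring.
Qed.

(** The shift of $n_2$ also moves the upper index of the sum over $n_3$; the
    choice of the two sums on the left is the one for which [rsum_absorb] brings
    that index back. *)
Lemma tsum_contig2 m b c d : 'q ^+ m * (tsum m b c.+1 d - tsum m b.+1 c d) =
  'q ^+ b * (tsum m b.+2 c.+1 d.+1 - 'q ^+ m * tsum m b.+1 c.+1 d.+1).
Proof.
rewrite /tsum (mulr_sumr _ _ _ ('q ^+ m)) -!sumrB !mulr_sumr.
rewrite big_ord_recl [RHS]big_ord_recr /=.
rewrite [X in X + _](_ : _ = 0) ?add0r; last first.
  rewrite !muln0 /rsum !big_ord1 !muln0 qbinn0; ring.
rewrite [X in _ + X](_ : _ = 0) ?addr0; last first.
  by rewrite (_ : (b.+2 * m = m + b.+1 * m)%N) ?exprD; [ring | lia].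
apply: eq_bigr => k _; rewrite /bump /= add1n.
have lt_km : (k < m)%N by [].
transitivity ('q ^+ m * (tcoef m k.+1 * (1 - 'q ^+ k.+1)) * 'q ^+ (b * k.+1) *
   rsum k c.+1 * rsum m (k.+1 + d)).
  transitivity ('q ^+ m * tcoef m k.+1 * 'q ^+ (b * k.+1) * rsum m (k.+1 + d) *
    (rsum k.+1 c.+1 - 'q ^+ k.+1 * rsum k.+1 c)).
    by rewrite (_ : b.+1 * k.+1 = k.+1 + b * k.+1)%N // exprD; ring.
  by rewrite rsum_absorb; ring.
rewrite tcoef_next // addnS addSn.
have -> : (b * k.+1 = b + b * k)%N by lia.
have -> : (b.+2 * k = k + k + b * k)%N by lia.
have -> : (b.+1 * k = k + b * k)%N by lia.
by rewrite !exprD; ring.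
Qed.

(** Each of the coefficients $[m,n_2]$ and $[m,n_4]$ absorbs a factor $1-q^{m+1}$,
    at the cost of a difference in $b$, respectively in $d$: hence four terms. *)
Lemma tsum_down m b c d :
  'q * 'q ^+ m ^+ 2 * (1 - 'q ^+ m.+1) ^+ 2 * tsum m b c d.+1 =
  tsum m.+1 b.+1 c d.+1 - 'q ^+ m.+1 * tsum m.+1 b c d.+1
  - 'q ^+ m.+1 * tsum m.+1 b.+1 c d + 'q ^+ m.+1 ^+ 2 * tsum m.+1 b c d.
Proof.
rewrite /tsum !mulr_sumr -!sumrB -!big_split /= [RHS]big_ord_recr /=.
rewrite [X in _ = _ + X](_ : _ = 0) ?addr0; last first.
  by rewrite mulSn exprD; ring.
apply: eq_bigr => k _; have le_km : (k <= m)%N by rewrite -ltnS.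
have Ec : 'q * 'q ^+ m ^+ 2 * (1 - 'q ^+ m.+1) * tcoef m k =
    tcoef m.+1 k * ('q ^+ k - 'q ^+ m.+1).
  rewrite /tcoef.
  have -> : (m.+1 * (m.+1 - k) + k * k.-1 =
             m * (m - k) + k * k.-1 + m + (m - k).+1)%N.
    by rewrite subSn // mulSn; lia.
  have Em : 'q ^+ m = 'q ^+ (m - k) * 'q ^+ k :> fps int by rewrite -exprD subnK.
  have E : (1 - 'q ^+ (m - k).+1) * qbin m.+1 k = (1 - 'q ^+ m.+1) * qbin m k.
    have U : qfact k * qfact (m - k) \is a GRing.unit by rewrite rpredM ?qfact_unit.
    apply: (mulIr U).
    have := @qbinomE m.+1 k (leqW le_km); have := qbinomE le_km.
    rewrite subSn // !qfactS => <- E'.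
    by transitivity (qbin m.+1 k * (qfact k * (qfact (m - k) * (1 - 'q ^+ (m - k).+1))));
      [ring | rewrite E'; ring].
  transitivity ('q * 'q ^+ m ^+ 2 * 'q ^+ (m * (m - k) + k * k.-1) *
    ((1 - 'q ^+ m.+1) * qbin m k)); first by ring.
  by rewrite -E !exprD !exprS Em; ring.
transitivity (('q * 'q ^+ m ^+ 2 * (1 - 'q ^+ m.+1) * tcoef m k) * 'q ^+ (b * k) *
  rsum k c * ((1 - 'q ^+ m.+1) * rsum m (k + d).+1)).
  by rewrite addnS; ring.
by rewrite Ec -rsum_absorb addnS (_ : b.+1 * k = k + b * k)%N // exprD; ring.
Qed.

(** Pascal's rule for $[m+1,n_2]$ and for the sums over $n_3$ and $n_4$, the
    second half of the first one being reindexed by $n_2-1$. *)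
Lemma tsum_up m : tsum m.+1 1 1 1 = 'q * 'q ^+ m ^+ 2 *
  (tsum m 0 1 1 + (1 + 'q * 'q ^+ m) * tsum m 1 1 2 + 'q * tsum m 2 2 2
   + 'q ^+ 2 * 'q ^+ m * tsum m 2 1 3 + 'q ^+ 3 * 'q ^+ m * tsum m 3 2 3).
Proof.
pose A k := rsum k 1 * rsum m.+1 k.+1.
have EL : tsum m.+1 1 1 1 = \sum_(k < m.+2) tcoef m.+1 k * 'q ^+ k * A k.
  by apply: eq_bigr => k _; rewrite mul1n addn1 /A; ring.
have first k : (k <= m)%N -> 'q ^+ (m.+1 * (m.+1 - k) + k * k.-1) * qbin m k * 'q ^+ k =
    'q * 'q ^+ m ^+ 2 * tcoef m k.
  move=> le_km; rewrite /tcoef -exprM mulrA -exprS -exprD mulrAC -exprD.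
  congr ('q ^+ _ * _); rewrite subSn // mulSn; nia.
have second k : (k <= m)%N -> 'q ^+ (m.+1 * (m - k) + k.+1 * k) *
    ('q ^+ (m - k) * qbin m k) = 'q ^+ m ^+ 2 * tcoef m k.
  move=> le_km; rewrite /tcoef -exprM !mulrA -!exprD.
  congr ('q ^+ _ * _); rewrite mulSn; case: k le_km => [|k] le_km /=; nia.
have -> : tsum m.+1 1 1 1 = \sum_(k < m.+1) 'q * 'q ^+ m ^+ 2 * tcoef m k *
    (A k + 'q ^+ k * A k.+1).
  rewrite EL.
  transitivity (\sum_(k < m.+1) 'q * 'q ^+ m ^+ 2 * tcoef m k * A k +
     \sum_(k < m.+1) 'q ^+ m ^+ 2 * tcoef m k * 'q ^+ k.+1 * A k.+1); last first.
    by rewrite -big_split; apply: eq_bigr => k _ /=; rewrite (exprS _ k); ring.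
  pose F k : fps int := 'q ^+ (m.+1 * (m.+1 - k) + k * k.-1) * qbin m k * 'q ^+ k * A k.
  transitivity (F 0 + \sum_(k < m.+1) F k.+1 +
     \sum_(k < m.+1) 'q ^+ m ^+ 2 * tcoef m k * 'q ^+ k.+1 * A k.+1).
    rewrite -addrA -big_split big_ord_recl; congr (_ + _).
      by rewrite /F /tcoef !qbinn0.
    apply: eq_bigr => k _; rewrite /bump /= ?add1n -second -1?ltnS //.
    by rewrite /F /tcoef qbin_pascal -1?ltnS // subSS /=; ring.
  congr (_ + _).
  transitivity (\sum_(k < m.+2) F k).
    by rewrite [RHS]big_ord_recl; congr (_ + _); apply: eq_bigr => k _.
  rewrite big_ord_recr /= [X in _ + X](_ : _ = 0) ?addr0; last first.
    by rewrite /F qbinom_small //; ring.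
  by apply: eq_bigr => k _; rewrite /F first // -ltnS.
rewrite /tsum !mulr_sumr -!big_split mulr_sumr; apply: eq_bigr => k _ /=.
rewrite /A !rsum_pascal !addnS !addn0 (_ : (3 * k = k + k + k)%N); last by lia.
rewrite (_ : (2 * k = k + k)%N); last by lia.
by rewrite mul1n !exprS !exprD; ring.
Qed.

(** * First order relations between the triple sums *)

(** The three first order relations below are creative-telescoping identities.
    After the sums of index [m] have been written in terms of those of index
    [m.+1] (or conversely), each one is a linear combination of the contiguity
    relations, whose coefficients are the solution of a linear system over
    $\mathbb{Q}(q,x)$. This is a fact about any array [V] that satisfies the
    contiguity relations, with [x] in the role of $q^{m+1}$. *)
Lemma contig_combination1 (R : comPzRingType) (q w : R) (x := q * w)
    (V : nat -> nat -> nat -> R)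
    (down := fun b c d => V b.+1 c d.+1 - x * V b c d.+1 - x * V b.+1 c d
                          + x ^+ 2 * V b c d)
    (V2 : forall b c d, x * (V b c.+1 d - V b.+1 c d) =
       q ^+ b * (V b.+2 c.+1 d.+1 - x * V b.+1 c.+1 d.+1))
    (V3 : forall b c d, V b c d - V b c.+1 d =
       q ^+ c * (V b c.+2 d - V b.+1 c.+1 d))
    (V4 : forall b c d, V b c d - V b c d.+1 =
       q ^+ d * (V b.+1 c d.+2 - x * V b.+1 c d.+1)) :
  q * w ^+ 2 * (1 - x) * (V 2 2 2 - x ^+ 2 * V 1 2 1) =
    x * w * ((1 + q ^+ 2 * w ^+ 2) * down 1 2 0 + q * w * down 1 1 0
       + (q * w + q ^+ 3 * w ^+ 3) * down 2 2 1) /\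
  q * w ^+ 2 * (1 - x) * (V 1 2 1 - x * V 1 1 1) =
    x * (w * down 1 1 0 + q * w ^+ 2 * down 1 2 0
       + (1 + q ^+ 2 * w ^+ 3) * down 2 2 1).
Proof.
pose rel2 b c d := x * (V b c.+1 d - V b.+1 c d) -
  q ^+ b * (V b.+2 c.+1 d.+1 - x * V b.+1 c.+1 d.+1).
pose rel3 b c d := V b c d - V b c.+1 d - q ^+ c * (V b c.+2 d - V b.+1 c.+1 d).
pose rel4 b c d := V b c d - V b c d.+1 -
  q ^+ d * (V b.+1 c d.+2 - x * V b.+1 c d.+1).
have E2 b c d : rel2 b c d = 0 by rewrite /rel2 V2 subrr.
have E3 b c d : rel3 b c d = 0 by rewrite /rel3 V3 subrr.
have E4 b c d : rel4 b c d = 0 by rewrite /rel4 V4 subrr.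
split; apply/eqP; rewrite -subr_eq0; apply/eqP.
- transitivity (q * w ^+ 2 * x * (- 1) * rel4 0 0 0
    + q * w ^+ 2 * x * (1 - x) * rel4 0 1 0
    + q * w ^+ 2 * x * (x - x ^+ 2) * rel4 0 2 0
    + q * w ^+ 2 * x * (- x ^+ 3) * rel4 1 2 0
    + q * w ^+ 2 * x * (1 + x ^+ 2) * rel4 2 2 0
    + q * w ^+ 2 * x * (1) * rel3 0 0 0
    + q * w ^+ 2 * x * (- 1) * rel3 0 0 1
    + q * w ^+ 2 * x * (x) * rel3 1 0 0
    + q * w ^+ 2 * x * (- 1) * rel3 1 0 2
    + q * w ^+ 2 * (x) * rel2 0 0 0
    + q * w ^+ 2 * (- x) * rel2 0 0 1
    + q * w ^+ 2 * (1 - x + x ^+ 2) * rel2 0 1 0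
    + q * w ^+ 2 * (- (1 - x + x ^+ 2)) * rel2 0 1 1).
    by rewrite /rel2 /rel3 /rel4 /down /x; ring.
  by rewrite !(E2, E3, E4); ring.
- transitivity (q * w ^+ 2 * x * (- x) * rel4 0 2 0
    + q * w ^+ 2 * x * (1 - x ^+ 2) * rel4 1 2 0
    + q * w ^+ 2 * x * (x) * rel4 2 2 0
    + q * w ^+ 2 * (x) * rel2 0 1 0
    + q * w ^+ 2 * (- x) * rel2 0 1 1
    + q * w ^+ 2 * (- 1) * rel2 1 1 0
    + w * rel2 1 1 1).
    by rewrite /rel2 /rel3 /rel4 /down /x; ring.
  by rewrite !(E2, E3, E4); ring.
Qed.

Lemma contig_combination2 (R : comPzRingType) (q u : R) (x := q * u)
    (V : nat -> nat -> nat -> R)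
    (down := fun b c d => V b.+1 c d.+1 - x * V b c d.+1 - x * V b.+1 c d
                          + x ^+ 2 * V b c d)
    (up := q * x ^+ 2 * (V 0 1 1 + (1 + q * x) * V 1 1 2 + q * V 2 2 2
       + q ^+ 2 * x * V 2 1 3 + q ^+ 3 * x * V 3 2 3))
    (V2 : forall b c d, x * (V b c.+1 d - V b.+1 c d) =
       q ^+ b * (V b.+2 c.+1 d.+1 - x * V b.+1 c.+1 d.+1))
    (V3 : forall b c d, V b c d - V b c.+1 d =
       q ^+ c * (V b c.+2 d - V b.+1 c.+1 d))
    (V4 : forall b c d, V b c d - V b c d.+1 =
       q ^+ d * (V b.+1 c d.+2 - x * V b.+1 c d.+1)) :
  x * (1 - x) * up = x * (1 - x) *
      ((q ^+ 2 * x ^+ 3 + q * x ^+ 2) * V 1 1 1 + q ^+ 3 * x ^+ 4 * V 1 2 1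
       + (q ^+ 4 * x ^+ 5 + q ^+ 2 * x ^+ 2 + q) * V 2 2 2)
    - q * x * (down 1 2 0 + x * down 2 2 1).
Proof.
pose rel2 b c d := x * (V b c.+1 d - V b.+1 c d) -
  q ^+ b * (V b.+2 c.+1 d.+1 - x * V b.+1 c.+1 d.+1).
pose rel3 b c d := V b c d - V b c.+1 d - q ^+ c * (V b c.+2 d - V b.+1 c.+1 d).
pose rel4 b c d := V b c d - V b c d.+1 -
  q ^+ d * (V b.+1 c d.+2 - x * V b.+1 c d.+1).
have E2 b c d : rel2 b c d = 0 by rewrite /rel2 V2 subrr.
have E3 b c d : rel3 b c d = 0 by rewrite /rel3 V3 subrr.
have E4 b c d : rel4 b c d = 0 by rewrite /rel4 V4 subrr.
apply/eqP; rewrite -subr_eq0; apply/eqP.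
transitivity (q * x ^+ 2 * (1 - x) * rel4 0 0 0
    + q * x ^+ 2 * (- (1 - x)) * rel4 0 1 0
    + q * x ^+ 2 * (- (q * x ^+ 2 * (1 - x))) * rel4 1 1 1
    + q * x ^+ 2 * (x) * rel4 1 2 0
    + q * x ^+ 2 * (- (q ^+ 2 * x ^+ 3 * (1 - x))) * rel4 1 2 1
    + q * x ^+ 2 * (- 1) * rel4 2 2 0
    + q * x ^+ 2 * (- (1 - x)) * rel3 0 0 0
    + q * x ^+ 2 * (1 - x) * rel3 0 0 1
    + q * x ^+ 2 * (1 - x) * rel3 1 0 2
    + q * x * (x * (1 - x)) * rel2 0 0 1
    + q * x * (- (1 - x)) * rel2 0 1 0
    + q * x * (1 - x) * rel2 0 1 1
    + q * x * (- (q ^+ 2 * x ^+ 3 * (1 - x))) * rel2 1 1 2).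
  by rewrite /rel2 /rel3 /rel4 /down /up /x; ring.
by rewrite !(E2, E3, E4); ring.
Qed.

(** The three relations at consecutive indices; [tsum m 2 2 2], [tsum m 1 2 1]
    and [tsum m 1 1 1] belong to the profiles (4,1,0), (3,1,1) and (2,2,1). *)
Lemma tsum_step1 m (w := 'q ^+ m) (x := 'q ^+ m.+1) :
  tsum m.+1 2 2 2 - x ^+ 2 * tsum m.+1 1 2 1 =
  (1 - x) * x * w * ((1 + 'q ^+ 2 * w ^+ 2) * tsum m 1 2 1 + 'q * w * tsum m 1 1 1
     + ('q * w + 'q ^+ 3 * w ^+ 3) * tsum m 2 2 2).
Proof.
have U : 1 - x \is a GRing.unit by apply: unit_1BqX.
have xE : x = 'q * w by rewrite /x exprS.
apply: (mulIr U); apply: (@fps_qX_inj (m.+1 + m)); rewrite exprD -/w -/x.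
have := @contig_combination1 _ 'q w (tsum m.+1); rewrite -xE.
case; [exact: tsum_contig2 | exact: tsum_contig3 | exact: tsum_contig4 |].
rewrite -!tsum_down -/w -/x => E _.
transitivity ('q * w ^+ 2 * (1 - x) * (tsum m.+1 2 2 2 - x ^+ 2 * tsum m.+1 1 2 1)).
  by rewrite {1}xE; ring.
by rewrite E xE; ring.
Qed.

Lemma tsum_step2 m (w := 'q ^+ m) (x := 'q ^+ m.+1) :
  tsum m.+1 1 2 1 - x * tsum m.+1 1 1 1 =
  (1 - x) * x * (w * tsum m 1 1 1 + 'q * w ^+ 2 * tsum m 1 2 1
     + (1 + 'q ^+ 2 * w ^+ 3) * tsum m 2 2 2).
Proof.
have U : 1 - x \is a GRing.unit by apply: unit_1BqX.
have xE : x = 'q * w by rewrite /x exprS.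
apply: (mulIr U); apply: (@fps_qX_inj (m.+1 + m)); rewrite exprD -/w -/x.
have := @contig_combination1 _ 'q w (tsum m.+1); rewrite -xE.
case; [exact: tsum_contig2 | exact: tsum_contig3 | exact: tsum_contig4 |].
rewrite -!tsum_down -/w -/x => _ E.
transitivity ('q * w ^+ 2 * (1 - x) * (tsum m.+1 1 2 1 - x * tsum m.+1 1 1 1)).
  by rewrite {1}xE; ring.
by rewrite E xE; ring.
Qed.

Lemma tsum_step3 m (u := 'q ^+ m) (w := 'q ^+ m.+1) :
  tsum m.+2 1 1 1 =
  ('q ^+ 2 * w ^+ 3 + 'q * w ^+ 2) * tsum m.+1 1 1 1
   + 'q ^+ 3 * w ^+ 4 * tsum m.+1 1 2 1
   + ('q ^+ 4 * w ^+ 5 + 'q ^+ 2 * w ^+ 2 + 'q) * tsum m.+1 2 2 2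
   - (1 - w) * 'q * w * u * (tsum m 1 2 1 + w * tsum m 2 2 2).
Proof.
have U : 1 - w \is a GRing.unit by apply: unit_1BqX.
have wE : w = 'q * u by rewrite /w exprS.
apply: (mulIr U); apply: (@fps_qX_inj m.+1); rewrite -/w.
have := @contig_combination2 _ 'q u (tsum m.+1); rewrite -wE.
move=> /(_ (@tsum_contig2 _) (@tsum_contig3 _) (@tsum_contig4 _)).
rewrite -!tsum_down -tsum_up -/u -/w => E.
transitivity (w * (1 - w) * tsum m.+2 1 1 1); first by ring.
by rewrite E wE; ring.
Qed.

Lemma tsum_step3_0 : tsum 1 1 1 1 = ('q ^+ 2 + 'q) * tsum 0 1 1 1
   + 'q ^+ 3 * tsum 0 1 2 1 + ('q ^+ 4 + 'q ^+ 2 + 'q) * tsum 0 2 2 2.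
Proof.
have rsum0 c : rsum 0 c = 1 by rewrite /rsum big_ord1 !muln0 qbinn0 mulr1.
have tsum0 b c d : tsum 0 b c d = 1.
  by rewrite /tsum big_ord1 /tcoef !rsum0 qbinn0 !muln0 expr0 !mulr1.
by rewrite tsum_up !tsum0 expr0; ring.
Qed.

(** * The refined sums and their functional equations *)

(** A sequence [s] stands for the series $\sum_n s_n z^n$: [dilate] is the
    substitution $z \mapsto zq$ and [differ] the multiplication by $1-z$. *)
Definition prev (s : nat -> fps int) n := if n is m.+1 then s m else 0.
Definition dilate (s : nat -> fps int) n := 'q ^+ n * s n.
Definition differ (s : nat -> fps int) n := s n - prev s n.

Definition tser b c d n := tsum n b c d / qfact n.

(** Coefficients of $z^n$ in the quadruple sums for the seven profiles of
    level 5, the summation variable $n_1$ being marked by $z$ and, in the last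
    three, every term of the cofactor but the first by one more $z$. *)
Definition s221 n := tser 1 1 1 n.
Definition s311 n := tser 1 2 1 n.
Definition s410 n := tser 2 2 2 n.
Definition s500 n := 'q ^+ n * tser 2 2 2 n.
Definition s401 n := 'q ^+ n * tser 1 2 1 n +
  prev (fun m => 'q * 'q ^+ m ^+ 2 * tser 2 2 2 m) n.
Definition s302 n := 'q ^+ n * tser 1 1 1 n +
  prev (fun m => 'q * 'q ^+ m ^+ 2 * tser 1 2 1 m
                 + 'q ^+ 2 * 'q ^+ m ^+ 3 * tser 2 2 2 m) n.
Definition s320 n := 'q ^+ n * tser 1 2 1 n +
  prev (fun m => 'q * 'q ^+ m ^+ 2 * tser 1 1 1 m
                 + 'q ^+ 2 * 'q ^+ m ^+ 3 * tser 1 2 1 m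
                 + 'q ^+ 3 * 'q ^+ m ^+ 4 * tser 2 2 2 m) n.

Definition dilate2 s := dilate (differ (dilate s)).
Definition dilate3 s := dilate (differ (dilate2 s)).

Lemma tserE b c d m : tser b c d m * qfact m = tsum m b c d.
Proof. by rewrite /tser divrK ?qfact_unit. Qed.

Lemma tser_step1 m (w := 'q ^+ m) (x := 'q ^+ m.+1) :
  tser 2 2 2 m.+1 - x ^+ 2 * tser 1 2 1 m.+1 =
  x * w * ((1 + 'q ^+ 2 * w ^+ 2) * tser 1 2 1 m + 'q * w * tser 1 1 1 m
     + ('q * w + 'q ^+ 3 * w ^+ 3) * tser 2 2 2 m).
Proof.
have := tsum_step1 m; rewrite -!tserE -/w -/x => E.
apply: (mulIr (qfact_unit m.+1)); set f := qfact m.+1 in E *.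
transitivity (tser 2 2 2 m.+1 * f - x ^+ 2 * (tser 1 2 1 m.+1 * f)); first by ring.
by rewrite E /f qfactS -/x; ring.
Qed.

Lemma tser_step2 m (w := 'q ^+ m) (x := 'q ^+ m.+1) :
  tser 1 2 1 m.+1 - x * tser 1 1 1 m.+1 =
  x * (w * tser 1 1 1 m + 'q * w ^+ 2 * tser 1 2 1 m
     + (1 + 'q ^+ 2 * w ^+ 3) * tser 2 2 2 m).
Proof.
have := tsum_step2 m; rewrite -!tserE -/w -/x => E.
apply: (mulIr (qfact_unit m.+1)); set f := qfact m.+1 in E *.
transitivity (tser 1 2 1 m.+1 * f - x * (tser 1 1 1 m.+1 * f)); first by ring.
by rewrite E /f qfactS -/x; ring.
Qed.

Lemma tser_step3 m (u := 'q ^+ m) (w := 'q ^+ m.+1) :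
  (1 - 'q ^+ m.+2) * tser 1 1 1 m.+2 =
  ('q ^+ 2 * w ^+ 3 + 'q * w ^+ 2) * tser 1 1 1 m.+1
   + 'q ^+ 3 * w ^+ 4 * tser 1 2 1 m.+1
   + ('q ^+ 4 * w ^+ 5 + 'q ^+ 2 * w ^+ 2 + 'q) * tser 2 2 2 m.+1
   - 'q * w * u * (tser 1 2 1 m + w * tser 2 2 2 m).
Proof.
have := tsum_step3 m; rewrite -!tserE -/u -/w => E.
apply: (mulIr (qfact_unit m.+1)).
transitivity (tser 1 1 1 m.+2 * qfact m.+2); first by rewrite (qfactS m.+1); ring.
by rewrite E [in RHS]qfactS qfactS -/w; ring.
Qed.

Lemma rsum0n c : rsum 0 c = 1.
Proof. by rewrite /rsum big_ord1 !muln0 qbinn0 mulr1. Qed.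

Lemma tser0 b c d : tser b c d 0 = 1.
Proof.
by rewrite /tser /tsum big_ord1 /tcoef !rsum0n qbinn0 !muln0 qfact0 divr1 expr0 !mulr1.
Qed.

Lemma tser_step3_0 : (1 - 'q) * tser 1 1 1 1 = 'q ^+ 4 + 'q ^+ 3 + 'q ^+ 2 *+ 2 + 'q *+ 2.
Proof.
have := tsum_step3_0; rewrite -!tserE !tser0 qfactS !qfact0 => E.
transitivity (tser 1 1 1 1 * (1 * (1 - 'q))); first by ring.
by rewrite E; ring.
Qed.

(** The next seven equations are the coefficients of $z^n$ in the functional
    equations of Corteel and Welsh: if $S_c(z)$ is the series attached to the
    profile $c$, they express $S_c(z)$ through the $S_{c'}(zq^j)$, where $c'$
    runs over the profiles obtained from $c$ by adding boxes at $j$ corners, with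
    the sign $(-1)^{j-1}$ and the factor $(zq;q)_{j-1}$. Those for (5,0,0),
    (4,0,1), (3,0,2) and (3,2,0) hold by the choice of the refined sums; the
    other three amount to the first order relations. *)
Lemma eqn500 n : s500 n = dilate s410 n.
Proof. by []. Qed.

Lemma eqn401 n : s401 n = dilate s311 n + dilate s500 n - dilate2 s410 n.
Proof.
rewrite /s401 /dilate2 /dilate /differ /dilate /s311 /s500 /s410.
by case: n => [|n] /=; rewrite ?exprS; ring.
Qed.

Lemma eqn302 n : s302 n = dilate s221 n + dilate s401 n - dilate2 s311 n.
Proof.
rewrite /s302 /dilate2 /dilate /differ /dilate /s311 /s401 /s221.
by case: n => [|n] /=; rewrite ?exprS; ring.
Qed.

Lemma eqn320 n : s320 n = dilate s302 n + dilate s311 n - dilate2 s221 n.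
Proof.
rewrite /s320 /dilate2 /dilate /differ /dilate /s311 /s302 /s221.
by case: n => [|n] /=; rewrite ?exprS; ring.
Qed.

Lemma eqn410 n : s410 n = dilate s320 n + dilate s401 n - dilate2 s311 n.
Proof.
rewrite /dilate2 /dilate /differ /dilate /s320 /s401 /s311 /s410.
case: n => [|n] /=; first by rewrite !tser0 expr0; ring.
have := tser_step1 n; set x := 'q ^+ n.+1; set w := 'q ^+ n => E.
have xE : x = 'q * w by rewrite /x exprS.
rewrite -[LHS](subrK (x ^+ 2 * tser 1 2 1 n.+1)) E xE; ring.
Qed.

Lemma eqn311 n : s311 n = dilate s221 n + dilate s302 n + dilate s410 n
  - dilate2 s221 n - dilate2 s320 n - dilate2 s401 n + dilate3 s311 n.
Proof.
rewrite /dilate3 /dilate2 /dilate /differ /dilate /s320 /s401 /s311 /s410 /s302 /s221.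
case: n => [|n] /=; first by rewrite !tser0 expr0; ring.
have := tser_step1 n; have := tser_step2 n.
set x := 'q ^+ n.+1; set w := 'q ^+ n => E2 E1.
have xE : x = 'q * w by rewrite /x exprS.
apply/eqP; rewrite -subr_eq0; apply/eqP.
case: n => [|n] /= in x w E1 E2 xE *.
  have w1 : w = 1 by rewrite /w expr0.
  move: E1 E2; rewrite !tser0 xE w1 => /eqP; rewrite -subr_eq0 => /eqP E1 /eqP.
  rewrite -subr_eq0 => /eqP E2.
  transitivity ((tser 1 2 1 1 - 'q * 1 * tser 1 1 1 1 -
    'q * 1 * (1 * 1 + 'q * 1 ^+ 2 * 1 + (1 + 'q ^+ 2 * 1 ^+ 3) * 1)) -
    'q * (tser 2 2 2 1 - ('q * 1) ^+ 2 * tser 1 2 1 1 -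
    'q * 1 * 1 * ((1 + 'q ^+ 2 * 1 ^+ 2) * 1 + 'q * 1 * 1 + ('q * 1 + 'q ^+ 3 * 1 ^+ 3) * 1))).
    by ring.
  by rewrite E1 E2; ring.
(* The double dilations bring in the first relation at the previous index. *)
have := tser_step1 n; set u := 'q ^+ n; rewrite -/w => E0.
have wE : w = 'q * u by rewrite /w exprS.
move: E0 E1 E2 => /eqP; rewrite -subr_eq0 => /eqP E0 /eqP; rewrite -subr_eq0.
move=> /eqP E1 /eqP; rewrite -subr_eq0 => /eqP E2.
transitivity (
  (tser 1 2 1 n.+2 - x * tser 1 1 1 n.+2 -
     x * (w * tser 1 1 1 n.+1 + 'q * w ^+ 2 * tser 1 2 1 n.+1
     + (1 + 'q ^+ 2 * w ^+ 3) * tser 2 2 2 n.+1))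
  - x * (tser 2 2 2 n.+2 - x ^+ 2 * tser 1 2 1 n.+2 -
    x * w * ((1 + 'q ^+ 2 * w ^+ 2) * tser 1 2 1 n.+1 + 'q * w * tser 1 1 1 n.+1
     + ('q * w + 'q ^+ 3 * w ^+ 3) * tser 2 2 2 n.+1))
  + x * (tser 2 2 2 n.+1 - w ^+ 2 * tser 1 2 1 n.+1 -
  w * u * ((1 + 'q ^+ 2 * u ^+ 2) * tser 1 2 1 n + 'q * u * tser 1 1 1 n
     + ('q * u + 'q ^+ 3 * u ^+ 3) * tser 2 2 2 n))).
  by rewrite xE wE; ring.
by rewrite E0 E1 E2; ring.
Qed.

Lemma eqn221 n : s221 n = dilate s311 n + dilate s221 n + dilate s320 n
  - dilate2 s221 n - dilate2 s302 n - dilate2 s311 n + dilate3 s221 n.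
Proof.
rewrite /dilate3 /dilate2 /dilate /differ /dilate /s320 /s311 /s302 /s221.
case: n => [|n] /=; first by rewrite !tser0 expr0; ring.
have := tser_step2 n.
set x := 'q ^+ n.+1; set w := 'q ^+ n => E2.
have xE : x = 'q * w by rewrite /x exprS.
apply/eqP; rewrite -subr_eq0; apply/eqP.
case: n => [|n] /= in x w E2 xE *.
  have w1 : w = 1 by rewrite /w expr0.
  move: E2 tser_step3_0; rewrite !tser0 xE w1 => /eqP; rewrite -subr_eq0 => /eqP E2 /eqP.
  rewrite -subr_eq0 => /eqP E3.
  transitivity (((1 - 'q) * tser 1 1 1 1 - ('q ^+ 4 + 'q ^+ 3 + 'q ^+ 2 *+ 2 + 'q *+ 2))
    - 'q * (tser 1 2 1 1 - 'q * 1 * tser 1 1 1 1 -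
    'q * 1 * (1 * 1 + 'q * 1 ^+ 2 * 1 + (1 + 'q ^+ 2 * 1 ^+ 3) * 1))).
    by ring.
  by rewrite E2 E3; ring.
(* The double dilations bring in the first relation at the previous index. *)
have := tser_step1 n; have := tser_step3 n; rewrite -/x -/w.
set u := 'q ^+ n => E3 E1.
have wE : w = 'q * u by rewrite /w exprS.
move: E1 E2 E3 => /eqP; rewrite -subr_eq0 => /eqP E1 /eqP; rewrite -subr_eq0.
move=> /eqP E2 /eqP; rewrite -subr_eq0 => /eqP E3.
transitivity (
 ((1 - x) * tser 1 1 1 n.+2 -
  (('q ^+ 2 * w ^+ 3 + 'q * w ^+ 2) * tser 1 1 1 n.+1
   + 'q ^+ 3 * w ^+ 4 * tser 1 2 1 n.+1
   + ('q ^+ 4 * w ^+ 5 + 'q ^+ 2 * w ^+ 2 + 'q) * tser 2 2 2 n.+1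
   - 'q * w * u * (tser 1 2 1 n + w * tser 2 2 2 n)))
  - x * (tser 1 2 1 n.+2 - x * tser 1 1 1 n.+2 -
     x * (w * tser 1 1 1 n.+1 + 'q * w ^+ 2 * tser 1 2 1 n.+1
     + (1 + 'q ^+ 2 * w ^+ 3) * tser 2 2 2 n.+1))
  + 'q * (tser 2 2 2 n.+1 - w ^+ 2 * tser 1 2 1 n.+1 -
  w * u * ((1 + 'q ^+ 2 * u ^+ 2) * tser 1 2 1 n + 'q * u * tser 1 1 1 n
     + ('q * u + 'q ^+ 3 * u ^+ 3) * tser 2 2 2 n))).
  by rewrite xE wE; ring.
by rewrite E1 E2 E3; ring.
Qed.

(** * The recursion in the largest part *)

(** Coefficient of $z^N$ in $\sum_n s_n z^n/(z;q)_\infty$. *)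
Definition over_zpoch (s : nat -> fps int) (N : nat) : fps int :=
  \sum_(n < N.+1) s n / qfact (N - n).

Lemma eq_over_zpoch s t N : s =1 t -> over_zpoch s N = over_zpoch t N.
Proof. by move=> st; apply: eq_bigr => n _; rewrite st. Qed.

(** Multiplication by $1-z$. *)
Lemma over_zpoch_differ s N :
  over_zpoch (differ s) N.+1 = over_zpoch s N.+1 - over_zpoch s N.
Proof.
rewrite /over_zpoch /differ; under eq_bigr => n _ do rewrite mulrBl.
rewrite sumrB; congr (_ - _); rewrite big_ord_recl /= mul0r add0r.
by apply: eq_bigr => n _; rewrite /bump /= subSS.
Qed.

(** Since $(1-z)S(zq)/(z;q)_\infty=S(zq)/(zq;q)_\infty$, the substitution
    $z\mapsto zq$ is applied to the whole quotient. *)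
Lemma over_zpoch_dilate s N :
  over_zpoch (differ (dilate s)) N = 'q ^+ N * over_zpoch s N.
Proof.
case: N => [|N].
  by rewrite /over_zpoch !big_ord1 /differ /dilate /= subr0 expr0 !mul1r.
rewrite over_zpoch_differ /over_zpoch big_ord_recr [in RHS]big_ord_recr /=.
rewrite addrAC -sumrB mulrDr mulr_sumr subnn; congr (_ + _); last first.
  by rewrite mulrA.
apply: eq_bigr => n _; have le_nN : (n <= N)%N by rewrite -ltnS.
rewrite subSn // qfactS /dilate; set f := qfact _; set g := 1 - _.
have Uf : f \is a GRing.unit by apply: qfact_unit.
have Ug : g \is a GRing.unit by apply: unit_1BqX.
set a := (f * g)^-1; have -> : f^-1 = a * g by rewrite /a invrM // mulrAC mulVr ?mul1r.
have -> : 'q ^+ N.+1 = 'q ^+ n * 'q ^+ (N - n).+1 :> fps int.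
  by rewrite -exprD; congr (_ ^+ _); lia.
by rewrite /g; ring.
Qed.

Definition profile := (nat * nat * nat)%type.

(** Adding a box to the inner shape in row $i$ lowers $c_i$ by one and raises the
    next entry; the rows selected by [j] can each take one if their entries are
    positive. *)
Definition corner (c : profile) (j : bool * bool * bool) :=
  [&& j.1.1 <= c.1.1, j.1.2 <= c.1.2 & j.2 <= c.2]%N.

Definition add_corner (c : profile) (j : bool * bool * bool) : profile :=
  ((c.1.1 + j.2 - j.1.1), (c.1.2 + j.1.1 - j.1.2), (c.2 + j.1.2 - j.2))%N.

Definition corner_sets : seq (bool * bool * bool) :=
  [:: (false, false, true); (false, true, false); (false, true, true);
      (true, false, false); (true, false, true); (true, true, false);
      (true, true, true)].

Definition corner_size (j : bool * bool * bool) : nat := j.1.1 + j.1.2 + j.2.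

Definition corners (c : profile) : seq (nat * profile) :=
  [seq (corner_size j, add_corner c j) | j <- corner_sets & corner c j].

(** The Corteel-Welsh recursion, for cylindric partitions with parts at most
    [N] and [N.+1]. *)
Definition corner_rec (X : profile -> nat -> fps int) c N :=
  X c N = X c N.+1 + \sum_(p <- corners c) (- 'q ^+ N.+1) ^+ p.1 * X p.2 N.+1.

(** The terms of index [N.+1] in the sum carry a positive power of
    [q ^+ N.+1], so the recursion determines the coefficients of [X c N.+1] one
    after the other from [X c N]. *)
Lemma corner_rec_uniq (X Y : profile -> nat -> fps int) (P : pred profile) :
  (forall c j, P c -> corner c j -> P (add_corner c j)) ->
  (forall c, P c -> X c 0 = Y c 0) ->
  (forall c N, P c -> corner_rec X c N) -> (forall c N, P c -> corner_rec Y c N) ->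
  forall c N, P c -> X c N = Y c N.
Proof.
move=> Pj XY0 recX recY c N; elim: N c => [|N IHN] c Pc; first exact: XY0.
apply: eq_upto_fps => n; elim/ltn_ind: n c Pc => n IHn c Pc k le_kn.
have [lt_kn|] := ltnP k n; first by apply: (IHn _ lt_kn).
move=> le_nk; have {le_kn le_nk} -> : k = n by lia.
have := recX c N Pc; have := recY c N Pc; rewrite /corner_rec -IHN // => -> /fpsP/(_ n).
rewrite !fpsDE [X in _ + X](_ : _ =
  (\sum_(p <- corners c) (- 'q ^+ N.+1) ^+ p.1 * X p.2 N.+1)``_n); first by move/addIr.
rewrite !fps_sumE [LHS]big_seq [RHS]big_seq; apply: eq_bigr => p.
case/mapP=> j; rewrite mem_filter => /andP[cj js ->].
set e' := corner_size j; rewrite -[(e', _).1]/e' -[(e', _).2]/(add_corner c j).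
have e_gt0 : (0 < e')%N.
  by move: js; rewrite !inE /e'; case: (j) => [[[] []] []].
rewrite exprNn -exprM -!mulrA.
have sgn f : ((-1) ^+ e' * f : fps int)``_n = (-1) ^+ e' * f``_n.
  by elim: (e') => [|a IHa]; rewrite ?expr0 ?mul1r // !exprS !mulN1r !mulNr fpsNE IHa.
rewrite !sgn !fps_qXM; case: leqP => // le_n; congr (_ * _).
apply/esym/(IHn (n - N.+1 * e')%N) => //; last exact: Pj.
have Ne_gt0 : (0 < N.+1 * e')%N by rewrite muln_gt0.
by rewrite -subn_gt0 subKn.
Qed.

(** A cyclic rotation of the profile does not change the count, so seven series
    serve the 21 profiles of rank 3 and level 5. *)
Definition level5_series (c : profile) : nat -> fps int :=
  match c with
  | (5, 0, 0) | (0, 5, 0) | (0, 0, 5) => s500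
  | (4, 1, 0) | (0, 4, 1) | (1, 0, 4) => s410
  | (4, 0, 1) | (1, 4, 0) | (0, 1, 4) => s401
  | (3, 2, 0) | (0, 3, 2) | (2, 0, 3) => s320
  | (3, 0, 2) | (2, 3, 0) | (0, 2, 3) => s302
  | (3, 1, 1) | (1, 3, 1) | (1, 1, 3) => s311
  | (2, 2, 1) | (1, 2, 2) | (2, 1, 2) => s221
  | _ => fun=> 0
  end.

Definition level5 (c : profile) := (c.1.1 + c.1.2 + c.2 == 5)%N.

Lemma over_zpochD s t N :
  over_zpoch (fun n => s n + t n) N = over_zpoch s N + over_zpoch t N.
Proof. by rewrite /over_zpoch -big_split; apply: eq_bigr => n _; rewrite mulrDl. Qed.

Lemma over_zpochB s t N :
  over_zpoch (fun n => s n - t n) N = over_zpoch s N - over_zpoch t N.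
Proof. by rewrite /over_zpoch -sumrB; apply: eq_bigr => n _; rewrite mulrBl. Qed.

Lemma differD s t : differ (fun n => s n + t n) =1 (fun n => differ s n + differ t n).
Proof. by case=> [|n]; rewrite /differ /=; ring. Qed.

Lemma differB s t : differ (fun n => s n - t n) =1 (fun n => differ s n - differ t n).
Proof. by case=> [|n]; rewrite /differ /=; ring. Qed.

Lemma over_zpoch_dilate2 s N :
  over_zpoch (differ (dilate2 s)) N = ('q ^+ N) ^+ 2 * over_zpoch s N.
Proof. by rewrite over_zpoch_dilate over_zpoch_dilate mulrA. Qed.

Lemma over_zpoch_dilate3 s N :
  over_zpoch (differ (dilate3 s)) N = ('q ^+ N) ^+ 3 * over_zpoch s N.
Proof. by rewrite over_zpoch_dilate over_zpoch_dilate2 mulrA. Qed.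

Lemma over_zpoch_pred s t N : s =1 t ->
  over_zpoch s N = over_zpoch s N.+1 - over_zpoch (differ t) N.+1.
Proof.
move=> st; rewrite (@eq_over_zpoch (differ t) (differ s)) => [|n].
  by rewrite over_zpoch_differ opprB addrC subrK.
by rewrite /differ st; case: n => //= n; rewrite st.
Qed.

Lemma over_zpoch_rec1 s a N (y := 'q ^+ N.+1) : s =1 dilate a ->
  over_zpoch s N = over_zpoch s N.+1 - y * over_zpoch a N.+1.
Proof. by move=> /over_zpoch_pred->; rewrite over_zpoch_dilate. Qed.

Lemma over_zpoch_rec2 s a b c N (y := 'q ^+ N.+1) :
  s =1 (fun n => dilate a n + dilate b n - dilate2 c n) ->
  over_zpoch s N = over_zpoch s N.+1 - (y * over_zpoch a N.+1 +
    y * over_zpoch b N.+1 - y ^+ 2 * over_zpoch c N.+1).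
Proof.
move=> /over_zpoch_pred->; rewrite (eq_over_zpoch _ (@differB _ _)) over_zpochB.
rewrite (eq_over_zpoch _ (@differD _ _)) over_zpochD over_zpoch_dilate2.
by rewrite !over_zpoch_dilate.
Qed.

Lemma over_zpoch_rec3 s a1 a2 a3 b1 b2 b3 c N (y := 'q ^+ N.+1) :
  s =1 (fun n => dilate a1 n + dilate a2 n + dilate a3 n
                 - dilate2 b1 n - dilate2 b2 n - dilate2 b3 n + dilate3 c n) ->
  over_zpoch s N = over_zpoch s N.+1 - (y * over_zpoch a1 N.+1 +
    y * over_zpoch a2 N.+1 + y * over_zpoch a3 N.+1
    - y ^+ 2 * over_zpoch b1 N.+1 - y ^+ 2 * over_zpoch b2 N.+1
    - y ^+ 2 * over_zpoch b3 N.+1 + y ^+ 3 * over_zpoch c N.+1).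
Proof.
move=> /over_zpoch_pred->; rewrite (eq_over_zpoch _ (@differD _ _)) over_zpochD.
do 3![rewrite (eq_over_zpoch _ (@differB _ _)) over_zpochB].
do 2![rewrite (eq_over_zpoch _ (@differD _ _)) over_zpochD].
by rewrite over_zpoch_dilate3 !over_zpoch_dilate2 !over_zpoch_dilate.
Qed.

(** Multiplied by $1/(z;q)_\infty$, the functional equations of the refined sums
    become the recursion, once for each of the 21 profiles. *)
Lemma level5_corner_rec c N : level5 c ->
  corner_rec (fun c => over_zpoch (level5_series c)) c N.
Proof.
have h500 := over_zpoch_rec1 N eqn500; have h401 := over_zpoch_rec2 N eqn401.
have h302 := over_zpoch_rec2 N eqn302; have h320 := over_zpoch_rec2 N eqn320.
have h410 := over_zpoch_rec2 N eqn410; have h311 := over_zpoch_rec3 N eqn311.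
have h221 := over_zpoch_rec3 N eqn221.
case: c => [[i j] k]; rewrite /level5 -[_.1.1]/i -[_.1.2]/j -[_.2]/k => /eqP l5.
have {l5} [ij ->] : (i + j <= 5)%N /\ k = (5 - i - j)%N by lia.
rewrite /corner_rec; move: h500 h401 h302 h320 h410 h311 h221.
(* The sum is expanded with [Z] opaque, so that only the profiles compute. *)
move: over_zpoch => Z.
case: i ij => [|[|[|[|[|[|i]]]]]] ij; try by [].
all: case: j ij => [|[|[|[|[|[|j]]]]]] // _.
all: match goal with |- context [corners ?c] =>
  let l := eval vm_compute in (corners c) in change (corners c) with l end.
all: rewrite !big_cons big_nil.
all: cbn [level5_series fst snd subn subn_rec Nat.sub].
all: move=> h500 h401 h302 h320 h410 h311 h221.
all: rewrite ?h500 ?h401 ?h302 ?h320 ?h410 ?h311 ?h221.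
all: ring.
Qed.

(** * Counting series *)

Definition count_set (I : choiceType) (A : set I) : int := \sum_(i \in A) (1 : int).

(** The weight takes its values in [int] because the weights of chains have terms
    of both signs. *)
Definition gseries (I : choiceType) (A : set I) (w : I -> int) : fps int :=
  Fps (fun n => count_set [set i | A i /\ w i = n%:Z]).

(** The condition under which [gseries A w] loses no element of [A]. *)
Definition tame (I : choiceType) (A : set I) (w : I -> int) :=
  (forall n : int, finite_set [set i | A i /\ w i = n]) /\
  (forall i, A i -> 0 <= w i).

Lemma set_bij_fiber (I J : choiceType) (A : set I) (B : set J) (w : I -> int)
    (w' : J -> int) (f : I -> J) (n m : int) : set_bij A B f ->
  (forall i, A i -> w i = n <-> w' (f i) = m) ->
  set_bij [set i | A i /\ w i = n] [set j | B j /\ w' j = m] f.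
Proof.
move=> [fAB finj fsurj] wE; split.
- by move=> i [Ai wi] /=; split; [exact: fAB | apply/wE].
- move=> i j; rewrite !inE => -[Ai _] [Aj _]; apply: finj; exact/mem_set.
- move=> j [Bj wj]; have [i Ai fij] := fsurj j Bj; exists i => //=.
  by split=> //; apply/wE => //; rewrite fij.
Qed.

Lemma count_bij (I J : choiceType) (A : set I) (B : set J) (f : I -> J) :
  set_bij A B f -> count_set A = count_set B.
Proof. by move=> fAB; rewrite /count_set (reindex_fsbig _ _ _ _ fAB). Qed.

Lemma gseries_bij (I J : choiceType) (A : set I) (B : set J) (w : I -> int)
    (w' : J -> int) (f : I -> J) : set_bij A B f ->
  (forall i, A i -> w i = w' (f i)) -> gseries A w = gseries B w'.
Proof.
move=> fAB wE; apply/fpsP => n; apply: count_bij.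
by apply: (set_bij_fiber fAB) => i Ai; rewrite wE.
Qed.

Lemma finite_set_bij (I J : choiceType) (A : set I) (B : set J) (f : I -> J) :
  set_bij A B f -> finite_set A -> finite_set B.
Proof.
by move=> [_ _ fsurj] finA; apply: sub_finite_set fsurj (finite_image f finA).
Qed.

Lemma tame_bij (I J : choiceType) (A : set I) (B : set J) (w : I -> int)
    (w' : J -> int) (f : I -> J) : set_bij A B f ->
  (forall i, A i -> w i = w' (f i)) -> tame A w -> tame B w'.
Proof.
move=> fAB wE [finA w0]; split=> [n|j Bj].
  apply: (finite_set_bij _ (finA n)); apply: (set_bij_fiber fAB) => i Ai.
  by rewrite wE.
by have [_ _ fsurj] := fAB; have [i Ai <-] := fsurj j Bj; rewrite -wE ?w0.
Qed.

Lemma gseries_shift (I : choiceType) (A : set I) (w w' : I -> int) (e : nat) :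
  (forall i, A i -> 0 <= w i) -> (forall i, A i -> w' i = w i + e%:Z) ->
  gseries A w' = 'q ^+ e * gseries A w.
Proof.
move=> w0 wE; apply/fpsP => n; rewrite fps_qXM; case: leqP => [le_en|lt_ne].
  congr (count_set _); apply/seteqP; split=> i [Ai wi]; split=> //; move: wi.
    by rewrite wE // => wi; lia.
  by rewrite (wE _ Ai) => wi; lia.
rewrite [LHS]/(count_set _) (_ : [set i | _] = set0); first exact: fsbig_set0.
by apply/seteqP; split=> // i [Ai]; rewrite wE //; have := w0 i Ai; lia.
Qed.

Lemma count_setU (I : choiceType) (A B : set I) : finite_set A -> finite_set B ->
  (forall i, A i -> ~ B i) -> count_set (A `|` B)%classic = count_set A + count_set B.
Proof.
move=> finA finB AB; apply: fsbigU0 => // i [Ai Bi]; exact: AB Ai Bi.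
Qed.

Lemma count_cond (I : choiceType) (A : set I) (P : pred I) : finite_set A ->
  count_set [set i | A i /\ P i] = \sum_(i <- finmap.enum_fset (fset_set A)) (P i)%:R.
Proof.
move=> finA; rewrite -fsbig_finite //=.
rewrite /count_set (_ : [set i | _] = A `&` [set i | P i])%classic //.
rewrite fsbig_mkcondr; apply: eq_fsbigr => i _.
by case: (boolP (P i)) => Pi; [rewrite mem_set | rewrite memNset //; apply/negP].
Qed.

(** * Cylindric partitions with bounded parts *)

Lemma partition_size_sumn s : is_partition s -> (size s <= sumn s)%N.
Proof.
case/andP=> _; elim: s => //= x s IHs; rewrite inE negb_or => /andP[x0 /IHs].
by move: x0; rewrite eq_sym -lt0n; lia.
Qed.

Lemma mem_leq_sumn (s : seq nat) x : x \in s -> (x <= sumn s)%N.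
Proof. by elim: s => //= y s IHs; rewrite inE => /predU1P[->|/IHs]; lia. Qed.

Lemma finite_partitions n :
  finite_set [set s : seq nat | is_partition s /\ (sumn s <= n)%N].
Proof.
pose f (t : n.-bseq 'I_n.+1) : seq nat := map val t.
apply: (@sub_finite_set _ _ (range f)); last exact: finite_image finite_finset.
move=> s [ps le_sn]; have le_size := leq_trans (partition_size_sumn ps) le_sn.
have szP : (size (map (fun x => inord x : 'I_n.+1) s) <= n)%N by rewrite size_map.
exists (Bseq szP) => //; rewrite /f /= -map_comp -[RHS]map_id.
apply/eq_in_map => x /mem_leq_sumn le_x /=.
by rewrite inordK // ltnS (leq_trans le_x).
Qed.

Lemma finite_tuples (T : choiceType) (P : set T) k : finite_set P ->
  finite_set [set L : k.-tuple T | forall i, P (tnth L i)].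
Proof.
move=> /finite_seqP[r rP]; case: k => [|k].
  apply: (@sub_finite_set _ _ [set [tuple]]); last exact: finite_set1.
  by move=> L _ /=; rewrite tuple0.
case: r rP => [|x0 r] rP.
  rewrite (_ : [set L | _] = set0)%classic //; apply/seteqP; split=> // L PL.
  by have := PL ord0; rewrite rP.
pose f (t : k.+1.-tuple 'I_(size (x0 :: r))) :=
  map_tuple (fun i : 'I_(size (x0 :: r)) => nth x0 (x0 :: r) i) t.
apply: (@sub_finite_set _ _ (range f)); last exact: finite_image finite_finset.
move=> L PL; exists [tuple (inord (index (tnth L i) (x0 :: r)) : 'I_(size r).+1) | i < k.+1].
  by [].
apply: eq_from_tnth => i; rewrite tnth_map tnth_mktuple.
have : tnth L i \in x0 :: r by have := PL i; rewrite rP.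
by move=> Lr; rewrite inordK ?nth_index //; rewrite -index_mem in Lr.
Qed.

Lemma finite_cyl k (c : k.-tuple nat) n :
  finite_set [set L | is_cylindric c L /\ (cyl_size L)%:Z = n].
Proof.
apply: sub_finite_set (finite_tuples k (finite_partitions `|n|%N)).
move=> L [[Lpart _] <-] i; split=> //.
by rewrite absz_nat /cyl_size (bigD1 i) //= leq_addr.
Qed.

Definition cyl_weight k (L : k.-tuple (seq nat)) : int := (cyl_size L)%:Z.

Lemma tame_cyl k (c : k.-tuple nat) : tame [set L | is_cylindric c L] (@cyl_weight k).
Proof. by split=> [n|L _]; [exact: finite_cyl | rewrite /cyl_weight]. Qed.

Lemma cyl_max_leP k (L : k.-tuple (seq nat)) N :
  reflect (forall i, {in tnth L i, forall m, (m <= N)%N}) (cyl_max L <= N)%N.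
Proof.
apply: (iffP (bigmax_leqP _ _ _)) => [LN i m mi|LN i _].
  by apply: leq_trans (LN i isT); apply: leq_bigmax_seq.
by apply/bigmax_leqP_seq => m mi _; apply: LN mi.
Qed.

Lemma partition_head_max s m : is_partition s -> m \in s -> (m <= nth 0%N s 0)%N.
Proof.
case/andP; case: s => //= x s xs _; rewrite inE => /predU1P[->//|ms].
have geq_trans : transitive geq by move=> ? ? ? /= h1 h2; exact: leq_trans h2 h1.
by move: xs => /(order_path_min geq_trans)/allP/(_ m ms).
Qed.

Definition row_top N k (L : k.-tuple (seq nat)) i := nth 0%N (tnth L i) 0 == N.

(** Deleting its first part shifts a row with respect to its neighbours and so
    changes the profile. *)
Definition delete_tops k (J : pred 'I_k) (L : k.-tuple (seq nat)) :=
  [tuple if J i then behead (tnth L i) else tnth L i | i < k].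

Definition insert_tops N k (J : pred 'I_k) (L : k.-tuple (seq nat)) :=
  [tuple if J i then N :: tnth L i else tnth L i | i < k].

(** A maximal part can be put back in front of its row without violating any of
    the inequalities. *)
Lemma delete_tops_bij k (c c' : k.-tuple nat) (J : pred 'I_k) N :
  (forall i, tnth c' (ordS i) + J (ordS i) = tnth c (ordS i) + J i)%N ->
  set_bij [set L | (is_cylindric c L /\ (cyl_max L <= N.+1)%N) /\
                   forall i, J i -> row_top N.+1 L i]
          [set L | is_cylindric c' L /\ (cyl_max L <= N.+1)%N] (delete_tops J).
Proof.
move=> cJ; pose g := insert_tops N.+1 J.
have gK : cancel g (delete_tops J).
  move=> L; apply: eq_from_tnth => i; rewrite !tnth_mktuple.
  by case: (J i).
have fK L : (forall i, J i -> row_top N.+1 L i) -> g (delete_tops J L) = L.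
  move=> LJ; apply: eq_from_tnth => i; rewrite !tnth_mktuple.
  case: (boolP (J i)) => [/LJ|//]; rewrite /row_top.
  by case: (tnth L i) => [|x s] //= /eqP->.
split.
- move=> L [[[Lpart Lcyl] /cyl_max_leP Lmax] LJ] /=; split; last first.
    apply/cyl_max_leP => i m; rewrite tnth_mktuple.
    by case: (J i) => [/mem_behead|]; apply: Lmax.
  have nthL i j : nth 0%N (tnth (delete_tops J L) i) j = nth 0%N (tnth L i) (j + J i).
    by rewrite tnth_mktuple; case: (J i); rewrite ?addn0 // nth_behead addn1.
  split=> [i|i j].
    rewrite tnth_mktuple; have := Lpart i; case: (J i) => //.
    case: (tnth L i) => //= x s /andP[/path_sorted s_sort]; rewrite inE negb_or.
    by rewrite /is_partition s_sort => /andP[].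
  by rewrite !nthL -addnA cJ (addnC (tnth c _)) addnA; exact: Lcyl.
- by move=> L L'; rewrite !inE => -[_ LJ] [_ LJ'] E; rewrite -(fK L) // E fK.
- move=> L [[Lpart Lcyl] /cyl_max_leP Lmax] /=; exists (g L) => //; split; last first.
    by move=> i Ji; rewrite /row_top tnth_mktuple Ji.
  have gmax : (cyl_max (g L) <= N.+1)%N.
    apply/cyl_max_leP => i m; rewrite tnth_mktuple.
    by case: (J i) => [|/Lmax//]; rewrite inE => /predU1P[->//|/Lmax].
  split=> //; have nthL i j : nth 0%N (tnth L i) j = nth 0%N (tnth (g L) i) (j + J i).
    by rewrite tnth_mktuple; case: (J i); rewrite ?addn0 // addn1.
  have gpart i : is_partition (tnth (g L) i).
    rewrite tnth_mktuple; have := Lpart i; case: (J i) => // /andP[sL nL].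
    rewrite /is_partition /= inE negb_or nL /= andbT path_min_sorted //.
    by apply/allP => m /Lmax.
  split=> // i j; have [lt_j|le_j] := ltnP j (J i).
    have -> : nth 0%N (tnth (g L) i) j = N.+1.
      by move: lt_j; rewrite tnth_mktuple; case: (J i) => //=; case: (j).
    have [lt_nth|le_nth] := ltnP (j + tnth c (ordS i)) (size (tnth (g L) (ordS i))).
      by apply: (cyl_max_leP _ _ gmax (ordS i)); apply: mem_nth.
    by rewrite nth_default.
  rewrite -(subnK le_j); set j' := (j - J i)%N; rewrite -nthL.
  by have := Lcyl i j'; rewrite nthL -addnA cJ (addnC (tnth c _)) addnA.
Qed.

Lemma delete_tops_size k (J : pred 'I_k) (L : k.-tuple (seq nat)) N :
  (forall i, J i -> row_top N L i) ->
  cyl_size L = (cyl_size (delete_tops J L) + N * \sum_(i < k) J i)%N.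
Proof.
move=> LJ; rewrite /cyl_size big_distrr -big_split; apply: eq_bigr => i _ /=.
rewrite tnth_mktuple; case: (boolP (J i)) => [/LJ|_]; last by rewrite muln0 addn0.
rewrite /row_top muln1; case: (tnth L i) => [|x s] /= /eqP<- //.
by rewrite addnC.
Qed.

Definition prof_tuple (c : profile) : 3.-tuple nat := [tuple c.1.1; c.1.2; c.2].

Definition cyl_bounded (c : profile) (N : nat) : fps int :=
  gseries [set L | is_cylindric (prof_tuple c) L /\ (cyl_max L <= N)%N] (@cyl_weight 3).

Definition corner_pred (j : bool * bool * bool) : pred 'I_3 :=
  fun i => tnth [tuple j.1.1; j.1.2; j.2] i.

Lemma forall_ord3 (P : 'I_3 -> Prop) :
  P ord0 -> P (inord 1) -> P (inord 2) -> forall i, P i.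
Proof.
move=> P0 P1 P2 [[|[|[|//]]] lt_i].
- by rewrite (_ : Ordinal lt_i = ord0) //; apply: val_inj.
- by rewrite (_ : Ordinal lt_i = inord 1) //; apply: val_inj; rewrite /= inordK.
- by rewrite (_ : Ordinal lt_i = inord 2) //; apply: val_inj; rewrite /= inordK.
Qed.

Lemma tnth3 (T : Type) (a b c : T) : [/\ tnth [tuple a; b; c] ord0 = a,
  tnth [tuple a; b; c] (inord 1) = b & tnth [tuple a; b; c] (inord 2) = c].
Proof. by rewrite !(tnth_nth a) /= !inordK. Qed.

Lemma ordS3 : [/\ @ordS 3 ord0 = inord 1, @ordS 3 (inord 1) = inord 2 &
  @ordS 3 (inord 2) = ord0].
Proof. by split; apply: val_inj; rewrite /= ?inordK. Qed.

Lemma cyl_bounded_tops c j N : corner c j ->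
  gseries [set L | (is_cylindric (prof_tuple c) L /\ (cyl_max L <= N.+1)%N) /\
                   forall i, corner_pred j i -> row_top N.+1 L i] (@cyl_weight 3)
  = 'q ^+ (N.+1 * corner_size j) * cyl_bounded (add_corner c j) N.+1.
Proof.
case: c j => [[c0 c1] c2] [[j0 j1] j2]; rewrite /corner /= => /and3P[le0 le1 le2].
have [o0 o1 o2] := ordS3; have [p0 p1 p2] := tnth3 j0 j1 j2.
rewrite /cyl_bounded /prof_tuple /add_corner /=.
set J := corner_pred _; set c := [tuple c0; c1; c2]; set c' := [tuple _; _; _].
have sizeJ : (\sum_(i < 3) J i = corner_size (j0, j1, j2))%N.
  by rewrite !big_ord_recl big_ord0 addn0 addnA.
have cJ : forall i, (tnth c' (ordS i) + J (ordS i) = tnth c (ordS i) + J i)%N.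
  have [t0 t1 t2] := tnth3 c0 c1 c2.
  have [t0' t1' t2'] := tnth3 (c0 + j2 - j0)%N (c1 + j0 - j1)%N (c2 + j1 - j2)%N.
  rewrite /J /corner_pred /c /c'; apply: forall_ord3.
  - by rewrite o0 t1 t1' p0 p1; lia.
  - by rewrite o1 t2 t2' p1 p2; lia.
  - by rewrite o2 t0 t0' p2 p0; lia.
have bij := delete_tops_bij N cJ.
rewrite -(@gseries_shift _ _ _ (fun L => cyl_weight L + (N.+1 * corner_size (j0, j1, j2))%:Z)) //.
apply: (gseries_bij bij) => L [_ LJ].
by rewrite /cyl_weight (delete_tops_size LJ) sizeJ PoszD.
Qed.

(** If row $i+1$ starts with the maximum and $c_{i+1}=0$, then row $i$ starts
    with it too; going round the cycle, one meets a row with a positive entry of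
    the profile. *)
Lemma cyl_max_corner c (L : 3.-tuple (seq nat)) N : (0 < c.1.1 + c.1.2 + c.2)%N ->
  is_cylindric (prof_tuple c) L -> (cyl_max L <= N.+1)%N ->
  (cyl_max L <= N)%N = ~~ [|| (0 < c.1.1)%N && row_top N.+1 L ord0,
    (0 < c.1.2)%N && row_top N.+1 L (inord 1) | (0 < c.2)%N && row_top N.+1 L (inord 2)].
Proof.
move=> c_gt0 [Lpart Lcyl] Lmax.
have topE i : row_top N.+1 L i = (N.+1 <= nth 0%N (tnth L i) 0)%N.
  have le_top : (nth 0%N (tnth L i) 0 <= N.+1)%N.
    case E : (tnth L i) => [|x s] //=; apply: (cyl_max_leP _ _ Lmax i).
    by rewrite E mem_head.
  by rewrite /row_top eqn_leq le_top.
have -> : (cyl_max L <= N)%N = ~~ [|| row_top N.+1 L ord0, row_top N.+1 L (inord 1) |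
    row_top N.+1 L (inord 2)].
  rewrite !topE; apply/cyl_max_leP/norP => [LN|[h0 /norP[h1 h2]]].
    have h i : ~~ (N < nth 0 (tnth L i) 0)%N.
      rewrite -leqNgt; case E : (tnth L i) => [|x s] //=; apply: (LN i).
      by rewrite E mem_head.
    by split; last apply/norP; rewrite ?h.
  by apply: forall_ord3 => m /(partition_head_max (Lpart _)) le_m;
     apply: leq_trans le_m _; rewrite leqNgt.
congr (~~ _); have [o0 o1 o2] := ordS3; have [t0 t1 t2] := tnth3 c.1.1 c.1.2 c.2.
have step i : [|| (0 < tnth (prof_tuple c) (ordS i))%N, ~~ row_top N.+1 L (ordS i) |
    row_top N.+1 L i].
  case: posnP => //= ci0; rewrite -implybE !topE; apply/implyP.
  by have := Lcyl i 0%N; rewrite ci0 => h1 h2; apply: leq_trans h2 h1.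
have := step ord0; have := step (inord 1); have := step (inord 2).
rewrite o0 o1 o2 t0 t1 t2; move: c_gt0; rewrite !addn_gt0.
by case: (0 < c.1.1)%N (0 < c.1.2)%N (0 < c.2)%N (row_top _ _ _) (row_top _ _ _)
  (row_top _ _ _) => [] [] [] [] [] [].
Qed.

(** Inclusion and exclusion over the rows that can and do start with the maximal
    part [N.+1]. *)
Lemma cyl_bounded_rec c N : (0 < c.1.1 + c.1.2 + c.2)%N -> corner_rec cyl_bounded c N.
Proof.
move=> c_gt0; rewrite /corner_rec /corners big_map big_filter.
apply/fpsP => n; rewrite fpsDE fps_sumE.
pose S := [set L | (is_cylindric (prof_tuple c) L /\ (cyl_max L <= N.+1)%N) /\
                   cyl_weight L = n%:Z].
have finS : finite_set S.
  by apply: sub_finite_set (finite_cyl (prof_tuple c) n%:Z) => L [[Lc _] Lw].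
pose r := finmap.enum_fset (fset_set S).
have cS (P : pred (3.-tuple (seq nat))) (A : set (3.-tuple (seq nat))) :
    (forall L, A L <-> S L /\ P L) -> count_set A = \sum_(L <- r) (P L)%:R.
  by move=> AE; rewrite -count_cond //; congr count_set; apply/seteqP; split=> L /AE.
rewrite [LHS](cS (fun L => cyl_max L <= N)%N) => [|L]; last first.
  by split=> [[[Lc LN] Lw]|[[[Lc _] Lw] LN]] //; do ?split=> //; apply: leqW.
rewrite [X in X + _](cS predT) => [|L]; last by split=> [|[]].
pose top (L : 3.-tuple (seq nat)) (j : bool * bool * bool) := [&& j.1.1 ==> row_top N.+1 L ord0,
  j.1.2 ==> row_top N.+1 L (inord 1) & j.2 ==> row_top N.+1 L (inord 2)].
have termE j : corner c j -> ((- 'q ^+ N.+1) ^+ corner_size j *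
    cyl_bounded (add_corner c j) N.+1)``_n =
    \sum_(L <- r) (-1) ^+ corner_size j * (top L j)%:R.
  move=> cj; rewrite -mulr_sumr (exprNn ('q ^+ N.+1)) -exprM -mulrA -(cyl_bounded_tops N cj).
  have sgn f e : ((-1) ^+ e * f : fps int)``_n = (-1) ^+ e * f``_n.
    by elim: e => [|e IHe]; rewrite ?expr0 ?mul1r // !exprS !mulN1r !mulNr fpsNE IHe.
  rewrite sgn; congr (_ * _); apply: cS => L.
  have [p0 p1 p2] := tnth3 j.1.1 j.1.2 j.2.
  split=> [[[Lc Ltop] Lw]|[[Lc Lw] /and3P[l0 l1 l2]]].
    split=> //; apply/and3P; split; apply/implyP => ji; apply: Ltop;
    by rewrite /corner_pred ?p0 ?p1 ?p2.
  split=> //; split=> //; apply: forall_ord3; rewrite /corner_pred ?p0 ?p1 ?p2;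
  exact/implyP.
rewrite (eq_bigr _ termE) exchange_big -big_split big_seq [RHS]big_seq /=.
apply: eq_bigr => L; rewrite in_fset_set // inE => -[[Lc LN] _].
rewrite (cyl_max_corner c_gt0) // /corner_sets !big_cons big_nil /top /corner /=.
have le_b (b : bool) m : (b <= m)%N = (b ==> (0 < m)%N) by case: b.
rewrite ?le_b /=.
by case: (0 < c.1.1)%N (0 < c.1.2)%N (0 < c.2)%N (row_top _ _ _) (row_top _ _ _)
  (row_top _ _ _) => [] [] [] [] [] [].
Qed.

Lemma cyl_bounded0 c : (0 < c.1.1 + c.1.2 + c.2)%N -> cyl_bounded c 0 = 1.
Proof.
move=> _; pose L0 : 3.-tuple (seq nat) := [tuple [::]; [::]; [::]].
have L0E i : tnth L0 i = [::] by case: i => [[|[|[|//]]] lt_i].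
have L0P L : is_cylindric (prof_tuple c) L /\ (cyl_max L <= 0)%N <-> L = L0.
  split=> [[[Lp _] /cyl_max_leP L0max]|->].
    apply: eq_from_tnth => i; rewrite L0E; case E : (tnth L i) => [|x s] //.
    have := Lp i; have := L0max i x; rewrite E mem_head => /(_ isT).
    by rewrite leqn0 => /eqP->; rewrite /is_partition inE andbF.
  split; last by apply/cyl_max_leP => i; rewrite L0E.
  by split=> i *; rewrite !L0E ?nth_nil.
have w0 : cyl_weight L0 = 0.
  by rewrite /cyl_weight /cyl_size big1 // => i _; rewrite L0E.
apply/fpsP => n; rewrite fps1E /count_set /gseries /=.
case: n => [|n].
  rewrite (_ : [set i | _] = [set L0]); first by rewrite /count_set fsbig_set1.
  by apply/seteqP; split=> [L [/L0P]|L ->] //; split=> //; apply/L0P.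
rewrite (_ : [set i | _] = set0); first by rewrite /count_set fsbig_set0.
by apply/seteqP; split=> // L [/L0P->]; rewrite w0.
Qed.

Lemma level5_series0 c : level5 c -> level5_series c 0 = 1.
Proof.
case: c => [[i j] k]; rewrite /level5 -[_.1.1]/i -[_.1.2]/j -[_.2]/k => /eqP l5.
have {l5} [ij ->] : (i + j <= 5)%N /\ k = (5 - i - j)%N by lia.
case: i ij => [|[|[|[|[|[|i]]]]]] ij; try by [].
all: case: j ij => [|[|[|[|[|[|j]]]]]] // _.
all: match goal with |- context [level5_series ?c] =>
  let d := eval vm_compute in c in change c with d end.
all: rewrite /level5_series /s500 /s401 /s302 /s320 /s410 /s311 /s221 /prev.
all: by rewrite ?expr0 ?mul1r ?addr0 tser0.
Qed.

(** Both sides satisfy the recursion in the largest part, and for the bound 0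
    both are 1. *)
Lemma cyl_boundedE c N : level5 c -> cyl_bounded c N = over_zpoch (level5_series c) N.
Proof.
have gt0 d : level5 d -> (0 < d.1.1 + d.1.2 + d.2)%N by move/eqP->.
move: c N; apply: (corner_rec_uniq (Y := fun c => over_zpoch (level5_series c))).
- move=> [[c0 c1] c2] [[j0 j1] j2]; rewrite /level5 /corner /=.
  by move=> /eqP c5 /and3P[? ? ?]; apply/eqP; lia.
- move=> c l5; rewrite cyl_bounded0 ?gt0 //.
  rewrite /over_zpoch big_ord1 subn0 qfact0 divr1.
  by rewrite level5_series0.
- by move=> c N /gt0; apply: cyl_bounded_rec.
- exact: level5_corner_rec.
Qed.

(** * From bounded parts to the series at $z=1$ *)

Definition cyl_series k (c : k.-tuple nat) : fps int :=
  gseries [set L | is_cylindric c L] (@cyl_weight k).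

Definition eval1 (f : fps {poly int}) : fps int := Fps (fun n => (f``_n).[1]).

Lemma eval1M f g : eval1 (f * g) = eval1 f * eval1 g.
Proof.
apply/fpsP => n; rewrite /= horner_sum; apply: eq_bigr => i _.
by rewrite hornerM.
Qed.

Lemma eval1B f g : eval1 (f - g) = eval1 f - eval1 g.
Proof. by apply/fpsP => n; rewrite /= hornerD hornerN. Qed.

Lemma eval1_1 : eval1 1 = 1.
Proof. by apply/fpsP => n; rewrite fps1E; case: n => [|n] /=; rewrite hornerE. Qed.

Lemma eval1_q : eval1 'q = 'q.
Proof. by apply/fpsP => n /=; case: (n == 1)%N; rewrite hornerE. Qed.

Lemma eval1X f n : eval1 (f ^+ n) = eval1 f ^+ n.
Proof. by elim: n => [|n IHn]; rewrite ?expr0 ?eval1_1 // !exprS eval1M IHn. Qed.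

Lemma eval1_const : eval1 (fps_const 'X) = 1.
Proof.
by apply/fpsP => n; rewrite fps1E /=; case: n => [|n] /=; rewrite hornerE.
Qed.

Lemma eval1_qpoch n : eval1 (qpoch (fps_const 'X * 'q) 'q n) = qfact n.
Proof.
elim: n => [|n IHn]; first by rewrite /qpoch !big_geq ?eval1_1.
rewrite !qpochS eval1M IHn eval1B eval1_1 !eval1M eval1X eval1_const eval1_q.
by rewrite mul1r.
Qed.

Lemma fps_const_expM (R : comNzRingType) (a : R) m f n :
  (fps_const a ^+ m * f)``_n = a ^+ m * f``_n.
Proof.
by elim: m => [|m IHm]; rewrite ?expr0 ?mul1r // !exprS -!mulrA fps_constM IHm.
Qed.

(** At $z=1$ all cylindric partitions of a given size have the same weight and
    $(zq;q)_\infty$ becomes $(q;q)_\infty$. *)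
Lemma cyl_G1E k (c : k.-tuple nat) : cyl_G1 c = qpoch_inf 'q 'q * cyl_series c.
Proof.
rewrite [cyl_G1 c](_ : _ = eval1 (cyl_G c)) // eval1M; congr (_ * _).
  by apply/fpsP => n; rewrite /= -eval1_qpoch.
apply/fpsP => n; pose F (L : k.-tuple (seq nat)) : {poly int} :=
  (fps_const 'X ^+ cyl_max L * 'q ^+ cyl_size L)``_n.
rewrite [LHS](_ : _ = (\sum_(L \in [set L | is_cylindric c L]) F L).[1]) //.
have FE L : F L = 'X ^+ cyl_max L * (n == cyl_size L)%:R.
  by rewrite /F fps_const_expM fps_qXE.
pose S := [set L | is_cylindric c L /\ cyl_weight L = n%:Z].
have finS : finite_set S by apply: finite_cyl.
rewrite -(@fsbig_widen _ _ _ _ S); first last.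
- move=> L [Lc notS] /=; rewrite FE; case: eqP => [nL|_]; last by rewrite mulr0.
  by case: notS; split=> //; rewrite /cyl_weight nL.
- by move=> L [].
rewrite [RHS](_ : _ = \sum_(L \in S) (1 : int)) // !fsbig_finite // horner_sum.
rewrite big_seq [RHS]big_seq; apply: eq_bigr => L.
rewrite in_fset_set // inE => -[_ [wL]]; rewrite FE wL eqxx mulr1.
by rewrite hornerXn expr1n.
Qed.

Lemma qfact_inf_upto n m : (n < m)%N -> eq_upto n (qpoch_inf 'q 'q) (qfact m).
Proof. by move=> lt_nm; apply: qpoch_inf_upto. Qed.

Lemma partition_max_size k (c : k.-tuple nat) L : is_cylindric c L ->
  (cyl_max L <= cyl_size L)%N.
Proof.
move=> [Lp _]; apply/cyl_max_leP => i m /mem_leq_sumn/leq_trans-> //.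
by rewrite /cyl_size (bigD1 i) //= leq_addr.
Qed.

Lemma cyl_series_upto c n N : (n <= N)%N ->
  eq_upto n (cyl_series (prof_tuple c)) (cyl_bounded c N).
Proof.
move=> le_nN i le_in; congr (count_set _); apply/seteqP; split=> L.
  move=> [Lc wL]; split=> //; split=> //; apply: leq_trans (partition_max_size Lc) _.
  by move: wL => [->]; apply: leq_trans le_in le_nN.
by move=> [[Lc _] wL].
Qed.

Definition low_order (s : nat -> fps int) := forall k i, (i < k)%N -> (s k)``_i = 0.

(** Meaningful when [s k] has order at least [k]. *)
Definition series_sum (s : nat -> fps int) : fps int :=
  Fps (fun n => (\sum_(k < n.+1) s k)``_n).

Lemma series_sum_upto s n N : low_order s -> (n < N)%N ->
  eq_upto n (series_sum s) (\sum_(k < N) s k).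
Proof.
move=> low lt_nN i le_in;
rewrite (_ : (series_sum s)``_i = (\sum_(k < i.+1) s k)``_i) // !fps_sumE.
rewrite -!(big_mkord xpredT (fun k => (s k)``_i)).
rewrite [RHS](big_cat_nat _ (n := i.+1)) //=; last by lia.
rewrite [X in _ + X]big_nat_cond [X in _ + X]big1 ?addr0 // => k.
by case/andP=> /andP[lt_ik _] _; apply: low.
Qed.

(** Since $(q;q)_\infty/(q;q)_{N-k}\to1$, multiplying by $(q;q)_\infty$ and
    letting $N$ tend to infinity amounts to putting $z=1$ in $\sum_k s_kz^k$. *)
Lemma over_zpoch_limit s n N : low_order s -> (n.*2 < N)%N ->
  eq_upto n (qpoch_inf 'q 'q * over_zpoch s N) (series_sum s).
Proof.
move=> low lt_nN; apply: eq_upto_sym.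
apply: eq_upto_trans (series_sum_upto low (_ : n < N.+1)%N) _; first by lia.
rewrite /over_zpoch mulr_sumr; apply: eq_upto_sum => k _.
have [lt_nk|le_kn] := ltnP n k.
  move=> i le_in; rewrite low ?(leq_ltn_trans le_in) // mulrCA.
  rewrite (@fps_mul_low _ _ _ k 0) ?addn0 ?(leq_ltn_trans le_in) // => a.
  exact: low.
have U := qfact_unit (N - k).
apply: (@eq_upto_trans _ _ (s k * (qfact (N - k) / qfact (N - k)))).
  by rewrite divrr // mulr1.
rewrite [X in eq_upto _ _ X]mulrCA; apply: eq_uptoM => //.
apply: eq_uptoM => //; apply: eq_upto_sym; apply: qfact_inf_upto; lia.
Qed.

(** * The quadruple sums *)

Lemma tserB b c d n : tser b.+1 c.+1 d.+1 n =
  \sum_(n2 < n.+1) \sum_(n3 < n.+1) \sum_(n4 < n.+1)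
     'q ^+ (Qexp n n2 n3 n4 + b * n2 + c * n3 + d * n4) * Bterm n n2 n3 n4.
Proof.
rewrite /tser /tsum mulr_suml; apply: eq_bigr => n2 _.
have le2 : (n2 <= n)%N by rewrite -ltnS.
move: (erefl (rsum n (n2 + d.+1))); move: {1 3}(rsum n _) => Y YE.
rewrite (@rsum_ext n2 n) // mulr_sumr !mulr_suml; apply: eq_bigr => n3 _.
rewrite YE /rsum mulr_sumr mulr_suml; apply: eq_bigr => n4 _.
have -> : (Qexp n n2 n3 n4 + b * n2 + c * n3 + d * n4 = n * (n - n2) + n2 * n2.-1 +
    b.+1 * n2 + (n3 * n3.-1 + c.+1 * n3) + (n4 * n4.-1 + (n2 + d.+1) * n4))%N.
  have sq k : (k * k.-1 + k = k ^ 2)%N by case: k => [|k] //=; nia.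
  have le_sq : (n * n2 <= n ^ 2)%N by rewrite expnS expn1 leq_mul2l le2 orbT.
  rewrite /Qexp !mulSn mulnDl mulSn mulnBr -(sq n2) -(sq n3) -(sq n4).
  by move: le_sq; rewrite expnS expn1; lia.
by rewrite /Bterm /tcoef !exprD; ring.
Qed.

Lemma Bterm_small n1 n2 n3 n4 :
  ~~ [&& n2 <= n1, n3 <= n1 & n4 <= n1]%N -> Bterm n1 n2 n3 n4 = 0.
Proof.
rewrite /Bterm; have [lt_12|le_21] := ltnP n1 n2.
  by rewrite qbinom_small // !(mulr0, mul0r).
have [lt_13|le_31] := ltnP n1 n3.
  by rewrite (@qbinom_small n2 n3) ?mulr0 //; lia.
have [lt_14|//] := ltnP n1 n4.
by rewrite (@qbinom_small n1 n4) ?mulr0 ?mul0r.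
Qed.

Lemma sum_iota_ord (R : nmodType) n N (G : nat -> R) : (n <= N)%N ->
  (forall k, (n < k)%N -> G k = 0) -> \sum_(k <- iota 0 N.+1) G k = \sum_(k < n.+1) G k.
Proof.
move=> le_nN G0; rewrite -(big_mkord xpredT G) -[iota 0 N.+1]/(index_iota 0 N.+1).
rewrite (big_cat_nat _ (n := n.+1)) //= [X in _ + X]big_nat_cond.
by rewrite [X in _ + X]big1 ?addr0 // => k /andP[/andP[lt_nk _] _]; apply: G0.
Qed.

(** The summand vanishes unless $n_2,n_3,n_4\le n_1$ and its order is then at
    least $n_1$, so the unordered sum is an iterated one, $n_1$ outermost. *)
Lemma qsum4_series (F X : nat -> nat -> nat -> nat -> fps int) :
  (forall n1 n2 n3 n4, F n1 n2 n3 n4 =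
     'q ^+ Qexp n1 n2 n3 n4 * (X n1 n2 n3 n4 * Bterm n1 n2 n3 n4)) ->
  qsum4 F = series_sum (fun n1 => \sum_(n2 < n1.+1) \sum_(n3 < n1.+1)
    \sum_(n4 < n1.+1) F n1 n2 n3 n4).
Proof.
move=> FE; have F0 n1 n2 n3 n4 : ~~ [&& n2 <= n1, n3 <= n1 & n4 <= n1]%N ->
    F n1 n2 n3 n4 = 0 by move=> out; rewrite FE Bterm_small // !mulr0.
have Flow n1 n2 n3 n4 i : (i < n1)%N -> (F n1 n2 n3 n4)``_i = 0.
  move=> lt_i1; have [/and3P[le_21 _ _]|/F0->//] :=
    boolP [&& n2 <= n1, n3 <= n1 & n4 <= n1]%N.
  rewrite FE fps_qXM leqNgt (leq_trans lt_i1) // /Qexp; nia.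
apply/fpsP => n; pose I := iota 0 n.+1.
pose r := [seq (p, n4) | p <- [seq (p, n3) | p <- [seq (n1, n2) | n1 <- I, n2 <- I],
                                             n3 <- I], n4 <- I].
pose f (p : nat * nat * nat * nat) := let: (n1, n2, n3, n4) := p in (F n1 n2 n3 n4)``_n.
rewrite [LHS](_ : _ = \sum_(p \in [set: nat * nat * nat * nat]) f p); last first.
  by apply: eq_fsbigr => -[[[n1 n2] n3] n4].
have mem_I k : (k \in I) = (k <= n)%N by rewrite mem_iota add0n ltnS.
rewrite (fsbigE r) //; last first.
- move=> [[[n1 n2] n3] n4] _; apply: contraNeq => /eqP fN0.
  have le_1n : (n1 <= n)%N by rewrite leqNgt; apply/negP => lt_n1; apply: fN0; apply: Flow.
  have [/and3P[l2 l3 l4]|/F0 F00] := boolP [&& n2 <= n1, n3 <= n1 & n4 <= n1]%N;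
    last by case: fN0; rewrite /f F00.
  have memI k : (k <= n1)%N -> k \in I by move=> ?; rewrite mem_I; lia.
  apply/allpairsP; exists ((n1, n2, n3), n4); split=> //; last exact: memI.
  apply/allpairsP; exists ((n1, n2), n3); split=> //; last exact: memI.
  by apply/allpairsP; exists (n1, n2); split=> //; apply: memI.
- have U : uniq I by apply: iota_uniq.
  by do 3![apply: allpairs_uniq => //; last by move=> [? ?] [? ?]].
rewrite (eq_bigl xpredT) => [|p]; last by rewrite in_setT.
rewrite /r !big_allpairs /I.
rewrite [RHS]fps_sumE -[RHS](big_mkord xpredT (fun n1 => (\sum_(n2 < n1.+1)
  \sum_(n3 < n1.+1) \sum_(n4 < n1.+1) F n1 n2 n3 n4)``_n)).
rewrite [RHS]big_seq /index_iota subn0 big_seq; apply: eq_bigr => n1.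
rewrite -/I mem_I => le_1n; rewrite fps_sumE -(@sum_iota_ord _ n1 n (fun n2 =>
  (\sum_(n3 < n1.+1) \sum_(n4 < n1.+1) F n1 n2 n3 n4)``_n)) // => [|k lt_k]; last first.
  rewrite fps_sumE big1 // => a _; rewrite fps_sumE big1 // => b _.
  by rewrite F0 // leqNgt lt_k.
apply: eq_bigr => n2 _; rewrite fps_sumE -(@sum_iota_ord _ n1 n (fun n3 =>
  (\sum_(n4 < n1.+1) F n1 n2 n3 n4)``_n)) // => [|k lt_k]; last first.
  rewrite fps_sumE big1 // => b _.
  by rewrite F0 // (leqNgt k) lt_k andbF.
apply: eq_bigr => n3 _; rewrite fps_sumE -(@sum_iota_ord _ n1 n (fun n4 =>
  (F n1 n2 n3 n4)``_n)) // => k lt_k.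
by rewrite F0 // (leqNgt k) lt_k !andbF.
Qed.

Lemma low_tser b c d : low_order (tser b.+1 c.+1 d.+1).
Proof.
move=> n i lt_in; rewrite tserB fps_sumE big1 // => n2 _.
rewrite fps_sumE big1 // => n3 _; rewrite fps_sumE big1 // => n4 _.
have le_2 : (n2 <= n)%N by rewrite -ltnS.
rewrite fps_qXM leqNgt (leq_trans lt_in) // /Qexp; nia.
Qed.

Lemma low_mul f s : low_order s -> low_order (fun n => f n * s n).
Proof.
by move=> ls n i lt_in; rewrite (@fps_mul_low _ _ _ 0 n) // => j; apply: ls.
Qed.

Lemma low_add s t : low_order s -> low_order t -> low_order (fun n => s n + t n).
Proof. by move=> ls lt n i lt_in; rewrite fpsDE ls ?lt ?addr0. Qed.

Lemma low_prev s : low_order s -> low_order (prev (fun m => 'q * s m)).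
Proof.
move=> ls [|n] i lt_in //; rewrite /prev.
have -> : 'q * s n = 'q ^+ 1 * s n by rewrite expr1.
by rewrite fps_qXM; case: i lt_in => // i lt_in; rewrite subn1 ls.
Qed.

(** Reindexing: at [z = 1] the delay by one unit disappears. *)
Lemma series_sum_prev s t : low_order t ->
  series_sum (fun n => s n + prev (fun m => 'q * t m) n) =
  series_sum (fun n => s n + 'q * t n).
Proof.
move=> lt; apply/fpsP => n.
rewrite [LHS](_ : _ = (\sum_(k < n.+1) (s k + prev (fun m => 'q * t m) k))``_n) //.
rewrite [RHS](_ : _ = (\sum_(k < n.+1) (s k + 'q * t k))``_n) //.
rewrite !big_split !fpsDE; congr (_ + _).
rewrite big_ord_recl big_ord_recr !fpsDE !fps_sumE.
rewrite [X in X + _ = _](_ : _ = 0) // add0r.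
rewrite [X in _ = _ + X](low_prev lt (ltnSn n) : ('q * t n)``_n = 0) addr0.
by apply: eq_bigr => i _.
Qed.

Lemma eq_series_sum s t : s =1 t -> series_sum s = series_sum t.
Proof.
move=> st; apply/fpsP => n; rewrite /series_sum /=; congr (fcoef _ n).
by apply: eq_bigr => i _; rewrite st.
Qed.

(** The series under [prev] in [s401], [s302] and [s320], up to a factor $q$. *)
Definition delayed401 n := 'q ^+ n ^+ 2 * tser 2 2 2 n.
Definition delayed302 n := 'q ^+ n ^+ 2 * tser 1 2 1 n + 'q * 'q ^+ n ^+ 3 * tser 2 2 2 n.
Definition delayed320 n := 'q ^+ n ^+ 2 * tser 1 1 1 n
  + 'q * 'q ^+ n ^+ 3 * tser 1 2 1 n + 'q ^+ 2 * 'q ^+ n ^+ 4 * tser 2 2 2 n.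

Lemma low_delayed : [/\ low_order delayed401, low_order delayed302 & low_order delayed320].
Proof. by split; do ?apply: low_add; apply: low_mul; apply: low_tser. Qed.

Lemma s401E n : s401 n = 'q ^+ n * tser 1 2 1 n + prev (fun m => 'q * delayed401 m) n.
Proof. by case: n => //= n; rewrite /s401 /delayed401 /=; ring. Qed.

Lemma s302E n : s302 n = 'q ^+ n * tser 1 1 1 n + prev (fun m => 'q * delayed302 m) n.
Proof. by case: n => //= n; rewrite /s302 /delayed302 /=; ring. Qed.

Lemma s320E n : s320 n = 'q ^+ n * tser 1 2 1 n + prev (fun m => 'q * delayed320 m) n.
Proof. by case: n => //= n; rewrite /s320 /delayed320 /=; ring. Qed.

Lemma cyl_G1_sum c : level5 c -> low_order (level5_series c) ->
  cyl_G1 (prof_tuple c) = series_sum (level5_series c).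
Proof.
move=> l5 low; rewrite cyl_G1E; apply: eq_upto_fps => n.
apply: eq_upto_trans (over_zpoch_limit low (ltnSn n.*2)).
rewrite -cyl_boundedE //; apply: eq_uptoM => //; apply: cyl_series_upto; lia.
Qed.

Local Ltac sum_terms :=
  rewrite !tserB; do ?rewrite mulr_sumr; rewrite -?big_split; apply: eq_bigr => n2 _;
  rewrite /=; do ?rewrite mulr_sumr; rewrite -?big_split; apply: eq_bigr => n3 _;
  rewrite /=; do ?rewrite mulr_sumr; rewrite -?big_split; apply: eq_bigr => n4 _ /=.

Local Ltac split_exponent :=
  rewrite ?mul0n ?mul1n ?addn0; move: (Bterm _ _ _ _) => B;
  rewrite ?(mulnC 2) ?(mulnC 3) !exprD ?exprM; ring.

Lemma cyl_G1_500 : cyl_G1 [tuple 5; 0; 0]%N = qsum4 (fun n1 n2 n3 n4 =>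
  'q ^+ (Qexp n1 n2 n3 n4 + n1 + n2 + n3 + n4) * Bterm n1 n2 n3 n4).
Proof.
rewrite (@cyl_G1_sum (5, 0, 0)%N) //; last by apply: low_mul; apply: low_tser.
rewrite (@qsum4_series _ (fun n1 n2 n3 n4 => 'q ^+ (n1 + n2 + n3 + n4))); last first.
  by move=> *; rewrite !exprD; ring.
by apply: eq_series_sum => n; rewrite /= /s500; sum_terms; split_exponent.
Qed.

Lemma cyl_G1_410 : cyl_G1 [tuple 4; 1; 0]%N = qsum4 (fun n1 n2 n3 n4 =>
  'q ^+ (Qexp n1 n2 n3 n4 + n2 + n3 + n4) * Bterm n1 n2 n3 n4).
Proof.
rewrite (@cyl_G1_sum (4, 1, 0)%N) //; last exact: low_tser.
rewrite (@qsum4_series _ (fun n1 n2 n3 n4 => 'q ^+ (n2 + n3 + n4))); last first.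
  by move=> *; rewrite !exprD; ring.
by apply: eq_series_sum => n; rewrite /= /s410; sum_terms; split_exponent.
Qed.

Lemma cyl_G1_401 : cyl_G1 [tuple 4; 0; 1]%N = qsum4 (fun n1 n2 n3 n4 =>
  'q ^+ (Qexp n1 n2 n3 n4 + n1 + n3) *
  (1 + 'q ^+ (n1 + n2 + n4 + 1)) * Bterm n1 n2 n3 n4).
Proof.
have [low _ _] := low_delayed.
have sE : series_sum s401 = _ := eq_series_sum s401E.
rewrite (@cyl_G1_sum (4, 0, 1)%N) //; last first.
  rewrite [level5_series _]/s401 -/s401 (funext s401E).
  by apply: low_add; [apply: low_mul; apply: low_tser | apply: low_prev].
rewrite [series_sum _]sE series_sum_prev //.
rewrite (@qsum4_series _ (fun n1 n2 n3 n4 => 'q ^+ (n1 + n3) *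
  (1 + 'q ^+ (n1 + n2 + n4 + 1)))); last first.
  by move=> *; rewrite !exprD; ring.
by apply: eq_series_sum => n; rewrite /= /delayed401; sum_terms; split_exponent.
Qed.

Lemma cyl_G1_302 : cyl_G1 [tuple 3; 0; 2]%N = qsum4 (fun n1 n2 n3 n4 =>
  'q ^+ (Qexp n1 n2 n3 n4 + n1) *
  (1 + 'q ^+ (n1 + n3 + 1)
     + 'q ^+ (2 * n1 + n2 + n3 + n4 + 2)) * Bterm n1 n2 n3 n4).
Proof.
have [_ low _] := low_delayed.
have sE : series_sum s302 = _ := eq_series_sum s302E.
rewrite (@cyl_G1_sum (3, 0, 2)%N) //; last first.
  rewrite [level5_series _]/s302 -/s302 (funext s302E).
  by apply: low_add; [apply: low_mul; apply: low_tser | apply: low_prev].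
rewrite [series_sum _]sE series_sum_prev //.
rewrite (@qsum4_series _ (fun n1 n2 n3 n4 => 'q ^+ n1 * (1 + 'q ^+ (n1 + n3 + 1)
     + 'q ^+ (2 * n1 + n2 + n3 + n4 + 2)))); last first.
  by move=> *; rewrite (exprD _ _ _); ring.
apply: eq_series_sum => n; rewrite /= /delayed302 mulrDr.
by sum_terms; split_exponent.
Qed.

Lemma cyl_G1_320 : cyl_G1 [tuple 3; 2; 0]%N = qsum4 (fun n1 n2 n3 n4 =>
  'q ^+ (Qexp n1 n2 n3 n4 + n1) *
  ('q ^+ n3 + 'q ^+ (n1 + 1) + 'q ^+ (2 * n1 + n3 + 2)
     + 'q ^+ (3 * n1 + n2 + n3 + n4 + 3)) * Bterm n1 n2 n3 n4).
Proof.
have [_ _ low] := low_delayed.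
have sE : series_sum s320 = _ := eq_series_sum s320E.
rewrite (@cyl_G1_sum (3, 2, 0)%N) //; last first.
  rewrite [level5_series _]/s320 -/s320 (funext s320E).
  by apply: low_add; [apply: low_mul; apply: low_tser | apply: low_prev].
rewrite [series_sum _]sE series_sum_prev //.
rewrite (@qsum4_series _ (fun n1 n2 n3 n4 => 'q ^+ n1 * ('q ^+ n3 + 'q ^+ (n1 + 1)
  + 'q ^+ (2 * n1 + n3 + 2) + 'q ^+ (3 * n1 + n2 + n3 + n4 + 3)))); last first.
  by move=> *; rewrite (exprD _ _ _); ring.
apply: eq_series_sum => n; rewrite /= /delayed320 !mulrDr.
by sum_terms; split_exponent.
Qed.

Lemma cyl_G1_311 : cyl_G1 [tuple 3; 1; 1]%N = qsum4 (fun n1 n2 n3 n4 =>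
  'q ^+ (Qexp n1 n2 n3 n4 + n3) * Bterm n1 n2 n3 n4).
Proof.
rewrite (@cyl_G1_sum (3, 1, 1)%N) //; last exact: low_tser.
rewrite (@qsum4_series _ (fun n1 n2 n3 n4 => 'q ^+ n3)); last first.
  by move=> *; rewrite !exprD; ring.
by apply: eq_series_sum => n; rewrite /= /s311; sum_terms; split_exponent.
Qed.

Lemma cyl_G1_221 : cyl_G1 [tuple 2; 2; 1]%N = qsum4 (fun n1 n2 n3 n4 =>
  'q ^+ Qexp n1 n2 n3 n4 * Bterm n1 n2 n3 n4).
Proof.
rewrite (@cyl_G1_sum (2, 2, 1)%N) //; last exact: low_tser.
rewrite (@qsum4_series _ (fun n1 n2 n3 n4 => 1)); last by move=> *; ring.
by apply: eq_series_sum => n; rewrite /= /s221; sum_terms; split_exponent.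
Qed.

(** * Partitions as functions, and cyclic chains of interlacing partitions *)

Notation pfun := (nat -> nat).

Definition fsupp (f : pfun) := exists N, forall r, (N <= r)%N -> f r = 0%N.

Definition psize (f : pfun) : nat := \sum_(r \in [set: nat]) f r.

Lemma psizeE f N : (forall r, (N <= r)%N -> f r = 0%N) ->
  psize f = (\sum_(r < N) f r)%N.
Proof.
move=> f0; rewrite /psize fsbig_ord; apply/esym/fsbig_widen => // r [_ /= /negP].
by rewrite -leqNgt => /f0.
Qed.

Lemma fsupp_bound f g : fsupp f -> fsupp g ->
  exists N, forall r, (N <= r)%N -> f r = 0%N /\ g r = 0%N.
Proof.
move=> [N fN] [M gM]; exists (maxn N M) => r; rewrite geq_max => /andP[Nr Mr].
by rewrite fN ?gM.
Qed.

Lemma psize_le f g : fsupp g -> (forall r, f r <= g r)%N -> (psize f <= psize g)%N.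
Proof.
move=> [N gN] le_fg; rewrite (psizeE gN) (psizeE (N := N)); last first.
  by move=> r /gN g0; have := le_fg r; rewrite g0 leqn0 => /eqP.
exact: leq_sum.
Qed.

Lemma psize_le_eq f g : fsupp g -> (forall r, f r <= g r)%N -> psize f = psize g ->
  f = g.
Proof.
move=> [N gN] le_fg; have fN r : (N <= r)%N -> f r = 0%N.
  by move=> /gN g0; have := le_fg r; rewrite g0 leqn0 => /eqP.
rewrite (psizeE gN) (psizeE fN) => E; apply/funext => r.
have [/[dup]/fN-> /gN->//|lt_rN] := leqP N r.
apply/eqP; rewrite eqn_leq le_fg /=; apply: contra_eqT E; rewrite -ltnNge => lt_fg.
rewrite (bigD1 (Ordinal lt_rN)) //= [X in _ != X](bigD1 (Ordinal lt_rN)) //=.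
rewrite neq_ltn -addSn leq_add //; by apply: leq_sum.
Qed.

(** That is, $g/f$ is a horizontal strip. *)
Definition interl (f g : pfun) := forall r, (f r <= g r)%N /\ (g r.+1 <= f r)%N.

Definition step (b : bool) f g := if b then interl f g else interl g f.

(** A letter [(true, a)] stands for an addition of a horizontal strip and
    [(false, a)] for a removal; in both cases [a] times the change of size is
    contributed to the weight. *)
Definition letter := (bool * int)%type.

Fixpoint chain (w : seq letter) (f : pfun) (L : seq pfun) : Prop :=
  match w, L with
  | [::], [::] => True
  | l :: w', g :: L' => [/\ fsupp g, step l.1 f g & chain w' g L']
  | _, _ => False
  end.

Fixpoint chain_weight (w : seq letter) (f : pfun) (L : seq pfun) : int :=
  match w, L with
  | l :: w', g :: L' => l.2 * ((psize g)%:Z - (psize f)%:Z) + chain_weight w' g L'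
  | _, _ => 0
  end.

Definition pfun0 : pfun := fun=> 0%N.

(** Closed chains are represented by all their members but the first one,
    which is also the last one. *)
Definition closed_chain (w : seq letter) : set (seq pfun) :=
  [set L | chain w (last pfun0 L) L].

Definition closed_weight (t : int) w (L : seq pfun) : int :=
  t * (psize (last pfun0 L))%:Z + chain_weight w (last pfun0 L) L.

Definition chain_series t w := gseries (closed_chain w) (closed_weight t w).
Definition chain_tame t w := tame (closed_chain w) (closed_weight t w).

Lemma chain_size w f L : chain w f L -> size L = size w.
Proof. by elim: w f L => [|l w IHw] f [|g L] //= [_ _ /IHw->]. Qed.

Lemma chain_cat w1 w2 f L1 L2 : size L1 = size w1 ->
  chain (w1 ++ w2) f (L1 ++ L2) <-> chain w1 f L1 /\ chain w2 (last f L1) L2.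
Proof.
elim: w1 f L1 => [|l w1 IHw] f [|g L1] //=; first by split=> [|[]].
move=> [/IHw{}IHw]; split=> [[gs st /IHw[? ?]]|[[? ? ?] ?]]; first by split.
by split=> //; apply/IHw.
Qed.

Lemma chain_weight_cat w1 w2 f L1 L2 : size L1 = size w1 ->
  chain_weight (w1 ++ w2) f (L1 ++ L2) =
  chain_weight w1 f L1 + chain_weight w2 (last f L1) L2.
Proof.
elim: w1 f L1 => [|l w1 IHw] f [|g L1] //= ; first by rewrite add0r.
by move=> [/IHw->]; rewrite addrA.
Qed.

Definition shift_letter (t : int) (l : letter) : letter := (l.1, l.2 - t).

(** Cutting the cycle one step later changes the member counted with the
    coefficient $t$, which is compensated by lowering the exponent of the step
    that has been moved to the end. *)
Lemma closed_chain_rot1 t l w :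
  set_bij (closed_chain (l :: w)) (closed_chain (rcons w (shift_letter t l))) (rot 1).
Proof.
split.
- case=> [|g L] //= [gs st cL]; rewrite rot1_cons /closed_chain /= last_rcons.
  by rewrite -!cats1 chain_cat ?(chain_size cL).
- by move=> L L' _ _; apply: rot_inj.
- move=> L; rewrite /closed_chain /=; case: (lastP L) => [|L' g].
    by case: w.
  rewrite last_rcons => cL; have szL : size L' = size w.
    by have := chain_size cL; rewrite !size_rcons => -[].
  move: cL; rewrite -!cats1 chain_cat //= => -[cL' [gs st _]].
  by exists (g :: L'); rewrite /= ?rot1_cons ?cats1.
Qed.

Lemma closed_weight_rot1 t l w L : closed_chain (l :: w) L ->
  closed_weight t (l :: w) L = closed_weight t (rcons w (shift_letter t l)) (rot 1 L).
Proof.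
case: L => [|g L] //= [gs st cL]; rewrite rot1_cons /closed_weight /= last_rcons.
rewrite -!cats1 chain_weight_cat ?(chain_size cL) //= addr0 mulrBl.
by ring.
Qed.

(** Tameness is carried along: it is known at the beginning, for the cylindric
    partitions, and is needed whenever a factor is split off. *)
Definition reduces t (c : fps int) w w' :=
  chain_tame t w -> chain_tame t w' /\ c * chain_series t w = chain_series t w'.

Lemma reduces_trans t c1 c2 w1 w2 w3 :
  reduces t c1 w1 w2 -> reduces t c2 w2 w3 -> reduces t (c1 * c2) w1 w3.
Proof.
move=> red12 red23 /red12[/red23[t3 E2] E1]; split=> //.
by rewrite mulrAC (mulrC _ c2) E1.
Qed.

Lemma reduces_refl t w : reduces t 1 w w.
Proof. by split=> //; rewrite mul1r. Qed.

Lemma finite_bij (I J : choiceType) (A : set I) (B : set J) (f : I -> J) :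
  set_bij A B f -> finite_set A <-> finite_set B.
Proof.
move=> fbij; split; first exact: finite_set_bij fbij.
have [fAB finj _] := fbij; move=> finB.
rewrite -(eq_finite_set (inj_card_eq finj)).
by apply: sub_finite_set finB => _ [i Ai <-]; apply: fAB.
Qed.

Lemma reduces_bij t w w' f : set_bij (closed_chain w) (closed_chain w') f ->
  (forall L, closed_chain w L -> closed_weight t w L = closed_weight t w' (f L)) ->
  reduces t 1 w w' /\ reduces t 1 w' w.
Proof.
move=> fbij wE; have E := gseries_bij fbij wE.
split=> tw; (split; last by rewrite mul1r /chain_series E); first exact: tame_bij fbij wE tw.
case: tw => fin ge0; split=> [n|L cL]; last by rewrite wE ?ge0 //; case: fbij => + _ _; apply.
have wE' L : closed_chain w L -> closed_weight t w L = n <-> closed_weight t w' (f L) = n.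
  by move=> cL; rewrite wE.
exact: (finite_bij (set_bij_fiber fbij wE')).2 (fin n).
Qed.

Lemma reduces_rot1 t l w : reduces t 1 (l :: w) (rcons w (shift_letter t l)) /\
  reduces t 1 (rcons w (shift_letter t l)) (l :: w).
Proof. exact: reduces_bij (closed_chain_rot1 t l w) (@closed_weight_rot1 t l w). Qed.

Lemma reduces_rot t w1 w2 :
  reduces t 1 (w1 ++ w2) (w2 ++ map (shift_letter t) w1) /\
  reduces t 1 (w2 ++ map (shift_letter t) w1) (w1 ++ w2).
Proof.
elim: w1 w2 => [|l w1 IHw] w2 /=; first by rewrite cats0; split; apply: reduces_refl.
have [r1 r2] := reduces_rot1 t l (w1 ++ w2); have := IHw (rcons w2 (shift_letter t l)).
rewrite -rcons_cat cat_rcons => -[r3 r4].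
by split; rewrite -[1]mulr1; [apply: reduces_trans r1 r3 | apply: reduces_trans r4 r2].
Qed.

(** A free nonnegative integer that enters the weight with the coefficient [e]
    contributes the factor $1/(1-q^e)$. *)
Lemma gseries_nat (I : choiceType) (A : set I) (w : I -> int) (e : nat) :
  (0 < e)%N ->
  let B := [set p : I * nat | A p.1] in
  let w' := fun p : I * nat => w p.1 + (p.2 * e)%:Z in
  tame B w' -> tame A w /\ (1 - 'q ^+ e) * gseries B w' = gseries A w.
Proof.
move=> e_gt0 B w' [finB ge0B].
have ge0 i : A i -> 0 <= w i by move=> Ai; have := ge0B (i, 0%N) Ai; rewrite /w' mul0n addr0.
have zero_bij n : set_bij [set i | A i /\ w i = n]
    [set p | B p /\ w' p = n /\ p.2 = 0%N] (fun i => (i, 0%N)).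
  split=> [i [Ai wi]|i j _ _ [//]|[i m] [Ai [wi /= m0]]].
    by split=> //; split=> //; rewrite /w' mul0n addr0.
  by exists i; rewrite ?m0 //; split=> //; move: wi; rewrite /w' m0 mul0n addr0.
split.
  split=> // n; apply/(finite_bij (zero_bij n)).
  by apply: sub_finite_set (finB n) => p [Bp [wp _]].
apply/fpsP => n; rewrite mulrBl mul1r fpsDE fpsNE fps_qXM.
pose B0 := [set p | B p /\ w' p = n%:Z /\ p.2 = 0%N].
pose B1 := [set p | B p /\ w' p = n%:Z /\ p.2 != 0%N].
have -> : (gseries B w')``_n = count_set B0 + count_set B1.
  rewrite -count_setU; first congr count_set.
  - apply/seteqP; split=> [p [Bp wp]|p [[Bp [wp _]]|[Bp [wp _]]]] //.
    by case: (eqVneq p.2 0%N) => p2; [left | right].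
  - by apply: sub_finite_set (finB n) => p [Bp [wp _]].
  - by apply: sub_finite_set (finB n) => p [Bp [wp _]].
  - by move=> p [_ [_ p0]] [_ [_ /eqP]].
rewrite -(count_bij (zero_bij n%:Z)) -addrA [X in _ + X](_ : _ = 0) ?addr0 //.
apply/eqP; rewrite subr_eq0; apply/eqP; case: leqP => [le_en|lt_ne].
  symmetry; apply: (@count_bij _ _ _ _ (fun p : I * nat => (p.1, p.2.+1))); split.
  - move=> [i m] [Ai wi]; split=> //; split=> //.
    by move: wi; rewrite /w' /= mulSn; lia.
  - by move=> [i m] [j m'] _ _ [-> ->].
  - move=> [i [|m]] [Ai [wi //= _]]; exists (i, m) => //; split=> //.
    by move: wi; rewrite /w' /= mulSn; lia.
rewrite (_ : B1 = set0); first exact: fsbig_set0.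
apply/seteqP; split=> // -[i [|m]] [Ai [wi //= _]].
by have := ge0 i Ai; move: wi; rewrite /w' /= mulSn; lia.
Qed.

(** * Exchanging an addition and a removal of a horizontal strip *)

(** When [f] and [g] both precede [h], the interval left for $h_{r+1}$ by the
    interlacing conditions is $[\max(f_{r+1},g_{r+1}),\min(f_r,g_r)]$. Reflecting
    $h_{r+1}$ in it gives part $r$ of a partition that precedes both [f] and [g];
    only $h_0$, which is not bounded above, is lost. *)
Definition toggle (f g h : pfun) : pfun :=
  fun r => (minn (f r) (g r) + maxn (f r.+1) (g r.+1) - h r.+1)%N.

Definition untoggle (f g k : pfun) (m : nat) : pfun := fun r =>
  if r is r'.+1 then (minn (f r') (g r') + maxn (f r'.+1) (g r'.+1) - k r')%N
  else (m + maxn (f 0) (g 0))%N.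

Lemma toggle_interl f g h : interl f h -> interl g h ->
  interl (toggle f g h) f /\ interl (toggle f g h) g.
Proof.
move=> fh gh; have B r : (maxn (f r.+1) (g r.+1) <= h r.+1 <= minn (f r) (g r))%N.
  by have := fh r; have := gh r; have := fh r.+1; have := gh r.+1; lia.
by split=> r; rewrite /toggle; have := B r; lia.
Qed.

Lemma untoggle_interl f g k m : interl k f -> interl k g ->
  interl f (untoggle f g k m) /\ interl g (untoggle f g k m).
Proof.
move=> kf kg; have B r : (maxn (f r.+1) (g r.+1) <= k r <= minn (f r) (g r))%N.
  by have := kf r; have := kg r; lia.
by split=> -[|r]; rewrite /untoggle; [have := B 0%N | have := B r; have := B r.+1
  | have := B 0%N | have := B r; have := B r.+1]; lia.
Qed.

Lemma toggleK f g h : interl f h -> interl g h ->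
  untoggle f g (toggle f g h) (h 0 - maxn (f 0) (g 0))%N = h.
Proof.
move=> fh gh; apply/funext => -[|r] /=; rewrite /toggle.
  by have := fh 0%N; have := gh 0%N; lia.
by have := fh r; have := gh r; have := fh r.+1; have := gh r.+1; lia.
Qed.

Lemma untoggleK f g k m : interl k f -> interl k g ->
  toggle f g (untoggle f g k m) = k.
Proof.
by move=> kf kg; apply/funext => r /=; rewrite /toggle /=; have := kf r; have := kg r; lia.
Qed.

Lemma fsupp_toggle f g h : fsupp f -> fsupp g -> fsupp (toggle f g h).
Proof.
move=> ff fg; have [N fgN] := fsupp_bound ff fg; exists N => r le_Nr.
by rewrite /toggle; have := fgN r le_Nr; have := fgN r.+1 (leqW le_Nr); lia.
Qed.

Lemma fsupp_untoggle f g k m : fsupp f -> fsupp g -> fsupp (untoggle f g k m).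
Proof.
move=> ff fg; have [N fgN] := fsupp_bound ff fg; exists N.+1 => -[|r] //= le_Nr.
by have := fgN r le_Nr; have := fgN r.+1 (leqW le_Nr); lia.
Qed.

(** The parts of [h] and of its image add up, interval by interval, to the
    sums of the two ends. *)
Lemma psize_toggle f g h : fsupp f -> fsupp g -> fsupp h -> interl f h -> interl g h ->
  (psize h + psize (toggle f g h) =
   (h 0 - maxn (f 0) (g 0)) + psize f + psize g)%N.
Proof.
move=> ff fg [M hM] fh gh; have [N fgN] := fsupp_bound ff fg.
pose K := maxn N M; have fK r : (K <= r)%N -> f r = 0%N.
  by rewrite geq_max => /andP[/fgN[]].
have gK r : (K <= r)%N -> g r = 0%N by rewrite geq_max => /andP[/fgN[]].
have hK r : (K.+1 <= r)%N -> h r = 0%N.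
  by move/ltnW; rewrite geq_max => /andP[_ /hM].
have tK r : (K <= r)%N -> toggle f g h r = 0%N.
  by move=> Kr; rewrite /toggle fK // gK // (fK r.+1) ?(gK r.+1) // leqW.
have fK1 r : (K.+1 <= r)%N -> f r = 0%N by move/ltnW/fK.
have gK1 r : (K.+1 <= r)%N -> g r = 0%N by move/ltnW/gK.
rewrite (psizeE hK) (psizeE tK) (psizeE fK1) (psizeE gK1) big_ord_recl /=.
rewrite -!addnA -big_split /=.
pose s r := (f r + g r)%N; rewrite -big_split /=.
have -> : (\sum_(i < K) (h (lift ord0 i) + toggle f g h i) =
    \sum_(i < K) minn (f i) (g i) + \sum_(i < K) maxn (f i.+1) (g i.+1))%N.
  rewrite -big_split; apply: eq_bigr => i _; rewrite /toggle /= /bump leq0n add1n.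
  by have := fh i; have := gh i; have := fh i.+1; have := gh i.+1; lia.
have -> : (\sum_(i < K.+1) (f i + g i) = \sum_(i < K.+1) minn (f i) (g i) +
    \sum_(i < K.+1) maxn (f i) (g i))%N.
  by rewrite -big_split; apply: eq_bigr => i _ /=; lia.
rewrite big_ord_recr [X in _ = (_ + (_ + X))%N]big_ord_recl /=.
rewrite (fK K) // (gK K) // minnn addn0.
rewrite [X in _ = (_ + (_ + (_ + X)))%N](eq_bigr (fun i : 'I_K =>
  maxn (f i.+1) (g i.+1))) //.
move: (\sum_(i < K) minn _ _)%N (\sum_(i < K) maxn _ _)%N => a b.
by have := fh 0%N; have := gh 0%N; lia.
Qed.

Lemma chain_last_fsupp w f L : fsupp f -> chain w f L -> fsupp (last f L).
Proof. by elim: w f L => [|l w IHw] f [|g L] //= _ [gs _ /(IHw _ _ gs)]. Qed.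

Definition chain_toggle (L : seq pfun) : seq pfun * nat :=
  if L is h :: g :: L' then
    let f := last g L' in (toggle f g h :: g :: L', (h 0 - maxn (f 0) (g 0))%N)
  else (L, 0%N).

Lemma chain_toggle_bij a b w : set_bij (closed_chain ((true, a) :: (false, b) :: w))
  [set p : seq pfun * nat | closed_chain ((false, b) :: (true, a) :: w) p.1] chain_toggle.
Proof.
split.
- case=> [|h [|g L]] //=; rewrite /closed_chain /=.
  move=> [hs fh [gs gh cL]]; have fs := chain_last_fsupp gs cL.
  by have [tf tg] := toggle_interl fh gh; split=> //; apply: fsupp_toggle.
- move=> [|h [|g L]] [|h' [|g' L']]; rewrite !inE /closed_chain //=; try by case.
  move=> [_ fh [_ gh _]] [_ fh' [_ gh' _]] [E gE LE mE].
  rewrite -(toggleK fh gh) -(toggleK fh' gh') mE E.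
  by rewrite gE LE.
- move=> [[|k [|g L]] m] //=; rewrite /closed_chain /=; try by case.
  move=> [ks kf [gs kg cL]]; have fs := chain_last_fsupp gs cL.
  have [fu gu] := untoggle_interl m kf kg.
  exists (untoggle (last g L) g k m :: g :: L) => /=.
    by split=> //; apply: fsupp_untoggle.
  by rewrite untoggleK //= addnK.
Qed.

(** The member between the two steps is replaced by its reflection; the excess of
    its first part over the minimal value is a free nonnegative integer, counted
    with the exponent $a-b$. *)
Lemma reduces_toggle t a b w1 w2 : 0 < a - b ->
  reduces t (1 - 'q ^+ `|a - b|%N) (w1 ++ (true, a) :: (false, b) :: w2)
    (w1 ++ (false, b) :: (true, a) :: w2).
Proof.
move=> ab_gt0; have e_gt0 : (0 < `|a - b|)%N by lia.
have eE : (`|a - b|%N)%:Z = a - b by rewrite gez0_abs // ltW.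
have front w : reduces t (1 - 'q ^+ `|a - b|%N) ((true, a) :: (false, b) :: w)
    ((false, b) :: (true, a) :: w).
  pose W p := closed_weight t ((false, b) :: (true, a) :: w) p.1 + (p.2 * `|a - b|)%N%:Z.
  have bij := chain_toggle_bij a b w.
  have wE L : closed_chain ((true, a) :: (false, b) :: w) L ->
      closed_weight t ((true, a) :: (false, b) :: w) L = W (chain_toggle L).
    case: L => [|h [|g L]]; rewrite /closed_chain //=; try by case.
    move=> [hs fh [gs gh cL]]; have fs := chain_last_fsupp gs cL.
    rewrite /W /closed_weight /= PoszM eE.
    have := psize_toggle fs gs hs fh gh.
    set x := psize h; set y := psize (toggle _ _ _); set m := (h 0 - _)%N.
    set u := psize _; set v := psize g => /(congr1 Posz); rewrite !PoszD => xy.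
    have -> : x%:Z = m%:Z + u%:Z + v%:Z - y%:Z by rewrite -xy addrK.
    by ring.
  move=> tw; have [tA E] := gseries_nat e_gt0 (tame_bij bij wE tw).
  by split=> //; rewrite [RHS]/chain_series -E -(gseries_bij bij wE).
have [rot1 _] := reduces_rot t w1 ((true, a) :: (false, b) :: w2).
have [_ rot2] := reduces_rot t w1 ((false, b) :: (true, a) :: w2).
rewrite -[1 - _]mul1r -[1 * _]mulr1; apply: reduces_trans rot2.
exact: reduces_trans rot1 (front _).
Qed.

(** * Sorting a cyclic word *)

Definition removals (w : seq letter) := [seq l <- w | ~~ l.1].
Definition additions (w : seq letter) := [seq l <- w | l.1].

Definition exchange_factor (a d : letter) : fps int := 1 - 'q ^+ `|a.2 - d.2|%N.

Lemma reduces_past t (a : letter) ds w1 w2 : a.1 ->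
  all (fun d : letter => ~~ d.1 && (0 < a.2 - d.2)) ds ->
  reduces t (\prod_(d <- ds) exchange_factor a d) (w1 ++ a :: ds ++ w2)
    (w1 ++ ds ++ a :: w2).
Proof.
case: a => [[] a] // _; elim: ds w1 => [|[[] d] ds IHds] w1 //=.
  by rewrite big_nil => _; apply: reduces_refl.
case/andP=> ad_gt0 /(IHds (rcons w1 (false, d))); rewrite !cat_rcons big_cons.
by apply: reduces_trans; apply: reduces_toggle.
Qed.

(** The pairs of an addition and a later removal are those that have to be
    exchanged when all the removals are brought to the front. *)
Fixpoint inversion_factor (w : seq letter) : fps int :=
  if w is l :: w' then
    inversion_factor w' * (if l.1 then \prod_(d <- removals w') exchange_factor l d else 1)
  else 1.

Fixpoint inversions_pos (w : seq letter) : bool :=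
  if w is l :: w' then
    inversions_pos w' && (l.1 ==> all (fun d : letter => 0 < l.2 - d.2) (removals w'))
  else true.

(** Bubble sort: each addition passes the removals behind it. *)
Lemma reduces_sort t w w1 : inversions_pos w ->
  reduces t (inversion_factor w) (w1 ++ w) (w1 ++ removals w ++ additions w).
Proof.
elim: w w1 => [|l w IHw] w1 /=; first by move=> _; apply: reduces_refl.
case/andP=> pos_w; have := IHw (rcons w1 l) pos_w; rewrite !cat_rcons => sorted_w.
case: (boolP l.1) => [la /= l_pos|ld _] /=; last first.
  by rewrite mulr1.
apply: reduces_trans sorted_w _; apply: reduces_past => //.
apply/allP => d dw; rewrite (allP l_pos) // andbT.
by move: dw; rewrite mem_filter => /andP[].
Qed.

Lemma all_additions w : all (fun l : letter => l.1) w ->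
  removals w = [::] /\ additions w = w.
Proof. by elim: w => //= -[[] a] w IHw //= /IHw[-> ->]. Qed.

Lemma all_removals w : all (fun l : letter => ~~ l.1) w ->
  removals w = w /\ additions w = [::].
Proof. by elim: w => //= -[[] a] w IHw //= /IHw[-> ->]. Qed.

Lemma inversion_factor_cat us ds : all (fun l : letter => l.1) us ->
  all (fun l : letter => ~~ l.1) ds ->
  inversion_factor (us ++ ds) = \prod_(u <- us) \prod_(d <- ds) exchange_factor u d.
Proof.
move=> + dsP; have [rds _] := all_removals dsP; elim: us => [|[[] a] us IHus] //=.
  rewrite big_nil => _; elim: (ds) dsP => //= -[[] d] w IHw //= wP.
  by rewrite IHw ?mulr1.
move=> /[dup] usP /IHus->; rewrite big_cons mulrC; congr (_ * _).
by rewrite /removals filter_cat -!/(removals _) rds (all_additions usP).1.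
Qed.

Lemma inversions_pos_cat us ds : all (fun l : letter => l.1) us ->
  all (fun l : letter => ~~ l.1) ds ->
  {in us & ds, forall u d, 0 < u.2 - d.2} -> inversions_pos (us ++ ds).
Proof.
move=> + dsP; have [rds _] := all_removals dsP; elim: us => [|[[] a] us IHus] //=.
  by move=> _ _; elim: (ds) dsP => //= -[[] d] w IHw //= /IHw->.
move=> /[dup] usP /IHus{}IHus pos; rewrite IHus => [|u d uP dP]; last first.
  by apply: pos => //; rewrite inE uP orbT.
rewrite /removals filter_cat -!/(removals _) rds (all_additions usP).1 /=.
by apply/allP => d dP; apply: (pos (true, a)) => //; rewrite mem_head.
Qed.

(** The removals, already in front, are rotated to the end, whereby their
    exponents drop by [t], and then pass all the additions once more. *)
Lemma reduces_cycle t us ds : all (fun l : letter => l.1) us ->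
  all (fun l : letter => ~~ l.1) ds ->
  {in us & ds, forall u d, 0 < u.2 - d.2 + t} ->
  reduces t (\prod_(u <- us) \prod_(d <- ds) exchange_factor u (shift_letter t d))
    (ds ++ us) (map (shift_letter t) ds ++ us).
Proof.
move=> usP dsP pos; have dsP' : all (fun l : letter => ~~ l.1) (map (shift_letter t) ds).
  by rewrite all_map.
have [rot _] := reduces_rot t ds us; rewrite -[\prod_(_ <- _) _]mul1r.
apply: reduces_trans rot _.
have := @reduces_sort t (us ++ map (shift_letter t) ds) [::].
rewrite inversion_factor_cat // /removals /additions !filter_cat -!/(removals _).
rewrite -!/(additions _) (all_additions usP).1 (all_additions usP).2.
rewrite (all_removals dsP').1 (all_removals dsP').2 cats0 /=.
under eq_bigr => u _ do rewrite big_map; apply.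
apply: inversions_pos_cat => // u _ uP /mapP[d dP ->] /=.
by have := pos u d uP dP; rewrite opprB addrA addrAC.
Qed.

Definition shift_times (t : int) (N : nat) (l : letter) : letter := (l.1, l.2 - t * N%:Z).

Lemma reduces_cycles t us ds N : 0 < t -> all (fun l : letter => l.1) us ->
  all (fun l : letter => ~~ l.1) ds ->
  {in us & ds, forall u d, 0 < u.2 - d.2 + t} ->
  reduces t
    (\prod_(u <- us) \prod_(d <- ds) \prod_(n < N) exchange_factor u (shift_times t n.+1 d))
    (ds ++ us) (map (shift_times t N) ds ++ us).
Proof.
move=> t_gt0 usP dsP pos; elim: N => [|N IHN].
  rewrite [\prod_(u <- us) _]big1 => [|u _]; last by rewrite big1 // => d _; rewrite big_ord0.
  rewrite (eq_map (g := id)) ?map_id => [|[b a]]; first exact: reduces_refl.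
  by rewrite /shift_times mulr0 subr0.
have dsP' : all (fun l : letter => ~~ l.1) (map (shift_times t N) ds).
  by rewrite all_map.
have pos' : {in us & map (shift_times t N) ds, forall u d, 0 < u.2 - d.2 + t}.
  move=> u _ uP /mapP[d dP ->] /=.
  have := pos u d uP dP; have : 0 <= t * N%:Z by rewrite mulr_ge0 // ltW.
  by move: (t * N%:Z) (u.2) (d.2) => s x y; lia.
have := reduces_trans IHN (reduces_cycle usP dsP' pos').
have -> : map (shift_letter t) (map (shift_times t N) ds) = map (shift_times t N.+1) ds.
  rewrite -map_comp; apply: eq_map => -[b a].
  rewrite /shift_times /shift_letter /= (_ : N.+1%:Z = N%:Z + 1); last by lia.
  by congr (_, _); ring.
congr (reduces t _ _ _); rewrite -big_split; apply: eq_bigr => u _ /=.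
rewrite big_map -big_split; apply: eq_bigr => d _ /=; rewrite big_ord_recr /=.
congr (_ * exchange_factor _ _); rewrite /shift_times /shift_letter /=.
by rewrite (_ : N.+1%:Z = N%:Z + 1); [congr (_, _); ring | lia].
Qed.

(** * The limit of the sorting process *)

Definition nparts : set pfun := [set f | fsupp f /\ forall r, (f r.+1 <= f r)%N].
Definition pweight (t : int) (f : pfun) : int := t * (psize f)%:Z.

Lemma chain_removals w f L (B : nat) :
  all (fun l : letter => ~~ l.1 && (l.2 <= - B%:Z)) w -> fsupp f -> chain w f L ->
  [/\ (psize (last f L) <= psize f)%N,
      B%:Z * ((psize f)%:Z - (psize (last f L))%:Z) <= chain_weight w f L &
      psize (last f L) = psize f -> L = nseq (size w) f].
Proof.
elim: w f L => [|[b a] w IHw] f [|g L] //=; first by move=> _ _ _; rewrite subrr mulr0.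
case/andP; case: b => //= aB wP fs [gs gf /(IHw _ _ wP gs)[le_lg le_w eqL]].
have le_gf : (psize g <= psize f)%N by apply: psize_le fs _ => r; have [] := gf r.
split; first exact: leq_trans le_lg le_gf.
  have -> : B%:Z * ((psize f)%:Z - (psize (last g L))%:Z) =
      B%:Z * ((psize f)%:Z - (psize g)%:Z) + B%:Z * ((psize g)%:Z - (psize (last g L))%:Z).
    by ring.
  rewrite lerD // -[X in _ <= X]mulrNN opprB ler_wpM2r ?subr_ge0 ?lez_nat //.
  by rewrite lerNr.
move=> E; have Egf : psize g = psize f by apply/eqP; rewrite eqn_leq le_gf -E le_lg.
have gfE : g = f by apply: psize_le_eq fs _ Egf => r; have [] := gf r.
by rewrite eqL ?E // gfE.
Qed.

Lemma chain_additions w f L (A : nat) :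
  all (fun l : letter => l.1 && (- A%:Z <= l.2)) w -> fsupp f -> chain w f L ->
  [/\ (psize f <= psize (last f L))%N,
      - A%:Z * ((psize (last f L))%:Z - (psize f)%:Z) <= chain_weight w f L &
      psize (last f L) = psize f -> L = nseq (size w) f].
Proof.
elim: w f L => [|[b a] w IHw] f [|g L] //=; first by move=> _ _ _; rewrite subrr mulr0.
case/andP; case: b => //= aB wP fs [gs fg /(IHw _ _ wP gs)[le_gl le_w eqL]].
have le_fg : (psize f <= psize g)%N by apply: psize_le gs _ => r; have [] := fg r.
split; first exact: leq_trans le_fg le_gl.
  have -> : - A%:Z * ((psize (last g L))%:Z - (psize f)%:Z) =
      - A%:Z * ((psize g)%:Z - (psize f)%:Z) + - A%:Z * ((psize (last g L))%:Z - (psize g)%:Z).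
    by ring.
  by rewrite lerD // ler_wpM2r ?subr_ge0 ?lez_nat.
move=> E; have Efg : psize f = psize g by apply/eqP; rewrite eqn_leq le_fg -E le_gl.
have fgE : f = g by apply: psize_le_eq gs _ Efg => r; have [] := fg r.
by rewrite eqL ?E // -fgE.
Qed.

Lemma chain_const w f : fsupp f -> (forall r, (f r.+1 <= f r)%N) ->
  chain w f (nseq (size w) f) /\ chain_weight w f (nseq (size w) f) = 0.
Proof.
move=> fs fP; have ff : interl f f by move=> r; split.
elim: w => //= l w [cw ww]; rewrite ww subrr mulr0 addr0; split=> //; split=> //.
by rewrite /step; case: l.1.
Qed.

Lemma last_nseq (T : Type) n (x y : T) : last x (nseq n y) = if n is 0 then x else y.
Proof. by case: n => //= n; elim: n. Qed.

(** After many turns the removals have very negative exponents while those of the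
    additions have not changed, so a closed chain that is not constant has a large
    weight; the constant ones are given by one partition each. *)
Lemma chain_series_limit (t : int) us ds (n : nat) : 0 < t ->
  all (fun l : letter => l.1) us -> all (fun l : letter => ~~ l.1) ds ->
  (0 < size us)%N ->
  exists N0, forall N, (N0 <= N)%N ->
    (chain_series t (map (shift_times t N) ds ++ us))``_n =
    (gseries nparts (pweight t))``_n.
Proof.
move=> t_gt0 usP dsP us_gt0; pose A := (\sum_(l <- us ++ ds) `|l.2|%N)%N.
have leA l : l \in us ++ ds -> (`|l.2|%N <= A)%N.
  by move=> lw; rewrite /A (big_rem l) //= leq_addr.
(* A unit of size lost in the removals costs at least [A + n.+1], and regaining
   it in the additions gives back at most [A]. *)
exists (A + (A + n.+1))%N => N leN; set w := _ ++ us.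
pose B := (A + n.+1)%N; have w_gt0 : (0 < size w)%N by rewrite size_cat addn_gt0 us_gt0 orbT.
have dsB : all (fun l : letter => ~~ l.1 && (l.2 <= - B%:Z)) (map (shift_times t N) ds).
  rewrite all_map; apply/allP => d dP /=; rewrite (allP dsP) //=.
  have /leA : d \in us ++ ds by rewrite mem_cat dP orbT.
  have : N%:Z <= t * N%:Z by rewrite ler_peMl // -gtz0_ge1.
  by move: (t * N%:Z) (d.2) => s x; rewrite /B; lia.
have usA : all (fun l : letter => l.1 && (- A%:Z <= l.2)) us.
  apply/allP => u uP /=; rewrite (allP usP) //=.
  have /leA : u \in us ++ ds by rewrite mem_cat uP.
  by move: (u.2) => x; lia.
symmetry; apply: (@count_bij _ _ _ _ (fun f => nseq (size w) f)); split.
- move=> f [[fs fP] wf]; have [cw ww] := chain_const w fs fP.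
  have lastE : last pfun0 (nseq (size w) f) = f by rewrite last_nseq; case: (size w) w_gt0.
  by split; rewrite /closed_chain /closed_weight /= lastE // ww addr0.
- by move=> f g _ _; case: (size w) w_gt0 => //= m _ [].
- move=> L [cL wL]; rewrite /closed_chain /= in cL.
  have szL := chain_size cL; set f := last pfun0 L in cL.
  have L_n0 : L != [::] by move: w_gt0; rewrite -szL; case: (L).
  have fs : fsupp f.
    rewrite /f; case: (L) L_n0 cL szL => // g L' _; case: (w) => // l w' /= [gs _ cL'] _.
    exact: chain_last_fsupp gs cL'.
  have [sz1 sz2] : size (take (size ds) L) = size (map (shift_times t N) ds) /\
     L = take (size ds) L ++ drop (size ds) L.
    rewrite cat_take_drop size_takel ?size_map // szL size_cat size_map leq_addr //.
  move: wL; rewrite /closed_weight -/f {1}sz2 /w chain_weight_cat //.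
  move: cL; rewrite {1}sz2 /w chain_cat //; set L1 := take _ L; set L2 := drop _ L.
  case=> c1 c2; have [le1 w1 eq1] := chain_removals dsB fs c1.
  have gs := chain_last_fsupp fs c1; have [le2 w2 eq2] := chain_additions usA gs c2.
  have lastL : last (last f L1) L2 = f.
    by rewrite -last_cat -sz2 /f; case: (L) L_n0.
  rewrite lastL in le2 w2 eq2; set g := last f L1 in le1 w1 eq1 gs le2 w2 eq2 *.
  move=> wL; have gfE : psize g = psize f.
    apply/eqP; rewrite eqn_leq le1 leqNgt; apply/negP => lt_gf; move: wL w1 w2.
    move: (chain_weight _ _ _) (chain_weight _ _ _) => x1 x2 wL w1 w2.
    have ge0 : 0 <= t * (psize f)%:Z by rewrite mulr_ge0 // ltW.
    have := lerD w1 w2; rewrite mulNr -mulrBl (_ : B%:Z - A%:Z = n.+1%:Z); last first.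
      by rewrite /B; lia.
    have := ler_peMr (_ : 0 <= n.+1%:Z) (_ : 1 <= (psize f)%:Z - (psize g)%:Z :> int).
    by move: (_ * (_ - _)) => y /(_ isT); lia.
  have L1E := eq1 gfE; have gE : g = f.
    by rewrite /g L1E last_nseq; case: (size _).
  have L2E : L2 = nseq (size us) f by rewrite -gE; apply: eq2; rewrite gE.
  have LE : L = nseq (size w) f.
    by rewrite sz2 -/L1 -/L2 L1E L2E size_cat nseqD.
  have ffP r : (f r.+1 <= f r)%N.
    move: c2; rewrite -/g gE L2E; case: (us) us_gt0 => // l us' _ /= [_ + _].
    by rewrite /step; case: l.1 => /(_ r)[].
  exists f => //; split=> //; rewrite /pweight; move: wL.
  by rewrite gE L1E L2E (chain_const _ fs ffP).2 (chain_const _ fs ffP).2 !addr0.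
Qed.

(** * Euler's product for partitions *)

Lemma noninc_le (f : pfun) : (forall r, f r.+1 <= f r)%N ->
  forall r s, (r <= s)%N -> (f s <= f r)%N.
Proof.
move=> fP r; elim=> [|s IHs]; first by case: r.
by rewrite leq_eqVlt => /predU1P[->//|/IHs]; apply: leq_trans.
Qed.

Lemma nparts_seq f : nparts f ->
  exists2 s, is_partition s /\ sumn s = psize f & f = nth 0%N s.
Proof.
move=> [[N fN] fP]; have exN : exists N, f N == 0%N by exists N; rewrite fN.
case: (ex_minnP exN) => M /eqP fM minM.
have f0 r : (M <= r)%N -> f r = 0%N.
  by move=> /(noninc_le fP); rewrite fM leqn0 => /eqP.
have nthE : f = nth 0%N (mkseq f M).
  apply/funext => r; have [le_Mr|lt_rM] := leqP M r.
    by rewrite nth_default ?size_mkseq ?f0.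
  by rewrite nth_mkseq.
exists (mkseq f M); last by [].
split.
  apply/andP; split.
    by apply/(sortedP 0%N) => i _; rewrite -nthE; apply: fP.
  apply/negP => /(nthP 0%N)[r]; rewrite size_mkseq => lt_rM; rewrite nth_mkseq // => fr.
  by have := minM r; rewrite fr eqxx leqNgt lt_rM => /(_ isT).
rewrite sumnE big_map (psizeE f0) -(big_mkord xpredT f).
by rewrite /index_iota subn0.
Qed.

Lemma tame_nparts (t : int) : 0 < t -> tame nparts (pweight t).
Proof.
move=> t_gt0; split=> [n|f _]; last by rewrite mulr_ge0 // ltW.
apply: (@sub_finite_set _ _ (nth 0%N @` [set s | is_partition s /\ (sumn s <= `|n|)%N])).
  move=> f [/nparts_seq[s [sP sE] fE] fn]; exists s => //; split=> //.
  move: fn; rewrite /pweight -sE.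
  have : (sumn s)%:Z <= t * (sumn s)%:Z by rewrite ler_peMl // -gtz0_ge1.
  by move: (t * _) => x; lia.
exact: finite_image (finite_partitions `|n|).
Qed.

Definition nparts_upto (M : nat) : set pfun :=
  [set f | (forall r, (f r.+1 <= f r)%N) /\ forall r, (M <= r)%N -> f r = 0%N].

(** Subtracting the last part removes the columns of full height. *)
Definition last_part (M : nat) (f : pfun) : pfun * nat :=
  ((fun r => f r - f M)%N, f M).

Lemma last_part_bij M : set_bij (nparts_upto M.+1)
  [set p : pfun * nat | nparts_upto M p.1] (last_part M).
Proof.
split.
- move=> f [fP f0]; split=> r /=; first by apply: leq_sub2r.
  by move=> /(noninc_le fP); rewrite -subn_eq0 => /eqP.
- move=> f g; rewrite !inE => -[fP f0] [gP g0] [/funeqP E EM]; apply/funext => r.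
  have [le_rM|lt_Mr] := leqP r M; last by rewrite f0 ?g0.
  have := E r; rewrite /= EM; have := noninc_le fP le_rM; have := noninc_le gP le_rM.
  by rewrite EM; lia.
- move=> [g m] [/= gP g0]; exists (fun r => if (r <= M)%N then g r + m else 0)%N.
    split=> r; last by rewrite ltnNge => /negbTE->.
    case: ifP => [/ltnW-> //|_]; last by case: ifP.
    by rewrite leq_add2r.
  rewrite /last_part leqnn g0 // add0n; congr (_, _); apply/funext => r.
  by case: leqP => [_|/ltnW/g0->]; rewrite ?addnK ?sub0n.
Qed.

Lemma psize_last_part M f : nparts_upto M.+1 f ->
  (psize f = psize (last_part M f).1 + M.+1 * (last_part M f).2)%N.
Proof.
move=> Pf; have [fP f0] := Pf; have [+ _ _] := last_part_bij M.
move=> /(_ f Pf) [_ g0]; rewrite (psizeE f0) (psizeE (N := M.+1)) => [|r /ltnW/g0//].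
rewrite [X in (_ + X)%N](_ : _ = \sum_(i < M.+1) f M)%N -?big_split; last first.
  by rewrite sum_nat_const card_ord.
apply: eq_bigr => i _ /=; rewrite subnK //.
by apply: noninc_le fP _ _ _; rewrite -ltnS.
Qed.

Lemma euler_upto t M : (0 < t)%N ->
  qpoch ('q ^+ t) ('q ^+ t) M * gseries (nparts_upto M) (pweight t%:Z) = 1.
Proof.
move=> t_gt0; elim: M => [|M IHM].
  rewrite /qpoch big_geq // mul1r.
  have E0 : nparts_upto 0 = [set pfun0].
    apply/seteqP; split=> [f [_ f0]|f ->]; last by split.
    by apply/funext => r; rewrite f0.
  have w0 : pweight t%:Z pfun0 = 0.
    by rewrite /pweight (psizeE (N := 0)) // big_ord0 mulr0.
  apply/fpsP => -[|n]; rewrite fps1E /gseries /= E0.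
    rewrite (_ : [set i | _] = [set pfun0]); first by rewrite /count_set fsbig_set1.
    by apply/seteqP; split=> [f []|f ->].
  rewrite (_ : [set i | _] = set0); first by rewrite /count_set fsbig_set0.
  by apply/seteqP; split=> // f [->]; rewrite w0.
rewrite qpochS -exprM -exprD -mulnS.
have sub N : nparts_upto N `<=` nparts by move=> f [fP f0]; split=> //; exists N.
have tameM N : tame (nparts_upto N) (pweight t%:Z).
  have [fin ge0] := @tame_nparts t%:Z t_gt0; split=> [n|f /sub/ge0//].
  by apply: sub_finite_set (fin n) => f [/sub].
pose W (p : pfun * nat) := pweight t%:Z p.1 + (p.2 * (t * M.+1))%N%:Z.
have wE f : nparts_upto M.+1 f -> pweight t%:Z f = W (last_part M f).
  move=> Pf; rewrite /W /pweight (psize_last_part Pf); set a := psize _; set b := _.2.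
  by rewrite !(PoszD, PoszM); ring.
have e_gt0 : (0 < t * M.+1)%N by rewrite muln_gt0 t_gt0.
have [_ E] := gseries_nat e_gt0 (tame_bij (last_part_bij M) wE (tameM M.+1)).
by rewrite -mulrA (gseries_bij (last_part_bij M) wE) E.
Qed.

Lemma euler t : (0 < t)%N ->
  qpoch_inf ('q ^+ t) ('q ^+ t) * gseries nparts (pweight t%:Z) = 1.
Proof.
move=> t_gt0; apply: eq_upto_fps => n; rewrite -(@euler_upto t n.+1) //.
have q0 : ('q ^+ t : fps int)``_0 = 0 by apply: fps_qX0.
apply: eq_uptoM; first exact: qpoch_inf_upto.
move=> i le_in; congr count_set; apply/seteqP; split=> f [Pf wf]; split=> //; last first.
  by case: Pf => fP f0; split=> //; exists n.+1.
case: Pf => -[N fN] fP; split=> // r lt_nr; apply/eqP; rewrite eqn0Ngt; apply/negP => fr.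
have pos s : (s <= r)%N -> (0 < f s)%N.
  by move=> /(noninc_le fP); apply: leq_trans.
have lt_rN : (r < N)%N by rewrite ltnNge; apply: contraL fr => /fN->.
have lt_r : (r < psize f)%N.
  rewrite (psizeE fN) -(subnKC lt_rN) big_split_ord /=.
  apply: leq_trans (leq_addr _ _); rewrite -[X in (X <= _)%N]card_ord -sum1_card.
  by apply: leq_sum => s _; apply: pos; rewrite -ltnS.
move: wf; rewrite /pweight; have : (psize f)%:Z <= t%:Z * (psize f)%:Z.
  by rewrite ler_peMl // lez_nat.
by move: (t%:Z * _) => x; lia.
Qed.

(** * Cylindric partitions as closed chains *)

(** The rows of a cylindric partition are continued periodically, and part $j$ of
    row $n$ is put on the level [row_end c n - 1 - j]. Then the inequalities
    compare a cell only with its neighbours: the next part of the same row is one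
    level lower, and part $j+c_{n+1}$ of the next row is one level higher. The
    cells of one level therefore form a diagonal, and the entries on two
    consecutive diagonals interlace. *)
Fixpoint row_end (c : seq nat) (n : nat) : nat :=
  if n is n'.+1 then (row_end c n' + nth 0 c (n %% size c)).+1 else 0%N.

(** The rows that have a cell on level [e] are those from [first_row c e] on, see
    [first_rowP]. *)
Fixpoint first_row (c : seq nat) (e : nat) : nat :=
  if e is e'.+1 then (first_row c e' + (row_end c (first_row c e') == e))%N else 1%N.

Definition period (c : seq nat) : nat := row_end c (size c).

Lemma row_end_mono c : {mono row_end c : n m / (n <= m)%N}.
Proof.
apply: leq_mono => n m; elim: m => // m IHm; rewrite ltnS leq_eqVlt => /predU1P[->|/IHm].
  by rewrite ltnS leq_addr.
by move/leq_trans; apply; rewrite leqW // leq_addr.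
Qed.

Lemma row_end_periodic c n d : row_end c (n + size c * d) = (row_end c n + period c * d)%N.
Proof.
have base m : row_end c (m + size c) = (row_end c m + period c)%N.
  by elim: m => // m IHm; rewrite addSn /= -[(m + size c).+1]addSn modnDr IHm; lia.
by elim: d => [|d IHd]; rewrite ?muln0 ?addn0 // !mulnS !addnA addnAC base IHd; lia.
Qed.

Lemma period_gt0 c : (0 < size c)%N -> (0 < period c)%N.
Proof. by rewrite /period; case: (size c). Qed.

Lemma first_rowP c e n : (first_row c e <= n)%N = (e < row_end c n)%N.
Proof.
have [le_e lt_e] : (row_end c (first_row c e).-1 <= e < row_end c (first_row c e))%N /\
    (0 < first_row c e)%N.
  elim: e => [|e [/andP[le_e lt_e] n0]] //=.
  case: eqVneq => [E|ne]; rewrite ?addn1 ?addn0 /=; last first.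
    by rewrite leqW //; split=> //; rewrite ltn_neqAle eq_sym ne.
  by rewrite E; split=> //; rewrite leqnn -E ltnS leq_addr.
case/andP: le_e => le_e lt_en; apply/idP/idP => [le_n|].
  by apply: leq_trans lt_en _; rewrite row_end_mono.
move=> lt_e'; rewrite -(prednK lt_e) ltnNge -(row_end_mono c) -ltnNge.
exact: leq_ltn_trans lt_e'.
Qed.

Lemma first_row_periodic c e d : (0 < size c)%N ->
  first_row c (e + period c * d) = (first_row c e + size c * d)%N.
Proof.
move=> c_gt0; have T0 : (period c * d <= e + period c * d)%N by apply: leq_addl.
have ge_d : (size c * d <= first_row c (e + period c * d))%N.
  have := leqnn (first_row c (e + period c * d)); rewrite first_rowP => lt_e.
  have := leq_ltn_trans T0 lt_e.
  by rewrite -[(period c * d)%N]add0n -(row_end_periodic c 0) ltnNge row_end_mono -ltnNge => /ltnW.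
apply/eqP; rewrite eqn_leq first_rowP row_end_periodic ltn_add2r -first_rowP leqnn /=.
by rewrite -(subnK ge_d) leq_add2r first_rowP -(ltn_add2r (period c * d)) -row_end_periodic
  subnK // -first_rowP.
Qed.

Definition level_cell (c : seq nat) (e n : nat) : nat * nat :=
  (n %% size c, row_end c n - e.+1)%N.

Definition cell (c : seq nat) (e r : nat) : nat * nat :=
  level_cell c e (first_row c e + r).

Lemma level_cell_periodic c e n d :
  level_cell c (e + period c * d) (n + size c * d) = level_cell c e n.
Proof.
rewrite /level_cell row_end_periodic -addSn subnDr; congr (_, _).
by rewrite mulnC addnC modnMDl.
Qed.

Lemma cell_periodic c e r d : (0 < size c)%N ->
  cell c (e + period c * d) r = cell c e r.
Proof.
by move=> c0; rewrite /cell first_row_periodic // addnAC level_cell_periodic.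
Qed.

Lemma level_cellE c e n : (e < row_end c n)%N ->
  cell c e (n - first_row c e) = level_cell c e n.
Proof. by rewrite -first_rowP => le_n; rewrite /cell subnKC. Qed.

Lemma level_cell_right c e n : (e.+1 < row_end c n)%N ->
  level_cell c e n = ((level_cell c e.+1 n).1, (level_cell c e.+1 n).2.+1).
Proof. by move=> lt_e; rewrite /level_cell /=; congr (_, _); lia. Qed.

Lemma level_cell_down c e n : (e < row_end c n)%N ->
  level_cell c e.+1 n.+1 = ((level_cell c e n).1.+1 %% size c,
    (level_cell c e n).2 + nth 0 c ((level_cell c e n).1.+1 %% size c))%N.
Proof.
move=> lt_e; rewrite /level_cell /=.
have -> : ((n %% size c).+1 %% size c = n.+1 %% size c)%N by rewrite -addn1 modnDml addn1.
congr (_, _); rewrite subSS; move: (nth _ _ _) => x. by lia.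
Qed.

(** The representative of row [i] that is taken is so far away that its level is
    nonnegative; it is then reduced modulo the period, to the range $1,\dots,T$. *)
Lemma cell_surj c i j : (i < size c)%N ->
  exists e r, (e < period c)%N /\ cell c e.+1 r = (i, j).
Proof.
move=> lt_i; have c_gt0 : (0 < size c)%N by case: (size c) lt_i.
have T_gt0 := period_gt0 c_gt0; set n := (i + size c * j.+1)%N.
have lt_j : (j < row_end c n)%N.
  by rewrite row_end_periodic (leq_trans _ (leq_addl _ _)) // leq_pmull.
pose e0 := (row_end c n - j.+1)%N; have lt_e0 : (e0 < row_end c n)%N.
  by rewrite /e0; move: (row_end c n) lt_j => x; lia.
have cell0 : cell c e0 (n - first_row c e0) = (i, j).
  rewrite level_cellE // /level_cell; congr (_, _).
    by rewrite /n mulnC addnC modnMDl modn_small.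
  by rewrite /e0; move: (row_end c n) lt_j => x; lia.
pose e1 := (e0 + (period c).-1)%N; exists (e1 %% period c)%N, (n - first_row c e0)%N.
split; first by rewrite ltn_mod.
rewrite -cell0 -(cell_periodic e0 _ 1 c_gt0) -(cell_periodic _.+1 _ (e1 %/ period c) c_gt0).
by congr (cell _ _ _); have := divn_eq e1 (period c); rewrite /e1; lia.
Qed.

(** Two rows that agree modulo [size c] have, for the same [j], levels that differ
    by a multiple of the period. *)
Lemma cell_inj c e e' r r' : (e < period c)%N -> (e' < period c)%N ->
  cell c e.+1 r = cell c e'.+1 r' -> e = e' /\ r = r'.
Proof.
wlog le_n : e e' r r' / (first_row c e.+1 + r <= first_row c e'.+1 + r')%N.
  move=> th lt_e lt_e' E; have [|/ltnW] := leqP (first_row c e.+1 + r) (first_row c e'.+1 + r').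
    by move=> /th; apply.
  by move=> /th/(_ lt_e' lt_e (esym E))[-> ->].
move=> lt_e lt_e'; rewrite /cell /level_cell.
have : (e.+1 < row_end c (first_row c e.+1 + r))%N by rewrite -first_rowP leq_addr.
have : (e'.+1 < row_end c (first_row c e'.+1 + r'))%N by rewrite -first_rowP leq_addr.
set n := (first_row c e.+1 + r)%N in le_n *; set n' := (first_row c e'.+1 + r')%N in le_n *.
move=> lt_n' lt_n [/eqP]; rewrite eq_sym eqn_mod_dvd // => /dvdnP[d nd].
have nE : n' = (n + size c * d)%N by rewrite mulnC -nd subnKC.
rewrite nE row_end_periodic => E; have e'E : e' = (e + period c * d)%N.
  by move: lt_n' lt_n E; rewrite nE row_end_periodic; move: (period c * d)%N => x; lia.
case: d nd nE E e'E => [|d] nd nE E e'E; last first.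
  by move: lt_e'; rewrite e'E mulnS; move: (period c * d)%N => x; lia.
have ee : e = e' by rewrite e'E muln0 addn0.
by split=> //; apply: (@addnI (first_row c e.+1)); rewrite -/n {1}ee -/n' nE muln0 addn0.
Qed.

Definition cyl_rows (c : seq nat) (A : nat -> pfun) :=
  forall i j, (i < size c)%N -> (A i j.+1 <= A i j)%N.

Definition cyl_columns (c : seq nat) (A : nat -> pfun) :=
  forall i j, (i < size c)%N ->
    (A (i.+1 %% size c) (j + nth 0 c (i.+1 %% size c)) <= A i j)%N.

Definition slice (c : seq nat) (A : nat -> pfun) (e : nat) : pfun :=
  fun r => A (cell c e r).1 (cell c e r).2.

(** Whether the diagonals on the levels [e] and [e.+1] start in the same row, in
    which case the second one is the larger. *)
Definition rises (c : seq nat) (e : nat) : bool := row_end c (first_row c e) != e.+1.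

Lemma slice_level c A e n : (e < row_end c n)%N ->
  slice c A e (n - first_row c e) = A (level_cell c e n).1 (level_cell c e n).2.
Proof. by move=> lt_e; rewrite /slice level_cellE. Qed.

Lemma first_rowS c e : first_row c e.+1 = (first_row c e + ~~ rises c e)%N.
Proof. by rewrite /= /rises negbK. Qed.

Lemma row_end_first c e r : (e < row_end c (first_row c e + r))%N.
Proof. by rewrite -first_rowP leq_addr. Qed.

Lemma slice_step c A e : (0 < size c)%N -> cyl_rows c A -> cyl_columns c A ->
  step (rises c e) (slice c A e) (slice c A e.+1).
Proof.
move=> c_gt0 Arow Acol.
have right n : (e.+1 < row_end c n)%N ->
    (A (level_cell c e n).1 (level_cell c e n).2 <=
     A (level_cell c e.+1 n).1 (level_cell c e.+1 n).2)%N.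
  by move=> lt_e; rewrite (level_cell_right lt_e); apply: Arow; rewrite ltn_mod.
have down n : (e < row_end c n)%N ->
    (A (level_cell c e.+1 n.+1).1 (level_cell c e.+1 n.+1).2 <=
     A (level_cell c e n).1 (level_cell c e n).2)%N.
  by move=> lt_e; rewrite (level_cell_down lt_e); apply: Acol; rewrite ltn_mod.
have lt_e r := row_end_first c e r; have lt_Se r := row_end_first c e.+1 r.
rewrite /slice /cell /step; have E := first_rowS c e.
case: (rises c e) E => /=; rewrite ?addn0 ?addn1 => E r.
  split; first by rewrite E; apply: right; rewrite -{1}E.
  by rewrite E addnS; apply: down.
split; first by rewrite E addSn; apply: down.
by rewrite E addnS addSn; apply: right; rewrite -addSn -{1}E.
Qed.

(** Every cell lies on some level at least one, so each of the two inequalities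
    at that cell is one of those that say that two consecutive slices interlace. *)
Lemma slice_cylindric c A : (0 < size c)%N ->
  (forall e, (e < period c)%N -> step (rises c e) (slice c A e) (slice c A e.+1)) ->
  cyl_rows c A /\ cyl_columns c A.
Proof.
move=> c_gt0 stepA.
have slice_per e d : slice c A (e + period c * d) = slice c A e.
  by apply/funext => r; rewrite /slice cell_periodic.
have stepT e : step (rises c e) (slice c A e) (slice c A e.+1).
  have T_gt0 := period_gt0 c_gt0; rewrite (divn_eq e (period c)) addnC mulnC -addSn !slice_per.
  suff -> : rises c (e %% period c + period c * (e %/ period c)) = rises c (e %% period c).
    by apply: stepA; rewrite ltn_mod.
  by rewrite /rises first_row_periodic // row_end_periodic -addSn eqn_add2r.
split=> i j lt_i; have [e [r [_ cell_ij]]] := cell_surj j lt_i.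
  have lt_e := row_end_first c e.+1 r; have /ltnW lt_e' := lt_e.
  set n := (first_row c e.+1 + r)%N in lt_e lt_e'.
  have Aij : slice c A e.+1 r = A i j by rewrite /slice cell_ij.
  have Aij' : slice c A e (n - first_row c e) = A i j.+1.
    rewrite slice_level // level_cell_right //.
    by rewrite (_ : level_cell c e.+1 n = (i, j)) // -cell_ij.
  rewrite -Aij -Aij' /n; have := stepT e; rewrite (first_rowS c e) /step.
  case: (rises c e) => /=; rewrite ?addn0 ?addn1 => /(_ r) [].
    by rewrite addKn.
  by rewrite addSn -addnS addKn.
have lt_e := row_end_first c e.+1 r; set n := (first_row c e.+1 + r)%N in lt_e.
have Aij : slice c A e.+1 r = A i j by rewrite /slice cell_ij.
have lt_Se : (e.+2 < row_end c n.+1)%N by rewrite /= ltnS (leq_trans lt_e) // leq_addr.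
have Aij' : slice c A e.+2 (n.+1 - first_row c e.+2) =
    A (i.+1 %% size c)%N (j + nth 0%N c (i.+1 %% size c))%N.
  rewrite slice_level // level_cell_down //.
  by rewrite (_ : level_cell c e.+1 n = (i, j)) // -cell_ij.
rewrite -Aij -Aij' /n; have := stepT e.+1; rewrite (first_rowS c e.+1) /step.
case: (rises c e.+1) => /=; rewrite ?addn0 ?addn1 => /(_ r) [].
  by rewrite -addnS addKn.
by rewrite subSS addKn.
Qed.

(** [level_word bs] gives the steps [bs] the exponents that make the weight of
    a closed chain the total size of its members, see [level_word_weight]. *)
Fixpoint level_word (bs : seq bool) : seq letter :=
  if bs is b :: bs' then (b, (size bs)%:Z) :: level_word bs' else [::].

Lemma size_level_word bs : size (level_word bs) = size bs.
Proof. by elim: bs => //= b bs ->. Qed.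

Lemma nth_level_word l bs s : (nth l (level_word bs) s).1 = nth l.1 bs s.
Proof. by elim: bs s => [|b bs IHbs] [|s] //=. Qed.

(** Summation by parts. *)
Lemma level_word_weight bs f L : size L = size bs ->
  (size bs)%:Z * (psize f)%:Z + chain_weight (level_word bs) f L =
  \sum_(g <- L) (psize g)%:Z.
Proof.
elim: bs f L => [|b bs IHbs] f [|g L] //=; first by rewrite big_nil mul0r addr0.
move=> [szL]; rewrite big_cons -(IHbs g L szL).
rewrite (_ : (size bs).+1%:Z = (size bs)%:Z + 1); last by lia.
by ring.
Qed.

Lemma chain_nthP w f L : chain w f L <-> size L = size w /\
  forall s, (s < size w)%N -> fsupp (nth pfun0 L s) /\
    step (nth (true, 0) w s).1 (nth pfun0 (f :: L) s) (nth pfun0 L s).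
Proof.
elim: w f L => [|l w IHw] f [|g L] /=; try by split=> // -[].
split=> [[gs fg /IHw[-> IH]]|[[szL] IH]]; first by split=> // -[|s] //= /IH.
split; [by have [] := IH 0%N isT | by have [] := IH 0%N isT |].
by apply/IHw; split=> // s lt_s; apply: (IH s.+1 lt_s).
Qed.

Lemma partition_nth_inj s s' : is_partition s -> is_partition s' ->
  nth 0%N s =1 nth 0%N s' -> s = s'.
Proof.
move=> ps ps' E.
have le u u' : is_partition u -> nth 0%N u =1 nth 0%N u' -> (size u <= size u')%N.
  move=> /andP[_ u0] uE; rewrite leqNgt; apply: contra u0 => lt_u.
  by rewrite -(nth_default 0%N (leqnn (size u'))) -uE mem_nth.
apply: (@eq_from_nth _ 0%N) => [|i _]; last exact: E.
by apply/eqP; rewrite eqn_leq !le.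
Qed.

Definition parts (L : seq (seq nat)) : nat -> pfun := fun i => nth 0%N (nth [::] L i).

Lemma is_cylindric_parts k (c : k.-tuple nat) (L : k.-tuple (seq nat)) :
  is_cylindric c L <-> (forall i, is_partition (tnth L i)) /\ cyl_columns c (parts L).
Proof.
have tL (i : 'I_k) : nth 0%N (tnth L i) = parts L i by rewrite (tnth_nth [::]).
split=> -[Lpart Lcol]; split=> //.
  move=> i j; rewrite size_tuple => lt_i; have := Lcol (Ordinal lt_i) j.
  by rewrite !tL (tnth_nth 0%N).
move=> i j; rewrite !tL (tnth_nth 0%N); have := Lcol i j; rewrite size_tuple.
by apply.
Qed.

Lemma partition_rows k (c : k.-tuple nat) (L : k.-tuple (seq nat)) :
  (forall i, is_partition (tnth L i)) -> cyl_rows c (parts L).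
Proof.
move=> Lpart i j; rewrite size_tuple => lt_i; have /andP[sL _] := Lpart (Ordinal lt_i).
rewrite /parts; move: sL; rewrite (tnth_nth [::]) /=; move: (nth _ _ _) => s ss.
have [lt_j|le_j] := ltnP j.+1 (size s); last by rewrite nth_default.
by have /(sortedP 0%N)/(_ j lt_j) := ss.
Qed.

Lemma row_end_ge c n : (n <= row_end c n)%N.
Proof. by elim: n => //= n IHn; rewrite ltnS (leq_trans IHn) ?leq_addr. Qed.

Lemma slice_support c A J e r : (0 < size c)%N ->
  (forall i j, (i < size c)%N -> (J <= j)%N -> A i j = 0%N) ->
  (J + e.+1 <= r)%N -> slice c A e r = 0%N.
Proof.
move=> c_gt0 A0 le_r; apply: A0; rewrite /cell /level_cell /= ?ltn_mod //.
by have := row_end_ge c (first_row c e + r); move: (row_end _ _) => x; lia.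
Qed.

Lemma sum_rows (F : nat -> pfun) M J :
  (forall i j, (i < M)%N -> (J <= j)%N -> F i j = 0%N) ->
  (\sum_(i < M) psize (F i))%N = \sum_(x \in (`I_M `*` [set: nat])%classic) F x.1 x.2.
Proof.
move=> F0; transitivity (\sum_(i < M) \sum_(j \in `I_J) F i j)%N.
  by apply: eq_bigr => i _; rewrite -fsbig_ord (@psizeE _ J) // => j; apply: F0.
rewrite (fsbig_ord _ _ (fun i => \sum_(j \in `I_J) F i j)%N) pair_fsbig //.
apply: fsbig_widen => [[i j] [] //|[i j] [[/= lt_i _] nij]].
by apply: F0 => //; rewrite leqNgt; apply/negP => lt_j; apply: nij.
Qed.

(** Rows and slices enumerate the same cells. This gives the equality of the
    sizes as well as the inverse of the passage from rows to slices. *)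
Lemma cell_bij c : (0 < size c)%N -> set_bij (`I_(period c) `*` [set: nat])%classic
  (`I_(size c) `*` [set: nat])%classic (fun x => cell c x.1.+1 x.2).
Proof.
move=> c_gt0; split.
- by move=> [e r] _; split=> //=; rewrite ltn_mod.
- move=> [e r] [e' r']; rewrite !inE => -[/= lt_e _] [/= lt_e' _].
  by move=> /(cell_inj lt_e lt_e')[-> ->].
- by move=> [i j] [/= /(cell_surj j)[e [r [lt_e E]]] _]; exists (e, r).
Qed.

Lemma sum_slices c A J : (0 < size c)%N ->
  (forall i j, (i < size c)%N -> (J <= j)%N -> A i j = 0%N) ->
  (\sum_(s < period c) psize (slice c A s.+1) = \sum_(i < size c) psize (A i))%N.
Proof.
move=> c_gt0 A0; rewrite (sum_rows A0) (reindex_fsbig _ _ _ _ (cell_bij c_gt0)).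
apply: (@sum_rows (fun s => slice c A s.+1) _ (J + (period c).+1)) => s r lt_s le_r.
by apply: slice_support c_gt0 A0 _; lia.
Qed.

Definition cyl_word (c : seq nat) : seq letter :=
  level_word (mkseq (rises c) (period c)).

Definition slices (c : seq nat) (A : nat -> pfun) : seq pfun :=
  mkseq (fun s => slice c A s.+1) (period c).

Lemma size_cyl_word c : size (cyl_word c) = period c.
Proof. by rewrite size_level_word size_mkseq. Qed.

Lemma last_mkseq (T : Type) (x : T) (f : nat -> T) n : (0 < n)%N ->
  last x (mkseq f n) = f n.-1.
Proof. by case: n => // n _; rewrite -nth_last size_mkseq nth_mkseq. Qed.

Lemma last_slices c A : (0 < size c)%N -> last pfun0 (slices c A) = slice c A 0.
Proof.
move=> c_gt0; rewrite last_mkseq ?period_gt0 // prednK ?period_gt0 //.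
by apply/funext => r; rewrite /slice -[in RHS](cell_periodic 0 r 1 c_gt0) muln1.
Qed.

Lemma nth_slices c A s : (s <= period c)%N ->
  nth pfun0 (slice c A 0 :: slices c A) s = slice c A s.
Proof. by case: s => //= s lt_s; rewrite nth_mkseq. Qed.

Lemma closed_chain_slices c A : (0 < size c)%N ->
  closed_chain (cyl_word c) (slices c A) <->
  forall s, (s < period c)%N -> fsupp (slice c A s.+1) /\
    step (rises c s) (slice c A s) (slice c A s.+1).
Proof.
move=> c_gt0; rewrite /closed_chain /= last_slices // chain_nthP size_mkseq size_cyl_word.
split=> [[_ H]|H]; [move=> s lt_s | split=> // s lt_s]; have := H s lt_s.
  by rewrite nth_slices 1?ltnW // nth_mkseq // nth_level_word nth_mkseq.
by rewrite nth_slices 1?ltnW // nth_mkseq // nth_level_word nth_mkseq.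
Qed.

Lemma parts_support k (L : k.-tuple (seq nat)) :
  exists J, forall i j, (J <= j)%N -> parts L i j = 0%N.
Proof.
exists (\max_(s <- L) size s)%N => i j le_j; rewrite /parts nth_default //.
have [lt_i|le_i] := ltnP i (size L); last by rewrite [nth [::] _ _]nth_default.
by apply: leq_trans le_j; apply: leq_bigmax_seq => //; apply: mem_nth.
Qed.

(** By [cell_bij] the entries of the slices can be prescribed freely. *)
Lemma fun_of_slices c (L : seq pfun) : size L = period c ->
  exists A, slices c A = L.
Proof.
move=> szL; pose good i j := [set p | (p.1 < period c)%N /\ cell c p.1.+1 p.2 = (i, j)].
pose idx i j := xget (0, 0)%N (good i j).
exists (fun i j => nth pfun0 L (idx i j).1 (idx i j).2).
apply: (@eq_from_nth _ pfun0); rewrite size_mkseq ?szL // => s lt_s; rewrite nth_mkseq //.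
apply/funext => r; rewrite /slice; set i := (cell _ _ _).1; set j := (cell _ _ _).2.
have : good i j (idx i j).
  apply: (@xgetPex _ (0, 0)%N (good i j)); exists (s, r).
  by split=> //=; rewrite -surjective_pairing.
by move: (idx i j) => [e r'] [/= lt_e]; rewrite -surjective_pairing => /(cell_inj lt_e lt_s)[-> ->].
Qed.

(** Finitely many nonzero cells are contained in finitely many columns. *)
Lemma rows_support c A : (forall s, (s < period c)%N -> fsupp (slice c A s.+1)) ->
  exists J, forall i j, (i < size c)%N -> (J <= j)%N -> A i j = 0%N.
Proof.
move=> sfs; have [R sR] : exists R, forall s r, (s < period c)%N -> (R <= r)%N ->
    slice c A s.+1 r = 0%N.
  elim: (period c) sfs => [|T IHT] sfs; first by exists 0%N.
  have [|R sR] := IHT; first by move=> s /ltnW; apply: sfs.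
  have [R' sR'] := sfs T (leqnn _); exists (maxn R R') => s r.
  rewrite ltnS geq_max leq_eqVlt => /predU1P[->|/sR h] /andP[le1 le2]; first exact: sR'.
  exact: h.
pose js := [seq (cell c s.+1 r).2 | s <- iota 0 (period c), r <- iota 0 R].
exists (sumn js).+1 => i j lt_i lt_j; have [s [r [lt_s E]]] := cell_surj j lt_i.
have -> : A i j = slice c A s.+1 r by rewrite /slice E.
apply: sR => //; rewrite leqNgt; apply/negP => lt_r.
suff : (j <= sumn js)%N by rewrite leqNgt lt_j.
apply: mem_leq_sumn; apply/allpairsP; exists (s, r); rewrite !mem_iota.
by split=> //; rewrite -[(s, r).1]/s -[(s, r).2]/r E.
Qed.

Lemma slices_bij k (c : k.-tuple nat) : (0 < k)%N ->
  set_bij [set L | is_cylindric c L] (closed_chain (cyl_word c))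
    (fun L => slices c (parts L)).
Proof.
move=> k_gt0; have c_gt0 : (0 < size c)%N by rewrite size_tuple.
split.
- move=> L /is_cylindric_parts[Lpart Lcol]; apply/closed_chain_slices => // s lt_s.
  have [J LJ] := parts_support L; split; last exact: slice_step (partition_rows Lpart) Lcol.
  by exists (J + s.+2)%N => r; apply: slice_support => // i j _; apply: LJ.
- move=> L L'; rewrite !inE => -[Lpart _] [Lpart' _] E; apply: eq_from_tnth => i.
  apply: partition_nth_inj => // j.
  have [|s [r [lt_s sr]]] := @cell_surj c i j; first by rewrite size_tuple.
  have := congr1 (fun u => nth pfun0 u s r) E; rewrite !nth_mkseq //.
  by rewrite /slice sr /parts !(tnth_nth [::]).
- move=> L cL; have szL : size L = period c by rewrite (chain_size cL) size_cyl_word.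
  have [A AL] := fun_of_slices szL; rewrite -AL in cL *.
  have {}cL := (closed_chain_slices A c_gt0).1 cL.
  have [Arow Acol] := slice_cylindric c_gt0 (fun e lt_e => (cL e lt_e).2).
  have [J AJ] := rows_support (fun e lt_e => (cL e lt_e).1).
  have Apart (i : 'I_k) : nparts (A i).
    by split=> [|r]; [exists J => r; apply: AJ | apply: Arow]; rewrite size_tuple.
  pose s i := sval (cid2 (nparts_seq (Apart i))).
  have sP i : is_partition (s i) by rewrite /s; case: cid2 => u [].
  have sA (i : 'I_k) : A i = nth 0%N (s i) by rewrite /s; case: cid2 => u [].
  pose L' : k.-tuple (seq nat) := [tuple s i | i < k].
  have LA i : (i < k)%N -> parts L' i = A i.
    move=> lt_i; rewrite /parts (_ : nth _ _ _ = tnth L' (Ordinal lt_i)).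
      by rewrite tnth_mktuple -sA.
    by rewrite (tnth_nth [::]).
  exists L'.
    apply/is_cylindric_parts; split=> [i|i j]; first by rewrite tnth_mktuple.
    rewrite size_tuple => lt_i; rewrite !LA ?ltn_mod //.
    by have := Acol i j; rewrite size_tuple; apply.
  apply: (@eq_from_nth _ pfun0); rewrite !size_mkseq // => e lt_e.
  rewrite !nth_mkseq //; apply/funext => r; rewrite /slice LA //.
  by rewrite /cell /level_cell /= size_tuple ltn_mod.
Qed.

Lemma psize_nth (s : seq nat) : psize (nth 0%N s) = sumn s.
Proof.
rewrite (psizeE (N := size s)) => [|r /(nth_default 0%N)//].
by rewrite sumnE (big_nth 0%N) big_mkord.
Qed.

Lemma slices_weight k (c : k.-tuple nat) (L : k.-tuple (seq nat)) : (0 < k)%N ->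
  cyl_weight L = closed_weight (period c)%:Z (cyl_word c) (slices c (parts L)).
Proof.
move=> k_gt0; have c_gt0 : (0 < size c)%N by rewrite size_tuple.
have [J LJ] := parts_support L.
have := @level_word_weight (mkseq (rises c) (period c)) (last pfun0 (slices c (parts L)))
  (slices c (parts L)); rewrite !size_mkseq => /(_ erefl).
rewrite /closed_weight => ->; rewrite big_map -[period c]subn0 big_mkord.
rewrite -(big_morph Posz PoszD (erefl 0%:Z)) /cyl_weight; congr Posz.
rewrite (sum_slices c_gt0 (fun i j _ => LJ i j)) size_tuple; apply: eq_bigr => i _.
by rewrite /parts psize_nth (tnth_nth [::]).
Qed.

Lemma cyl_chain_series k (c : k.-tuple nat) : (0 < k)%N ->
  chain_tame (period c)%:Z (cyl_word c) /\
  cyl_series c = chain_series (period c)%:Z (cyl_word c).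
Proof.
move=> k_gt0; have bij := slices_bij c k_gt0.
have wE L : is_cylindric c L -> cyl_weight L =
    closed_weight (period c)%:Z (cyl_word c) (slices c (parts L)).
  by move=> _; apply: slices_weight.
by split; [apply: tame_bij bij wE (tame_cyl c) | apply: gseries_bij bij wE].
Qed.

(** * The product formula *)

Lemma level_word_le bs l : l \in level_word bs -> 0 < l.2 <= (size bs)%:Z.
Proof.
elim: bs => //= b bs IHbs; rewrite inE => /predU1P[->|/IHbs]; first by rewrite /= lexx.
by case/andP=> -> /=; move: (l.2) => x; lia.
Qed.

(** The exponents decrease along the word, so an addition comes before a removal
    exactly when its exponent is the larger. *)
Lemma inversion_factor_level bs :
  inversion_factor (level_word bs) = \prod_(u <- additions (level_word bs))
    \prod_(d <- removals (level_word bs)) (if d.2 < u.2 then exchange_factor u d else 1).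
Proof.
elim: bs => [|b bs IHbs] /=; first by rewrite big_nil.
rewrite IHbs; case: b => /=.
  rewrite big_cons mulrC; congr (_ * _); apply: eq_big_seq => d.
  rewrite mem_filter => /andP[_ /level_word_le/andP[_ le_d]].
  by rewrite (_ : d.2 < _) //=; move: (d.2) le_d => x; lia.
rewrite mulr1; apply: eq_big_seq => u.
rewrite mem_filter => /andP[_ /level_word_le/andP[_ le_u]].
by rewrite big_cons ifF ?mul1r //=; apply/negP; move: (u.2) le_u => x; lia.
Qed.

Lemma inversions_pos_level bs : inversions_pos (level_word bs).
Proof.
elim: bs => //= b bs ->; case: b => //=; apply/allP => d.
rewrite mem_filter => /andP[_ /level_word_le/andP[_ le_d]].
by move: (d.2) le_d => x; lia.
Qed.

(** The cyclic distance from an addition to a removal. *)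
Definition gap (t : nat) (u d : letter) : nat :=
  `|(if d.2 < u.2 then u.2 - d.2 else u.2 - d.2 + t%:Z)%R|%N.

Definition gaps (bs : seq bool) : seq nat :=
  [seq gap (size bs) u d | u <- additions (level_word bs), d <- removals (level_word bs)].

(** During the sorting an addition meets a given removal once if it is in front
    of it, and during the later turns once per turn, the exponent growing by [t]
    from one encounter to the next: these are the factors of the product. *)
Lemma exchange_qpoch t (u d : letter) n N : 0 < u.2 <= t%:Z -> 0 < d.2 <= t%:Z -> (n < N)%N ->
  eq_upto n (qpoch_inf ('q ^+ gap t u d) ('q ^+ t))
    ((if d.2 < u.2 then exchange_factor u d else 1) *
     \prod_(m < N) exchange_factor u (shift_times t%:Z m.+1 d)).
Proof.
move=> u_t d_t lt_nN; have t_gt0 : (0 < t)%N by move: (u.2) u_t => x; lia.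
have q0 : ('q ^+ t : fps int)``_0 = 0 by apply: fps_qX0.
have exchE m : exchange_factor u (shift_times t%:Z m.+1 d) =
    1 - 'q ^+ (`|(u.2 - d.2 + t%:Z)%R|%N + t * m).
  congr (1 - 'q ^+ _); rewrite /= mulnC -[(m * t)%N]/(`|(m%:Z * t%:Z)%R|%N).
  have : 0 <= m%:Z * t%:Z by rewrite mulr_ge0.
  rewrite (_ : t%:Z * m.+1%:Z = m%:Z * t%:Z + t%:Z); last first.
    by rewrite (_ : m.+1%:Z = m%:Z + 1); [ring | lia].
  by move: (_ * _) (u.2) u_t (d.2) d_t => s x xt y yt; lia.
rewrite (eq_bigr _ (fun (m : 'I_N) _ => exchE m)) /gap; case: ifP => lt_du.
  apply: eq_upto_trans (qpoch_inf_upto _ q0 (leqW lt_nN)) _.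
  rewrite /qpoch big_mkord big_ord_recl expr0 mulr1.
  apply: eq_uptoM => //; apply: eq_upto_prod => m _; rewrite -exprM -exprD.
  suff -> : (`|(u.2 - d.2)%R| + t * bump 0 m = `|(u.2 - d.2 + t%:Z)%R| + t * m)%N by [].
  rewrite /bump leq0n mulnDr muln1 addnA; congr addn.
  by move: (u.2) (d.2) lt_du => x y xy; lia.
rewrite mul1r; apply: eq_upto_trans (qpoch_inf_upto _ q0 lt_nN) _.
by rewrite /qpoch big_mkord; apply: eq_upto_prod => m _; rewrite -exprM -exprD.
Qed.

(** Borodin's product formula: sorting the word and then turning the removals
    round the cycle forever leaves the constant chains. *)
Lemma level_word_series bs : let t := size bs in let w := level_word bs in
  (0 < size (additions w))%N -> chain_tame t%:Z w ->
  \prod_(e <- gaps bs) qpoch_inf ('q ^+ e) ('q ^+ t) * chain_series t%:Z w =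
  gseries nparts (pweight t%:Z).
Proof.
move=> t w us_gt0 tw; have t_gt0 : 0 < t%:Z by move: us_gt0; rewrite /t /w; case: (bs).
have usP : all (fun l : letter => l.1) (additions w) by apply: filter_all.
have dsP : all (fun l : letter => ~~ l.1) (removals w) by apply: filter_all.
have bounds l : l \in additions w \/ l \in removals w -> 0 < l.2 <= t%:Z.
  by rewrite !mem_filter => -[] /andP[_ /level_word_le].
have pos : {in additions w & removals w, forall u d, 0 < u.2 - d.2 + t%:Z}.
  move=> u d uP dP; have := bounds u (or_introl uP); have := bounds d (or_intror dP).
  by move: (u.2) (d.2) (t) => x y z; lia.
apply/fpsP => n; have [N0 limN] := chain_series_limit n t_gt0 usP dsP us_gt0.
pose N := maxn N0 n.+1; have lt_nN : (n < N)%N by rewrite leq_maxr.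
rewrite -(limN N) ?leq_maxl //.
have [_ <-] := reduces_trans (@reduces_sort t%:Z w [::] (inversions_pos_level bs))
  (reduces_cycles N t_gt0 usP dsP pos) tw.
apply: (@eq_uptoM n _ _ _ _ _ (@eq_upto_refl _ _)) => //.
rewrite inversion_factor_level -big_split big_allpairs_dep big_seq [X in eq_upto _ _ X]big_seq.
apply: eq_upto_prod => u uP; rewrite -big_split big_seq [X in eq_upto _ _ X]big_seq.
by apply: eq_upto_prod => d dP; apply: exchange_qpoch; rewrite ?bounds; auto.
Qed.

(** The factors are sorted by the residues of their exponents modulo [t]. *)
Lemma qpoch_inf_residues t : (0 < t)%N ->
  qpoch_inf 'q 'q = \prod_(1 <= e < t.+1) qpoch_inf ('q ^+ e) ('q ^+ t) :> fps int.
Proof.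
move=> t_gt0; apply: eq_upto_fps => n.
have q0 : ('q ^+ t : fps int)``_0 = 0 by apply: fps_qX0.
have q1 : ('q : fps int)``_0 = 0 by [].
apply: eq_upto_trans (qpoch_inf_upto (m := t * n.+1) _ q1 _) _; first by rewrite leq_pmull.
have E N : qpoch 'q 'q (t * N) =
    \prod_(1 <= e < t.+1) qpoch ('q ^+ e) ('q ^+ t) N :> fps int.
  elim: N => [|N IHN].
    by rewrite muln0 [LHS]/qpoch big_geq // big1 // => e _; rewrite /qpoch big_geq.
  under eq_bigr => e _ do rewrite qpochS.
  rewrite big_split -IHN /qpoch mulnS addnC (big_cat_nat (n := t * N)) ?leq_addr //=.
  congr (_ * _); rewrite big_add1 -{1}[(t * N)%N]add0n (addnC (t * N)%N) big_addn addnK.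
  by apply: eq_bigr => e _; rewrite -exprS -exprM -exprD addSn.
rewrite E; apply: eq_upto_prod => e _.
by apply: eq_upto_sym; apply: qpoch_inf_upto.
Qed.

(** Among the factors of the product formula there is one for each residue
    $1,\dots,t-1$; together with the factor of the constant chains they cancel
    $(q;q)_\infty$, and [s] lists those that remain. *)
Lemma cyl_G1_product k (c : k.-tuple nat) t (s : seq nat) :
  let bs := mkseq (rises c) t in
  [&& (0 < k)%N, t == period c, (0 < count id bs)%N, all (leq 1) s &
      perm_eq (gaps bs) (iota 1 t.-1 ++ s)] ->
  cyl_G1 c = 1 / qpochs_inf [seq 'q ^+ e | e <- s] ('q ^+ t).
Proof.
move=> bs /and5P[k_gt0 /eqP tE bs_up s_gt0 gapsE]; have [] := cyl_chain_series c k_gt0.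
rewrite /cyl_word -tE -/bs => tw E.
have t_gt0 : (0 < t)%N by rewrite tE; apply: period_gt0; rewrite size_tuple.
have szbs : size bs = t by rewrite size_mkseq.
have q0 : ('q ^+ t : fps int)``_0 = 0 by apply: fps_qX0.
have ups : (0 < size (additions (level_word bs)))%N.
  rewrite size_filter; move: bs_up; congr (0 < _)%N.
  by elim: (bs) => //= b bs' ->.
have := level_word_series ups; rewrite szbs => /(_ tw).
rewrite (perm_big _ gapsE) big_cat /= -E => prodE.
have := euler t_gt0; rewrite -prodE => eulerE.
have U : qpochs_inf [seq 'q ^+ e | e <- s] ('q ^+ t) \is a @GRing.unit (fps int).
  rewrite /qpochs_inf big_map big_seq; apply: rpred_prod => e /(allP s_gt0) e_gt0.
  by apply: qpoch_inf_unit => //; apply: fps_qX0.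
apply: (mulIr U); rewrite divrK // cyl_G1E (qpoch_inf_residues t_gt0) -[RHS]eulerE.
rewrite big_nat_recr //= /qpochs_inf big_map /index_iota subn1 /=.
by ring.
Qed.

Theorem theorem2p4 :
  [/\ cyl_G1 [tuple 5; 0; 0]%N =
        qsum4 (fun n1 n2 n3 n4 =>
          'q ^+ (Qexp n1 n2 n3 n4 + n1 + n2 + n3 + n4) * Bterm n1 n2 n3 n4) /\
      cyl_G1 [tuple 5; 0; 0]%N =
        1 / qpochs_inf [:: 'q ^+ 2; 'q ^+ 3; 'q ^+ 3; 'q ^+ 4;
                           'q ^+ 4; 'q ^+ 5; 'q ^+ 5; 'q ^+ 6] ('q ^+ 8),
      [/\ cyl_G1 [tuple 4; 1; 0]%N =
            qsum4 (fun n1 n2 n3 n4 =>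
              'q ^+ (Qexp n1 n2 n3 n4 + n2 + n3 + n4) * Bterm n1 n2 n3 n4),
          cyl_G1 [tuple 4; 1; 0]%N = cyl_G1 [tuple 4; 0; 1]%N,
          cyl_G1 [tuple 4; 0; 1]%N =
            qsum4 (fun n1 n2 n3 n4 =>
              'q ^+ (Qexp n1 n2 n3 n4 + n1 + n3) *
              (1 + 'q ^+ (n1 + n2 + n4 + 1)) * Bterm n1 n2 n3 n4) &
          cyl_G1 [tuple 4; 0; 1]%N =
            1 / qpochs_inf [:: 'q; 'q ^+ 2; 'q ^+ 3; 'q ^+ 4;
                               'q ^+ 4; 'q ^+ 5; 'q ^+ 6; 'q ^+ 7] ('q ^+ 8)],
      [/\ cyl_G1 [tuple 3; 0; 2]%N =
            qsum4 (fun n1 n2 n3 n4 =>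
              'q ^+ (Qexp n1 n2 n3 n4 + n1) *
              (1 + 'q ^+ (n1 + n3 + 1)
                 + 'q ^+ (2 * n1 + n2 + n3 + n4 + 2)) * Bterm n1 n2 n3 n4),
          cyl_G1 [tuple 3; 0; 2]%N = cyl_G1 [tuple 3; 2; 0]%N,
          cyl_G1 [tuple 3; 2; 0]%N =
            qsum4 (fun n1 n2 n3 n4 =>
              'q ^+ (Qexp n1 n2 n3 n4 + n1) *
              ('q ^+ n3 + 'q ^+ (n1 + 1) + 'q ^+ (2 * n1 + n3 + 2)
                 + 'q ^+ (3 * n1 + n2 + n3 + n4 + 3)) * Bterm n1 n2 n3 n4) &
          cyl_G1 [tuple 3; 2; 0]%N =
            1 / qpochs_inf [:: 'q; 'q ^+ 2; 'q ^+ 2; 'q ^+ 3;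
                               'q ^+ 5; 'q ^+ 6; 'q ^+ 6; 'q ^+ 7] ('q ^+ 8)],
      cyl_G1 [tuple 3; 1; 1]%N =
        qsum4 (fun n1 n2 n3 n4 =>
          'q ^+ (Qexp n1 n2 n3 n4 + n3) * Bterm n1 n2 n3 n4) /\
      cyl_G1 [tuple 3; 1; 1]%N =
        1 / qpochs_inf [:: 'q; 'q; 'q ^+ 3; 'q ^+ 3;
                           'q ^+ 5; 'q ^+ 5; 'q ^+ 7; 'q ^+ 7] ('q ^+ 8) &
      cyl_G1 [tuple 2; 2; 1]%N =
        qsum4 (fun n1 n2 n3 n4 =>
          'q ^+ Qexp n1 n2 n3 n4 * Bterm n1 n2 n3 n4) /\
      cyl_G1 [tuple 2; 2; 1]%N =
        1 / qpochs_inf [:: 'q; 'q; 'q ^+ 2; 'q ^+ 4;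
                           'q ^+ 4; 'q ^+ 6; 'q ^+ 7; 'q ^+ 7] ('q ^+ 8)].
Proof.
have P500 := @cyl_G1_product 3 [tuple 5; 0; 0]%N 8 [:: 2; 3; 3; 4; 4; 5; 5; 6]%N isT.
have P410 := @cyl_G1_product 3 [tuple 4; 1; 0]%N 8 [:: 1; 2; 3; 4; 4; 5; 6; 7]%N isT.
have P401 := @cyl_G1_product 3 [tuple 4; 0; 1]%N 8 [:: 1; 2; 3; 4; 4; 5; 6; 7]%N isT.
have P302 := @cyl_G1_product 3 [tuple 3; 0; 2]%N 8 [:: 1; 2; 2; 3; 5; 6; 6; 7]%N isT.
have P320 := @cyl_G1_product 3 [tuple 3; 2; 0]%N 8 [:: 1; 2; 2; 3; 5; 6; 6; 7]%N isT.
have P311 := @cyl_G1_product 3 [tuple 3; 1; 1]%N 8 [:: 1; 1; 3; 3; 5; 5; 7; 7]%N isT.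
have P221 := @cyl_G1_product 3 [tuple 2; 2; 1]%N 8 [:: 1; 1; 2; 4; 4; 6; 7; 7]%N isT.
split; first by split; [exact: cyl_G1_500 | exact: P500].
- by split; [exact: cyl_G1_410 | rewrite P410 P401 | exact: cyl_G1_401 | exact: P401].
- by split; [exact: cyl_G1_302 | rewrite P302 P320 | exact: cyl_G1_320 | exact: P320].
- by split; [exact: cyl_G1_311 | exact: P311].
- by split; [exact: cyl_G1_221 | exact: P221].
Qed.
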